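(* (Inner bound, decode-and-forward, one confidential and one common message.) Let $(U,V,X,X_1,Y,Y_1,Z)$ be random variables on finite alphabets with joint distribution of the form $P_{Y,Z,Y_1|X,X_1}(y,z,y_1|x,x_1)\,P_{X,X_1|U,V}(x,x_1|u,v)\,P_{U,V}(u,v)$, with $P_{Y,Z,Y_1|X,X_1}$ the channel. Write $M=\min\{I(U;Y_1|X_1),I(U,X_1;Y),I(U,X_1;Z)\}$. Then every triple $(R_0,R_1,R_e)$ of positive reals with $$R_e\le R_1,\quad R_0\le M,\quad R_0+R_1\le M+I(V;Y|U,X_1),\quad R_e\le I(V;Y|U,X_1)-I(V;Z|U,X_1)$$ belongs to $\mathcal R^{(C)}$.
   Context: Discrete memoryless relay broadcast channel with one confidential message and one common message: finite alphabets $\mathcal X,\mathcal X_1,\mathcal Y,\mathcal Y_1,\mathcal Z$ and a transition probability $p(y,y_1,z|x,x_1)$, used memorylessly over $N$ channel uses. $X$ is the transmitter input, $X_1$ the relay input, $Y$ the output at receiver 1, $Y_1$ the output at the relay, $Z$ the output at receiver 2. Messages $W_0$ (common) and $W_1$ (confidential) are independent and uniform over finite sets $\mathcal W_0,\mathcal W_1$. A code of length $N$: a stochastic encoder mapping $(w_0,w_1)$ to $x^N$; a stochastic relay encoder producing $x_{1,i}$ from $(y_{1,1},\dots,y_{1,i-1})$; a decoder at receiver 1 mapping $y^N$ to an estimate of $(W_0,W_1)$ with error probability $P_{e1}$; a decoder at receiver 2 mapping $z^N$ to an estimate of $W_0$ with error probability $P_{e2}$. Equivocation $\Delta=\frac1N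 H(W_1|Z^N)$. A triple $(R_0,R_1,R_e)$ of positive reals is achievable if for every $\epsilon>0$ there exist codes with $\lim_N\frac{\log|\mathcal W_j|}{N}=R_j$ ($j=0,1$), $\lim_N\Delta\ge R_e$, $P_{e1},P_{e2}\le\epsilon$. $\mathcal R^{(C)}$ is the set of achievable triples. Logarithms are base 2. *)

(* Defs.v *)
From Stdlib Require Import Reals.
From HB Require Import structures.
From mathcomp Require Import all_boot.

Set Implicit Arguments.
Unset Strict Implicit.
Unset Printing Implicit Defensive.

Local Open Scope R_scope.

Definition log2 (x : R) : R := ln x / ln 2.

(** a * log2 b, with the convention 0 log(.) = 0 *)
Definition plogq (a b : R) : R := if Rlt_dec 0 a then a * log2 b else 0.

Definition marg (T S : finType) (p : T -> R) (f : T -> S) (s : S) : R :=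
  \big[Rplus/0]_(t : T | f t == s) p t.

Definition cond_mutinfo (T A B C : finType) (p : T -> R)
  (fA : T -> A) (fB : T -> B) (fC : T -> C) : R :=
  \big[Rplus/0]_(abc : A * B * C)
    plogq (marg p (fun t => (fA t, fB t, fC t)) abc)
      (marg p (fun t => (fA t, fB t, fC t)) abc * marg p fC abc.2
        / (marg p (fun t => (fA t, fC t)) (abc.1.1, abc.2)
           * marg p (fun t => (fB t, fC t)) (abc.1.2, abc.2))).

Definition mutinfo (T A B : finType) (p : T -> R) (fA : T -> A) (fB : T -> B) : R :=
  cond_mutinfo p fA fB (fun _ => tt).

Definition cond_entropy (T A C : finType) (p : T -> R) (fA : T -> A) (fC : T -> C) : R :=
  - \big[Rplus/0]_(ac : A * C)
      plogq (marg p (fun t => (fA t, fC t)) ac)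
            (marg p (fun t => (fA t, fC t)) ac / marg p fC ac.2).

Definition is_channel (X X1 Y Y1 Z : finType) (W : X -> X1 -> Y -> Y1 -> Z -> R) : Prop :=
  (forall x x1 y y1 z, 0 <= W x x1 y y1 z) /\
  (forall x x1, \big[Rplus/0]_(yy : Y * Y1 * Z) W x x1 yy.1.1 yy.1.2 yy.2 = 1).

(** A length-N code with message sets 'I_M0 (common) and 'I_M1 (confidential):
    - enc w0 w1 xN        : stochastic encoder, probability of x^N given (w0,w1)
    - relay i y1N x1N a   : probability that the relay sends x_{1,i} = a given its
                            past observations; must depend only on the coordinates
                            j < i of y1N (and of its own past inputs x1N), see
                            [valid_code] (causality)
    - dec1 yN             : estimate of (W0,W1) at receiver 1
    - dec2 zN             : estimate of W0 at receiver 2 *)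
Record code (X X1 Y Y1 Z : finType) (N M0 M1 : nat) := Code {
  enc : 'I_M0 -> 'I_M1 -> {ffun 'I_N -> X} -> R;
  relay : 'I_N -> {ffun 'I_N -> Y1} -> {ffun 'I_N -> X1} -> X1 -> R;
  dec1 : {ffun 'I_N -> Y} -> 'I_M0 * 'I_M1;
  dec2 : {ffun 'I_N -> Z} -> 'I_M0
}.

Definition valid_code (X X1 Y Y1 Z : finType) (N M0 M1 : nat)
  (c : code X X1 Y Y1 Z N M0 M1) : Prop :=
  (0 < M0)%N /\ (0 < M1)%N /\
  (forall w0 w1 xN, 0 <= enc c w0 w1 xN) /\
  (forall w0 w1, \big[Rplus/0]_(xN : {ffun 'I_N -> X}) enc c w0 w1 xN = 1) /\
  (forall i y1N x1N a, 0 <= relay c i y1N x1N a) /\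
  (forall i y1N x1N, \big[Rplus/0]_(a : X1) relay c i y1N x1N a = 1) /\
  (forall (i : 'I_N) (y1N y1N' : {ffun 'I_N -> Y1}) (x1N x1N' : {ffun 'I_N -> X1}),
     (forall j : 'I_N, (j < i)%N -> y1N j = y1N' j /\ x1N j = x1N' j) ->
     relay c i y1N x1N = relay c i y1N' x1N').

Definition code_space (X X1 Y Y1 Z : finType) (N M0 M1 : nat) : finType :=
  ('I_M0 * 'I_M1 * {ffun 'I_N -> X} * {ffun 'I_N -> X1} * {ffun 'I_N -> Y}
   * {ffun 'I_N -> Y1} * {ffun 'I_N -> Z})%type.

Definition code_joint (X X1 Y Y1 Z : finType) (W : X -> X1 -> Y -> Y1 -> Z -> R)
  (N M0 M1 : nat) (c : code X X1 Y Y1 Z N M0 M1)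
  (t : code_space X X1 Y Y1 Z N M0 M1) : R :=
  let: (w0, w1, xN, x1N, yN, y1N, zN) := t in
  / (INR M0 * INR M1) * enc c w0 w1 xN *
  \big[Rmult/1]_(i : 'I_N)
     (relay c i y1N x1N (x1N i) * W (xN i) (x1N i) (yN i) (y1N i) (zN i)).

Definition Pe1 (X X1 Y Y1 Z : finType) (W : X -> X1 -> Y -> Y1 -> Z -> R)
  (N M0 M1 : nat) (c : code X X1 Y Y1 Z N M0 M1) : R :=
  \big[Rplus/0]_(t : code_space X X1 Y Y1 Z N M0 M1
                  | dec1 c t.1.1.2 != (t.1.1.1.1.1.1, t.1.1.1.1.1.2))
     code_joint W c t.

Definition Pe2 (X X1 Y Y1 Z : finType) (W : X -> X1 -> Y -> Y1 -> Z -> R)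
  (N M0 M1 : nat) (c : code X X1 Y Y1 Z N M0 M1) : R :=
  \big[Rplus/0]_(t : code_space X X1 Y Y1 Z N M0 M1
                  | dec2 c t.2 != t.1.1.1.1.1.1)
     code_joint W c t.

Definition equivocation (X X1 Y Y1 Z : finType) (W : X -> X1 -> Y -> Y1 -> Z -> R)
  (N M0 M1 : nat) (c : code X X1 Y Y1 Z N M0 M1) : R :=
  / INR N * cond_entropy (code_joint W c)
      (fun t : code_space X X1 Y Y1 Z N M0 M1 => t.1.1.1.1.1.2)
      (fun t : code_space X X1 Y Y1 Z N M0 M1 => t.2).

Definition achievable (X X1 Y Y1 Z : finType) (W : X -> X1 -> Y -> Y1 -> Z -> R)
  (R0 R1 Re : R) : Prop :=
  0 < R0 /\ 0 < R1 /\ 0 < Re /\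
  forall eps : R, 0 < eps ->
  exists (M0 M1 : nat -> nat) (c : forall N : nat, code X X1 Y Y1 Z N (M0 N) (M1 N)),
    (forall N, valid_code (c N)) /\
    Un_cv (fun N => log2 (INR (M0 N)) / INR N) R0 /\
    Un_cv (fun N => log2 (INR (M1 N)) / INR N) R1 /\
    (exists L, Un_cv (fun N => equivocation W (c N)) L /\ Re <= L) /\
    (exists N0 : nat, forall N : nat, (N0 <= N)%N ->
        Pe1 W (c N) <= eps /\ Pe2 W (c N) <= eps).

Definition is_pmf2 (U V : finType) (P : U -> V -> R) : Prop :=
  (forall u v, 0 <= P u v) /\ \big[Rplus/0]_(uv : U * V) P uv.1 uv.2 = 1.

Definition is_cond2 (U V X X1 : finType) (PX : U -> V -> X -> X1 -> R) : Prop :=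
  (forall u v x x1, 0 <= PX u v x x1) /\
  (forall u v, \big[Rplus/0]_(xx : X * X1) PX u v xx.1 xx.2 = 1).

Definition joint7 (U V X X1 Y Y1 Z : finType) (PUV : U -> V -> R)
  (PX : U -> V -> X -> X1 -> R) (W : X -> X1 -> Y -> Y1 -> Z -> R)
  (t : U * V * X * X1 * Y * Y1 * Z) : R :=
  let: (u, v, x, x1, y, y1, z) := t in
  PUV u v * PX u v x x1 * W x x1 y y1 z.

Section Proj.
Context {U V X X1 Y Y1 Z : finType}.
Definition prU (t : U * V * X * X1 * Y * Y1 * Z) : U := t.1.1.1.1.1.1.
Definition prV (t : U * V * X * X1 * Y * Y1 * Z) : V := t.1.1.1.1.1.2.
Definition prX1 (t : U * V * X * X1 * Y * Y1 * Z) : X1 := t.1.1.1.2.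
Definition prY (t : U * V * X * X1 * Y * Y1 * Z) : Y := t.1.1.2.
Definition prY1 (t : U * V * X * X1 * Y * Y1 * Z) : Y1 := t.1.2.
Definition prZ (t : U * V * X * X1 * Y * Y1 * Z) : Z := t.2.
Definition prUX1 (t : U * V * X * X1 * Y * Y1 * Z) : U * X1 := (prU t, prX1 t).
End Proj.

(* Main.v *)
(** Block Markov superposition coding with decode-and-forward. In each block the transmitter
    superposes the new common index on the previous one, which the relay has just decoded
    and resends, and then a satellite codeword [v]. The relay decodes forward, the two
    receivers decode the common indices backward, and receiver 1 then finds the satellite.
    Each decoder is a likelihood ratio test, so that the expectation of an error over the
    random codebook is a power of a one-letter expectation: less than 1 by Chernoff's bound
    for the true codeword, and the inverse of the threshold for a wrong one.

    The satellite index consists of a secret part and of a randomizing part (a piece of the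
    confidential message and dummy bits) whose rate is exactly [I(V;Z|U,X1)]. Receiver 2
    could thus decode the randomizing part if it were told the secret. This yields both a
    lower bound on the equivocation, the information on the whole satellite being at most
    [N I(V;Z|U,X1)] on average over the codebooks, and an upper bound. The equivocation
    therefore converges, to the rate of the secret part.

    The true law of a code and the ideal law, under which the relay never errs, coincide
    outside of the error event, so everything is computed with the latter. *)

(* Achievability prescribes the limits of both rates and asks that the equivocation have a limit, so
   bounds up to a tolerance do not suffice: two-sided estimates are needed at every large length,
   then a single sequence of codes with vanishing tolerance. The input law is given with [X] and
   [X1] conditioned on [U] and [V], whereas superposition draws the relay letter first. The law is
   factored anew in the order [X1], [U], [V], [X]; the last factor is a prefix channel simulated by
   the stochastic encoder. The relay feeds past outputs back into its inputs, so the true law of a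
   code is not a product over time. The ideal law is one, once the codebook and the data are fixed,
   and this is what reduces every estimate to one letter. The idle indices at both ends waste about
   one block in [B.+1]. The number of blocks is therefore chosen from the tolerance alone, and only
   the block length grows with [N]. *)
Require Import Defs.
From Stdlib Require Import Reals.
From HB Require Import structures.
From mathcomp Require Import all_boot all_order all_algebra.
From mathcomp Require Import ring lra.
From mathcomp Require Import Rstruct Rstruct_topology boolp reals sequences exp.

Set Implicit Arguments.
Unset Strict Implicit.
Unset Printing Implicit Defensive.
Import Order.TTheory GRing.Theory Num.Theory.
Local Open Scope ring_scope.

(** * Product laws *)

Section ProductLaws.
Variable R : realType.

Lemma sum_ffun_prod (I T : finType) (F : I -> T -> R) :
  \sum_(f : {ffun I -> T}) \prod_i F i (f i) = \prod_i \sum_t F i t.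
Proof. by rewrite bigA_distr_bigA. Qed.

(** The weights need not be normalized, because [expect_two] inserts an indicator into one of
    them. *)
Lemma sum_ffun_prod_at (I T : finType) (w : I -> T -> R) (F : T -> R) (j : I) :
  \sum_(f : {ffun I -> T}) (\prod_i w i (f i)) * F (f j)
  = (\prod_(i | i != j) \sum_t w i t) * \sum_t w j t * F t.
Proof.
transitivity (\sum_(f : {ffun I -> T})
    \prod_i (w i (f i) * (if i == j then F (f i) else 1))).
  apply: eq_bigr => f _; rewrite big_split /=; congr (_ * _).
  by rewrite (bigD1 j) //= eqxx big1 ?mulr1 // => i /negbTE ->.
rewrite (sum_ffun_prod (fun i t => w i t * (if i == j then F t else 1))).
rewrite (bigD1 j) //= mulrC; congr (_ * _).
  by apply: eq_bigr => i /negbTE ->; apply: eq_bigr => t _; rewrite mulr1.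
by apply: eq_bigr => t _; rewrite eqxx.
Qed.

Lemma expect_one (I T : finType) (w : I -> T -> R) (F : T -> R) (j : I) :
  (forall i, \sum_t w i t = 1) ->
  \sum_(f : {ffun I -> T}) (\prod_i w i (f i)) * F (f j) = \sum_t w j t * F t.
Proof.
by move=> w1; rewrite sum_ffun_prod_at big1 ?mul1r // => i _; rewrite w1.
Qed.

Lemma expect_two (I T : finType) (w : I -> T -> R) (F : T -> T -> R) (j k : I) :
  (forall i, \sum_t w i t = 1) -> j != k ->
  \sum_(f : {ffun I -> T}) (\prod_i w i (f i)) * F (f j) (f k)
  = \sum_t w j t * \sum_t' w k t' * F t t'.
Proof.
move=> w1 jk.
(* The value [t] taken at [j] is fixed by an indicator absorbed into the weight of [j]; what remains
   is an expectation at [k] alone. *)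
transitivity (\sum_t \sum_(f : {ffun I -> T})
   (\prod_i (w i (f i) * (if i == j then (f i == t)%:R else 1))) * F t (f k)).
  rewrite exchange_big /=; apply: eq_bigr => f _.
  rewrite (bigD1 (f j)) //= [X in _ + X]big1 ?addr0 => [|t tj]; last first.
    rewrite (bigD1 j) //= eqxx eq_sym (negbTE tj) mulr0 !mul0r //.
  congr (_ * _); apply: eq_bigr => i _.
  by case: eqP => [->|_]; rewrite ?eqxx mulr1.
apply: eq_bigr => t _.
rewrite (sum_ffun_prod_at (fun i u => w i u * (if i == j then (u == t)%:R else 1))).
congr (_ * _); last first.
  by apply: eq_bigr => u _; rewrite eq_sym (negbTE jk) mulr1.
rewrite (bigD1 j) //= [X in _ * X]big1 => [|i /andP[_ /negbTE ->]]; last first.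
  by rewrite -[RHS](w1 i); apply: eq_bigr => u _; rewrite mulr1.
rewrite mulr1 eqxx (bigD1 t) //= eqxx mulr1 big1 ?addr0 // => u /negbTE ->.
by rewrite mulr0.
Qed.

Lemma sum_ffun_pair (I S T : finType) (F : {ffun I -> S} -> {ffun I -> T} -> R) :
  \sum_a \sum_b F a b
  = \sum_(f : {ffun I -> S * T}) F [ffun i => (f i).1] [ffun i => (f i).2].
Proof.
rewrite pair_big /=.
rewrite (reindex (fun f : {ffun I -> S * T} =>
   ([ffun i => (f i).1], [ffun i => (f i).2]))) //=.
exists (fun p : {ffun I -> S} * {ffun I -> T} => [ffun i => (p.1 i, p.2 i)]).
  by move=> f _; apply/ffunP => i; rewrite !ffunE /=; case: (f i).
by case=> a b _ /=; congr (_, _); apply/ffunP => i; rewrite !ffunE.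
Qed.

(** [S] is typically a block: the coordinates outside of it sum to 1, so codewords of full length
    can be averaged over one block. *)
Lemma sum_pick_prod (I T : finType) (S : pred I) (w v : I -> T -> R) :
  (forall i, \sum_t w i t = 1) ->
  \sum_(f : {ffun I -> T}) (\prod_i w i (f i)) * \prod_(i | S i) v i (f i)
  = \prod_(i | S i) \sum_t w i t * v i t.
Proof.
move=> w1.
transitivity (\sum_(f : {ffun I -> T})
    \prod_i (w i (f i) * (if S i then v i (f i) else 1))).
  by apply: eq_bigr => f _; rewrite big_split /= -big_mkcond.
rewrite (sum_ffun_prod (fun i t => w i t * (if S i then v i t else 1))).
rewrite [RHS]big_mkcond; apply: eq_bigr => i _; case: (S i) => //.
by rewrite -[RHS](w1 i); apply: eq_bigr => t _; rewrite mulr1.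
Qed.

(** The strict bound [0 < w t] will give a codebook all of whose letters have positive probability,
    so that logarithms and ratios make sense. *)
Lemma exists_le_mean (T : finType) (w F : T -> R) (c : R) :
  (forall t, 0 <= w t) -> \sum_t w t = 1 -> \sum_t w t * F t <= c ->
  exists2 t, 0 < w t & F t <= c.
Proof.
move=> w0 w1 Fc.
case: (boolP [exists t, (0 < w t) && (F t <= c)]) => [/existsP[t /andP[]]|].
  by exists t.
rewrite negb_exists => /forallP H; exfalso.
(* Otherwise all terms [w t * (F t - c)] are nonnegative with a sum at most 0; they vanish, and so
   do the weights. *)
have w0' t : w t = 0.
  suff : w t * (F t - c) = 0.
    move/eqP; rewrite mulf_eq0 => /orP[/eqP //|]; rewrite subr_eq0 => /eqP Ft.
    have := H t; rewrite Ft lexx andbT -leNgt => wt.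
    by apply/eqP; rewrite eq_le wt w0.
  have nn u : 0 <= w u * (F u - c).
    have := H u; rewrite negb_and -leNgt -ltNge => /orP[wu|Fu].
      by have -> : w u = 0 by [apply/eqP; rewrite eq_le wu w0]; rewrite mul0r.
    by rewrite mulr_ge0 // subr_ge0 ltW.
  have S0 : \sum_u w u * (F u - c) = 0.
    apply/eqP; rewrite eq_le sumr_ge0 // andbT.
    under eq_bigr do rewrite mulrBr.
    by rewrite sumrB -mulr_suml w1 mul1r subr_le0.
  exact: (psumr_eq0P (fun u _ => nn u) S0).
by move: w1; rewrite big1 // => /esym/eqP; rewrite oner_eq0.
Qed.

Definition upd (I T : finType) (y : {ffun I -> T}) (k : I) (t : T) : {ffun I -> T} :=
  [ffun i => if i == k then t else y i].

(** Exchanging coordinate [k] of [y] with the extra letter [t] is an involution on pairs. After it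
    the second component is free and contributes the factor [#|T|]. *)
Lemma sum_upd (I T : finType) (k : I) (f : {ffun I -> T} -> R) :
  \sum_y \sum_t f (upd y k t) = #|T|%:R * \sum_y f y.
Proof.
rewrite pair_big /=.
rewrite (reindex (fun p : {ffun I -> T} * T => (upd p.1 k p.2, p.1 k))) /=; last first.
  exists (fun p : {ffun I -> T} * T => (upd p.1 k p.2, p.1 k)).
    case=> y t _ /=; rewrite ffunE eqxx; congr (_, _).
    by apply/ffunP => i; rewrite !ffunE; case: eqP => [->|].
  case=> y t _ /=; rewrite ffunE eqxx; congr (_, _).
  by apply/ffunP => i; rewrite !ffunE; case: eqP => [->|].
transitivity (\sum_(p : {ffun I -> T} * T) f p.1).
  apply: eq_bigr => -[y t] _ /=; congr f.
  by apply/ffunP => i; rewrite !ffunE; case: eqP => [->|].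
rewrite -(pair_big xpredT xpredT (fun y (_ : T) => f y)) /= mulr_sumr.
by apply: eq_bigr => y _; rewrite sumr_const mulr_natl.
Qed.

(** A product of kernels with feedback is a probability. Hybrid argument: [F k] uses the kernels
    before time [k] and the uniform law from then on. Passing to [k.+1] preserves the total, since
    coordinate [k] enters no other factor and can be resampled. *)
Lemma causal_total (N : nat) (T : finType) (t0 : T)
    (w : 'I_N -> {ffun 'I_N -> T} -> T -> R) :
  (forall (i : 'I_N) (y y' : {ffun 'I_N -> T}) t,
     (forall j : 'I_N, (j < i)%N -> y j = y' j) -> w i y t = w i y' t) ->
  (forall i y, \sum_t w i y t = 1) ->
  \sum_(y : {ffun 'I_N -> T}) \prod_i w i y (y i) = 1.
Proof.
move=> causal w1.
have T0 : #|T|%:R != 0 :> R by rewrite pnatr_eq0 -lt0n; apply/card_gt0P; exists t0.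
pose F k (y : {ffun 'I_N -> T}) :=
  \prod_(i < N) (if (i < k)%N then w i y (y i) else #|T|%:R^-1).
suff H k : (k <= N)%N -> \sum_y F k y = 1.
  rewrite -[RHS](H N (leqnn N)); apply: eq_bigr => y _.
  by rewrite /F; apply: eq_bigr => i _; rewrite ltn_ord.
elim: k => [_|k IH kN].
  rewrite /F /= (sum_ffun_prod (fun _ (_ : T) => #|T|%:R^-1)) big1 // => i _.
  by rewrite sumr_const -[_^-1 *+ _]mulr_natl mulfV.
rewrite -[RHS](IH (ltnW kN)); apply: (mulfI T0).
pose k' := Ordinal kN; rewrite -!(sum_upd k').
apply: eq_bigr => y _.
pose G := \prod_(i < N | i != k')
  (if (i < k)%N then w i y (y i) else #|T|%:R^-1).
have wE (i : 'I_N) t : (i <= k)%N -> w i (upd y k' t) = w i y.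
  move=> ik; apply: boolp.funext => u; apply: causal => j ji; rewrite ffunE.
  by case: eqP => // E; move: ji; rewrite E ltnNge ik.
have E1 t : F k.+1 (upd y k' t) = w k' y t * G.
  rewrite /F (bigD1 k') //= ltnS leqnn ffunE eqxx wE //; congr (_ * _).
  apply: eq_bigr => i ik; rewrite ffunE (negbTE ik) ltnS leq_eqVlt.
  have -> : (i == k :> nat) = false by apply/negbTE.
  by rewrite orFb; case: ifP => // ik'; rewrite wE // ltnW.
have E2 t : F k (upd y k' t) = #|T|%:R^-1 * G.
  rewrite /F (bigD1 k') //= ltnn; congr (_ * _).
  apply: eq_bigr => i ik; rewrite ffunE (negbTE ik).
  by case: ifP => // ik'; rewrite wE // ltnW.
under eq_bigr do rewrite E1.
under [in RHS]eq_bigr do rewrite E2.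
by rewrite -!mulr_suml w1 sumr_const -[_^-1 *+ _]mulr_natl mulfV.
Qed.

End ProductLaws.

(** * Entropy bounds *)

Lemma ln_le_sub1 (R : realType) (x : R) : 0 < x -> ln x <= x - 1.
Proof.
by move=> x0; have := @le_ln1Dx R (x - 1); rewrite (addrC 1) subrK; apply; lra.
Qed.

Section EntropyBounds.
Variables (R : realType) (G O Wt Zt St : finType) (Pa Pi : G -> O -> R).
Variables (bad : G -> O -> bool) (w : G -> Wt) (z : O -> Zt) (s : Wt -> St).
Variable dec : St -> Zt -> G.
Hypothesis Pa0 : forall g o, 0 <= Pa g o.
Hypothesis Pi0 : forall g o, 0 <= Pi g o.
Hypothesis agree : forall g o, ~~ bad g o -> Pa g o = Pi g o.
Hypothesis Pa1 : \sum_g \sum_o Pa g o = 1.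
Hypothesis Pi1 : \sum_g \sum_o Pi g o = 1.
Hypothesis decP : forall g o, ~~ bad g o -> dec (s (w g)) (z o) = g.

(** [G] stands for the messages with the dummy bits, [O] for all outputs, [Pa] for the true law and
    [Pi] for the ideal one. [dec] is a fictitious receiver 2 which, told the secret part, recovers
    everything. *)
Definition law_wz (a : Wt) (c : Zt) := \sum_(g | w g == a) \sum_(o | z o == c) Pa g o.
Definition law_z (c : Zt) := \sum_a law_wz a c.
Definition equiv_nats := - \sum_a \sum_c law_wz a c * ln (law_wz a c / law_z c).
Definition bad_mass := \sum_g \sum_(o | bad g o) Pi g o.

Lemma law_wz_ge0 a c : 0 <= law_wz a c.
Proof. by apply: sumr_ge0 => g _; apply: sumr_ge0. Qed.

Lemma law_z_ge0 c : 0 <= law_z c.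
Proof. by apply: sumr_ge0 => a _; exact: law_wz_ge0. Qed.

Lemma law_wz_le a c : law_wz a c <= law_z c.
Proof.
rewrite /law_z (bigD1 a) //= lerDl; apply: sumr_ge0 => ? _; exact: law_wz_ge0.
Qed.

Lemma law_wz_ge g o : Pa g o <= law_wz (w g) (z o).
Proof.
rewrite /law_wz (bigD1 g) //= (bigD1 o) //= -addrA lerDl addr_ge0 //.
  by apply: sumr_ge0.
by apply: sumr_ge0 => ? _; apply: sumr_ge0.
Qed.

Lemma law_wz_expect (F : Wt -> Zt -> R) :
  \sum_a \sum_c law_wz a c * F a c = \sum_g \sum_o Pa g o * F (w g) (z o).
Proof.
rewrite [RHS](partition_big w xpredT) //=; apply: eq_bigr => a _.
rewrite (eq_bigr (fun c =>
   \sum_(g | w g == a) \sum_(o | z o == c) Pa g o * F a c)); last first.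
  by move=> c _; rewrite mulr_suml; apply: eq_bigr => g _; rewrite mulr_suml.
rewrite exchange_big /=; apply: eq_bigr => g /eqP <-.
rewrite [RHS](partition_big z xpredT) //=; apply: eq_bigr => c _.
by apply: eq_bigr => o /eqP <-.
Qed.

Lemma law_wz_total : \sum_a \sum_c law_wz a c = 1.
Proof.
rewrite -[RHS]Pa1 -(eq_bigr _ (fun g _ => eq_bigr _ (fun o _ => mulr1 (Pa g o)))).
rewrite -(law_wz_expect (fun _ _ => 1)).
by apply: eq_bigr => a _; apply: eq_bigr => c _; rewrite mulr1.
Qed.

Lemma law_z_total : \sum_c law_z c = 1.
Proof. by rewrite exchange_big law_wz_total. Qed.

Lemma bad_mass_ge0 : 0 <= bad_mass.
Proof. by apply: sumr_ge0 => g _; apply: sumr_ge0. Qed.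

Lemma ok_mass : \sum_g \sum_(o | ~~ bad g o) Pi g o = 1 - bad_mass.
Proof.
rewrite -Pi1 -sumrB; apply: eq_bigr => g _.
by rewrite [in RHS](bigID (bad g)) /= [X in X - _]addrC addrK.
Qed.

(** Two laws of total mass 1 that agree off an event give it the same mass; true error probabilities
    can thus be bounded under the ideal law. *)
Lemma actual_bad_mass : \sum_g \sum_(o | bad g o) Pa g o = bad_mass.
Proof.
have H : \sum_g \sum_(o | ~~ bad g o) Pa g o = 1 - bad_mass.
  rewrite -ok_mass; apply: eq_bigr => g _; apply: eq_bigr => o; exact: agree.
rewrite -[RHS](subKr 1) -H -Pa1 -sumrB; apply: eq_bigr => g _.
by rewrite [in RHS](bigID (bad g)) /= addrK.
Qed.

Lemma actual_le_bad_mass (E : G -> O -> bool) :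
  (forall g o, E g o -> bad g o) -> \sum_g \sum_(o | E g o) Pa g o <= bad_mass.
Proof.
move=> Ebad; rewrite -actual_bad_mass; apply: ler_sum => g _.
rewrite big_mkcond [leRHS]big_mkcond /=; apply: ler_sum => o _.
by case: ifP => [/Ebad ->|_] //; case: ifP.
Qed.

Lemma card_St_gt0 : (0 < #|St|)%N.
Proof.
case: (posnP #|St|) => // St0.
have : \sum_g \sum_o Pa g o = 0.
  by apply: big1 => g _; have := card0_eq St0 (s (w g)); rewrite inE.
by rewrite Pa1 => /eqP; rewrite oner_eq0.
Qed.

Lemma card_Wt_gt0 : (0 < #|Wt|)%N.
Proof.
case: (posnP #|Wt|) => // Wt0.
have : \sum_g \sum_o Pa g o = 0.
  by apply: big1 => g _; have := card0_eq Wt0 (w g); rewrite inE.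
by rewrite Pa1 => /eqP; rewrite oner_eq0.
Qed.

(* The posterior of the message is compared (Gibbs) with the guess that picks the
   secret part uniformly and then trusts the decoder with probability 1/2. *)
Lemma equiv_upper : equiv_nats <= ln #|St|%:R + ln 2 + bad_mass * ln #|Wt|%:R.
Proof.
have S1 : 1 <= #|St|%:R :> R by rewrite ler1n card_St_gt0.
have W1 : 1 <= #|Wt|%:R :> R by rewrite ler1n card_Wt_gt0.
pose q a c : R := ((w (dec (s a) c) == a)%:R + #|Wt|%:R^-1) / (2 * #|St|%:R).
have q0 a c : 0 < q a c.
  rewrite divr_gt0 //; last by lra.
  by rewrite ltr_wpDl ?ler0n // invr_gt0; lra.
have qs c : \sum_a q a c <= 1.
  rewrite -mulr_suml ler_pdivrMr; last by lra.
  rewrite big_split /= sumr_const -[_^-1 *+ _]mulr_natl mulfV; last by apply/eqP; lra.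
  suff : \sum_a (w (dec (s a) c) == a)%:R <= #|St|%:R :> R by lra.
  rewrite (partition_big s xpredT) //= -sum1_card natr_sum.
  apply: ler_sum => t _.
  apply: (@le_trans _ _ (\sum_(a | s a == t) (w (dec t c) == a)%:R)).
    by apply: ler_sum => a /eqP ->.
  rewrite big_mkcond (bigD1 (w (dec t c))) //= big1 ?addr0.
    by case: ifP; rewrite ?eqxx.
  by move=> a; rewrite eq_sym => /negbTE ->; case: ifP.
(* The correction in the last bracket sums to at most 0, as [q] is a subprobability in [a]. *)
have gibbs a c : - (law_wz a c * ln (law_wz a c / law_z c))
    <= law_wz a c * (- ln (q a c)) + (law_z c * q a c - law_wz a c).
  have := law_wz_ge0 a c; rewrite le_eqVlt => /orP[/eqP <-|p0].
    by rewrite !mul0r oppr0 add0r addr0 mulr_ge0 ?law_z_ge0 // ltW.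
  have z0 := lt_le_trans p0 (law_wz_le a c).
  have x0 : 0 < law_z c * q a c / law_wz a c by apply: divr_gt0 => //; apply: mulr_gt0.
  have zq0 : 0 < law_z c * q a c by apply: mulr_gt0.
  have := ln_le_sub1 x0; rewrite (ln_div zq0 p0) (lnM z0 (q0 a c)) (ln_div p0 z0).
  rewrite -(ler_pM2l p0).
  have -> : law_wz a c * (law_z c * q a c / law_wz a c - 1) = law_z c * q a c - law_wz a c.
    by field; rewrite gt_eqF.
  by move=> H; lra.
have step : equiv_nats <= \sum_g \sum_o Pa g o * (- ln (q (w g) (z o))).
  rewrite -(law_wz_expect (fun a c => - ln (q a c))) /equiv_nats -sumrN.
  have -> : \sum_a \sum_c law_wz a c * - ln (q a c)
    = \sum_a \sum_c (law_wz a c * - ln (q a c) + (law_z c * q a c - law_wz a c))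
      + (1 - \sum_c law_z c * \sum_a q a c).
    under [X in _ = X + _]eq_bigr do rewrite big_split sumrB /=.
    rewrite big_split sumrB /= law_wz_total [X in _ + (X - _) + _]exchange_big /=.
    under [X in _ + (X - _) + _]eq_bigr do rewrite -mulr_sumr.
    by ring.
  rewrite -[leLHS]addr0; apply: lerD.
    by apply: ler_sum => a _; rewrite -sumrN; apply: ler_sum.
  rewrite subr_ge0 -law_z_total; apply: ler_sum => c _.
  by rewrite ler_piMr ?law_z_ge0.
apply: (le_trans step).
rewrite -actual_bad_mass mulr_suml.
have -> : ln #|St|%:R + ln 2 = \sum_g \sum_o Pa g o * (ln #|St|%:R + ln 2) :> R.
  under eq_bigr do rewrite -mulr_suml.
  by rewrite -mulr_suml Pa1 mul1r.
rewrite -big_split /=; apply: ler_sum => g _.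
rewrite [X in _ + X]mulr_suml [X in _ + X]big_mkcond -big_split /=.
apply: ler_sum => o _.
(* When decoding succeeds the indicator in [q] is 1. Otherwise its uniform component keeps the extra
   cost below [ln #|Wt|]. *)
have lq : - ln (q (w g) (z o)) <= ln #|St|%:R + ln 2 + (if bad g o then ln #|Wt|%:R else 0).
  have L2 x : 0 < x -> q (w g) (z o) = x / (2 * #|St|%:R) ->
      - ln (q (w g) (z o)) = - ln x + (ln #|St|%:R + ln 2).
    move=> x0 ->; rewrite ln_div ?lnM ?posrE ?mulr_gt0 //; try lra.
  case: ifP => [_|/negbT/decP E].
    rewrite (L2 _ _ erefl); last by rewrite ltr_wpDl ?ler0n // invr_gt0; lra.
    have W0 : 0 < #|Wt|%:R^-1 :> R by rewrite invr_gt0; lra.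
    have : ln #|Wt|%:R^-1 <= ln ((w (dec (s (w g)) (z o)) == w g)%:R + #|Wt|%:R^-1) :> R.
      by rewrite ler_ln ?posrE ?ltr_wpDl ?ler0n ?lerDr.
    rewrite lnV ?posrE; lra.
  rewrite (L2 _ _ erefl); last by rewrite ltr_wpDl ?ler0n // invr_gt0; lra.
  rewrite E eqxx addr0 gerDr oppr_le0 ln_ge0 // lerDl invr_ge0; lra.
apply: (le_trans (ler_wpM2l (Pa0 g o) lq)).
by rewrite mulrDr; case: ifP; rewrite ?mulr0.
Qed.

(** [D] is the ideal joint law of the data and the observation. [Q] will be the same with the output
    law averaged over the satellite, so that it depends only on the cloud codewords; at least [L]
    data share them, whence [LQ]. *)
Variables (D Q : G -> Zt -> R) (L : R).
Hypothesis DE : forall g c, D g c = \sum_(o | z o == c) Pi g o.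
Hypothesis Q0 : forall g c, 0 <= Q g c.
Hypothesis Q1 : \sum_g \sum_c Q g c <= 1.
Hypothesis DQ : forall g c, 0 < D g c -> 0 < Q g c.
Hypothesis L0 : 0 < L.
Hypothesis LQ : forall g c, L * Q g c <= \sum_g' Q g' c.

Lemma D_ge0 g c : 0 <= D g c.
Proof. by rewrite DE sumr_ge0. Qed.

Lemma ideal_sum (F : G -> Zt -> R) g :
  \sum_o Pi g o * F g (z o) = \sum_c D g c * F g c.
Proof.
rewrite (partition_big z xpredT) //=; apply: eq_bigr => c _.
by rewrite DE mulr_suml; apply: eq_bigr => o /eqP ->.
Qed.

(* [ln x <= x - 1] is applied at [x = P(w|z) L Q / D] on correct decodings and at
   [x = Q / D] on the others; as [g] is determined by [w] and [z] when decoding succeeds,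
   the first kind of terms contributes at most 1. *)
Lemma equiv_lower :
  (1 - bad_mass) * ln L - \sum_g \sum_o Pi g o * ln (D g (z o) / Q g (z o)) - 1
  <= equiv_nats.
Proof.
have -> : equiv_nats =
    \sum_g \sum_o Pa g o * - ln (law_wz (w g) (z o) / law_z (z o)).
  rewrite -(law_wz_expect (fun a c => - ln (law_wz a c / law_z c))) /equiv_nats.
  by rewrite -sumrN; apply: eq_bigr => a _; rewrite -sumrN;
     apply: eq_bigr => c _; rewrite mulrN.
pose F g c := law_wz (w g) c * L * Q g c / (law_z c * D g c).
pose X := \sum_g \sum_c (dec (s (w g)) c == g)%:R * (D g c * F g c).
pose Y := \sum_g \sum_c D g c * (Q g c / D g c).
have F0 g c : 0 <= F g c.
  by rewrite divr_ge0 ?mulr_ge0 ?law_wz_ge0 ?law_z_ge0 ?D_ge0 // ltW.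
have Y1 : Y <= 1.
  apply: le_trans Q1; apply: ler_sum => g _; apply: ler_sum => c _.
  have := D_ge0 g c; rewrite le_eqVlt => /orP[/eqP <-|d0]; first by rewrite mul0r.
  by rewrite mulrCA mulfV ?mulr1 // gt_eqF.
have X1 : X <= 1.
  apply: le_trans Q1; rewrite /X exchange_big [leRHS]exchange_big /=.
  apply: ler_sum => c _.
  have := law_z_ge0 c; rewrite le_eqVlt => /orP[/eqP zc|zc].
    rewrite big1 ?sumr_ge0 // => g _.
    by rewrite /F -zc mul0r invr0 !mulr0.
  apply: (@le_trans _ _ (\sum_g (\sum_g' Q g' c) / law_z c *
      ((dec (s (w g)) c == g)%:R * law_wz (w g) c))).
    apply: ler_sum => g _.
    rewrite [leRHS]mulrCA ler_wpM2l ?ler0n //.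
    rewrite [leRHS]mulrC [leRHS]mulrA.
    have := D_ge0 g c; rewrite le_eqVlt => /orP[/eqP d0|d0].
      rewrite /F -d0 mul0r mulr_ge0 ?mulr_ge0 ?law_wz_ge0 ?sumr_ge0 //.
      by rewrite invr_ge0 ltW.
    have -> : D g c * F g c = law_wz (w g) c * (L * Q g c) / law_z c.
      by rewrite /F; field; rewrite !gt_eqF.
    rewrite ler_wpM2r ?invr_ge0 ?(ltW zc) // ler_wpM2l ?law_wz_ge0 //.
  rewrite -mulr_sumr.
  rewrite -[leRHS]mulr1 -mulrA ler_wpM2l ?sumr_ge0 // mulrC ler_pdivrMr // mul1r.
  rewrite (partition_big w xpredT) //= ; apply: ler_sum => a _.
  apply: (@le_trans _ _ (\sum_(g | w g == a) (dec (s a) c == g)%:R * law_wz a c)).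
    by apply: ler_sum => g /eqP ->.
  rewrite -mulr_suml -[leRHS]mul1r ler_wpM2r ?law_wz_ge0 //.
  rewrite big_mkcond (bigD1 (dec (s a) c)) //= big1 ?addr0.
    by case: ifP; rewrite ?eqxx.
  by move=> g; rewrite eq_sym => /negbTE ->; case: ifP.
have key g o : (if bad g o then 0 else Pi g o * ln L)
   - Pi g o * ln (D g (z o) / Q g (z o)) + Pi g o
   - Pi g o * ((dec (s (w g)) (z o) == g)%:R * F g (z o)) - Pi g o * (Q g (z o) / D g (z o))
   <= Pa g o * - ln (law_wz (w g) (z o) / law_z (z o)).
  have rhs0 : 0 <= Pa g o * - ln (law_wz (w g) (z o) / law_z (z o)).
    rewrite mulr_ge0 // oppr_ge0.
    have := law_wz_ge0 (w g) (z o); rewrite le_eqVlt => /orP[/eqP <-|p0].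
      by rewrite mul0r ln0.
    by rewrite ln_le0 // ler_pdivrMr ?mul1r ?law_wz_le ?(lt_le_trans p0) ?law_wz_le.
  have := Pi0 g o; rewrite le_eqVlt => /orP[/eqP p0|p0].
    by rewrite -p0 !mul0r if_same !(subr0, addr0).
  have d0 : 0 < D g (z o).
    rewrite DE; apply: (lt_le_trans p0); rewrite (bigD1 o) //= lerDl; exact: sumr_ge0.
  have q0 := DQ d0.
  rewrite ln_div ?posrE //.
  have FQ0 : 0 <= Pi g o * ((dec (s (w g)) (z o) == g)%:R * F g (z o)).
    by apply: mulr_ge0 => //; apply: mulr_ge0.
  have QD0 : 0 <= Pi g o * (Q g (z o) / D g (z o)).
    by apply: mulr_ge0 => //; apply: divr_ge0 => //; exact: ltW.
  case: ifP => [_|/negbT nb].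
    apply: le_trans rhs0.
    have := ln_le_sub1 (divr_gt0 q0 d0); rewrite (ln_div q0 d0) -(ler_pM2l p0).
    by move=> H; lra.
  have wz0 : 0 < law_wz (w g) (z o).
    by apply: lt_le_trans (law_wz_ge g o); rewrite agree.
  have z0 := lt_le_trans wz0 (law_wz_le (w g) (z o)).
  have x1 : 0 < law_wz (w g) (z o) * L by apply: mulr_gt0.
  have x2 : 0 < law_wz (w g) (z o) * L * Q g (z o) by apply: mulr_gt0.
  have x3 : 0 < law_z (z o) * D g (z o) by apply: mulr_gt0.
  have x0 : 0 < F g (z o) by apply: divr_gt0.
  have lnF : ln (F g (z o)) = ln (law_wz (w g) (z o)) + ln L + ln (Q g (z o))
      - (ln (law_z (z o)) + ln (D g (z o))).
    by rewrite /F (ln_div x2 x3) (lnM x1 q0) (lnM wz0 L0) (lnM z0 d0).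
  have := ln_le_sub1 x0; rewrite lnF -(ler_pM2l p0) => H.
  move: FQ0; rewrite decP // eqxx mul1r agree // (ln_div wz0 z0) => FQ0.
  by lra.
have : \sum_g \sum_o ((if bad g o then 0 else Pi g o * ln L)
   - Pi g o * ln (D g (z o) / Q g (z o)) + Pi g o
   - Pi g o * ((dec (s (w g)) (z o) == g)%:R * F g (z o)) - Pi g o * (Q g (z o) / D g (z o)))
   <= \sum_g \sum_o Pa g o * - ln (law_wz (w g) (z o) / law_z (z o)).
  by apply: ler_sum => g _; apply: ler_sum => o _.
apply: le_trans.
have -> : (1 - bad_mass) * ln L = \sum_g \sum_o (if bad g o then 0 else Pi g o * ln L).
  rewrite -ok_mass mulr_suml; apply: eq_bigr => g _; rewrite mulr_suml big_mkcond.
  by apply: eq_bigr => o _; case: (bad g o).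
under [leRHS]eq_bigr do rewrite !sumrB big_split sumrB /=.
rewrite !sumrB big_split sumrB /= Pi1.
have -> : \sum_g \sum_o Pi g o * ((dec (s (w g)) (z o) == g)%:R * F g (z o)) = X.
  apply: eq_bigr => g _.
  rewrite (ideal_sum (fun g c => (dec (s (w g)) c == g)%:R * F g c)).
  by apply: eq_bigr => c _; rewrite mulrCA.
have -> : \sum_g \sum_o Pi g o * (Q g (z o) / D g (z o)) = Y.
  by apply: eq_bigr => g _; rewrite (ideal_sum (fun g c => Q g c / D g c)).
lra.
Qed.

End EntropyBounds.

(** * Likelihood ratio tests *)

(** As [expR y >= 1 + y], it suffices that [(1 - y + 2 * y ^+ 2) * (1 + y) = 1 + y ^+ 2 * (1 + 2 *
    y)] be at least 1, hence the restriction on [y]. *)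
Lemma expRN_quadratic (R : realType) (y : R) : `|y| <= 2^-1 ->
  expR (- y) <= 1 - y + 2 * y ^+ 2.
Proof.
rewrite ler_norml => /andP[y1 y2].
have e1 := expR_ge1Dx y.
have e0 : 0 < 1 + y by lra.
rewrite expRN; apply: (@le_trans _ _ (1 + y)^-1).
  by rewrite lef_pV2 ?posrE ?expR_gt0.
rewrite -div1r ler_pdivrMr //.
have -> : (1 - y + 2 * y ^+ 2) * (1 + y) = 1 + y ^+ 2 * (1 + 2 * y) by ring.
by rewrite lerDl mulr_ge0 ?sqr_ge0 //; lra.
Qed.

Lemma chernoff (R : realType) (T : finType) (p Y : T -> R) :
  (forall t, 0 <= p t) -> \sum_t p t = 1 -> 0 < \sum_t p t * Y t ->
  exists2 s, 0 < s & \sum_t p t * expR (- (s * Y t)) < 1.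
Proof.
move=> p0 p1; set tau := \sum_t _ => tau0.
pose C := \sum_t `|Y t|.
have YC t : `|Y t| <= C by rewrite /C (bigD1 t) //= lerDl sumr_ge0.
have tC : tau <= C.
  rewrite /tau -[C]mul1r -p1 mulr_suml; apply: ler_sum => t _.
  by rewrite ler_wpM2l // (le_trans (ler_norm _)).
have C0 : 0 < C by lra.
(* The mean is at most [1 - s * tau + 2 * s ^+ 2 * C ^+ 2]; this [s] makes the quadratic term half
   of the linear one. *)
pose s := tau / (4 * C ^+ 2).
have C2 : 0 < C ^+ 2 by rewrite exprn_gt0.
have s0 : 0 < s by rewrite divr_gt0 // mulr_gt0.
have sC2 : s * C ^+ 2 = tau / 4 by rewrite /s; field; rewrite gt_eqF.
have sC : s * C <= 2^-1.
  have -> : s * C = tau / C / 4 by rewrite /s; field; rewrite gt_eqF.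
  have : tau / C <= 1 by rewrite ler_pdivrMr // mul1r.
  by lra.
exists s => //.
apply: (@le_lt_trans _ _ (\sum_t p t * (1 - s * Y t + 2 * (s ^+ 2 * C ^+ 2)))).
  apply: ler_sum => t _; rewrite ler_wpM2l //.
  apply: (le_trans (expRN_quadratic _)).
    by rewrite normrM gtr0_norm // (le_trans _ sC) // ler_wpM2l // ltW.
  rewrite lerD2l ler_wpM2l // exprMn ler_wpM2l ?sqr_ge0 //.
  by rewrite -[Y t ^+ 2]ger0_norm ?sqr_ge0 // normrX lerXn2r ?nnegrE // ltW.
under eq_bigr do rewrite mulrDr mulrBr mulr1 mulrCA.
rewrite big_split sumrB /= p1 -mulr_suml p1 mul1r -mulr_sumr -/tau.
have -> : s ^+ 2 * C ^+ 2 = s * (tau / 4) by rewrite -sC2; ring.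
have := mulr_gt0 s0 tau0; lra.
Qed.

Lemma ln_prod (R : realType) (I : finType) (P : pred I) (f : I -> R) :
  (forall i, 0 < f i) -> ln (\prod_(i | P i) f i) = \sum_(i | P i) ln (f i).
Proof.
move=> f0; apply: esym; apply: (@proj2 (0 < \prod_(i | P i) f i)).
apply: (big_ind2 (fun x y => 0 < y /\ x = ln y)) => //; first by rewrite ln1.
by move=> x y x' y' [y0 ->] [y'0 ->]; rewrite mulr_gt0 // lnM.
Qed.

Section Letter.
Variables (R : realType) (L O Gt Ct Yt : finType).
Variables (pl : L -> R) (k : L -> O -> R) (fG : L -> Gt) (fC : L -> Ct) (fY : O -> Yt).
Hypothesis pl0 : forall l, 0 <= pl l.
Hypothesis pl1 : \sum_l pl l = 1.
Hypothesis k0 : forall l o, 0 <= k l o.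
Hypothesis k1 : forall l, \sum_o k l o = 1.

(* [m_gc], [m_c], [m_gyc], [m_yc] are the marginals of the joint law [pl l * k l o] under
   the letters [g = fG l], [c = fC l] and [y = fY o]. *)
Definition key (l : L) : Gt * Ct := (fG l, fC l).
Definition m_gc (gc : Gt * Ct) := \sum_(l | key l == gc) pl l.
Definition m_c (c : Ct) := \sum_(l | fC l == c) pl l.
Definition m_gyc (gc : Gt * Ct) (y : Yt) :=
  \sum_(l | key l == gc) \sum_(o | fY o == y) pl l * k l o.
Definition m_yc (y : Yt) (c : Ct) :=
  \sum_(l | fC l == c) \sum_(o | fY o == y) pl l * k l o.
Definition num gc y := m_gyc gc y * m_c gc.2.
Definition den gc y := m_gc gc * m_yc y gc.2.
Definition info_density l o := ln (num (key l) (fY o) / den (key l) (fY o)).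
(** The conditional mutual information of [g] and [y] given [c], in nats, as an expectation over
    letters; [infoE] restates it with the marginals. *)
Definition info := \sum_l pl l * \sum_o k l o * info_density l o.

Lemma m_gc_gt0 l : 0 < pl l -> 0 < m_gc (key l).
Proof.
by move=> p0; apply: (lt_le_trans p0); rewrite /m_gc (bigD1 l) //= lerDl sumr_ge0.
Qed.

Lemma m_c_gt0 l : 0 < pl l -> 0 < m_c (fC l).
Proof.
by move=> p0; apply: (lt_le_trans p0); rewrite /m_c (bigD1 l) //= lerDl sumr_ge0.
Qed.

Lemma m_gyc_ge0 gc y : 0 <= m_gyc gc y.
Proof. by apply: sumr_ge0 => l _; apply: sumr_ge0 => o _; rewrite mulr_ge0. Qed.

Lemma m_yc_ge0 y c : 0 <= m_yc y c.
Proof. by apply: sumr_ge0 => l _; apply: sumr_ge0 => o _; rewrite mulr_ge0. Qed.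

Lemma m_gc_ge0 gc : 0 <= m_gc gc.
Proof. by apply: sumr_ge0. Qed.

Lemma m_c_ge0 c : 0 <= m_c c.
Proof. by apply: sumr_ge0. Qed.

Lemma m_gyc_gt0 l o : 0 < pl l -> 0 < k l o -> 0 < m_gyc (key l) (fY o).
Proof.
move=> p0 q0; apply: (lt_le_trans (mulr_gt0 p0 q0)).
rewrite /m_gyc (bigD1 l) //= (bigD1 o) //= -addrA lerDl addr_ge0 //.
  by apply: sumr_ge0 => o' _; rewrite mulr_ge0.
by apply: sumr_ge0 => l' _; apply: sumr_ge0 => o' _; rewrite mulr_ge0.
Qed.

Lemma m_gyc_le gc y : m_gyc gc y <= m_yc y gc.2.
Proof.
case: gc => g c; rewrite /m_gyc /m_yc big_mkcond [leRHS]big_mkcond.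
apply: ler_sum => l _; rewrite /key xpair_eqE /=.
case: (fC l == c); rewrite ?andbT ?andbF //; case: ifP => // _.
by apply: sumr_ge0 => o' _; rewrite mulr_ge0.
Qed.

Lemma m_yc_gt0 l o : 0 < pl l -> 0 < k l o -> 0 < m_yc (fY o) (fC l).
Proof. by move=> p0 q0; exact: lt_le_trans (m_gyc_gt0 p0 q0) (m_gyc_le _ _). Qed.

Lemma num_gt0 l o : 0 < pl l -> 0 < k l o -> 0 < num (key l) (fY o).
Proof. by move=> p0 q0; rewrite mulr_gt0 ?m_gyc_gt0 ?m_c_gt0. Qed.

Lemma den_gt0 l o : 0 < pl l -> 0 < k l o -> 0 < den (key l) (fY o).
Proof. by move=> p0 q0; rewrite mulr_gt0 ?m_yc_gt0 ?m_gc_gt0. Qed.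

Lemma num_ge0 gc y : 0 <= num gc y.
Proof. by rewrite mulr_ge0 ?m_gyc_ge0 ?m_c_ge0. Qed.

Lemma den_ge0 gc y : 0 <= den gc y.
Proof. by rewrite mulr_ge0 ?m_yc_ge0 ?m_gc_ge0. Qed.

Lemma m_gyc_total : \sum_gc \sum_y m_gyc gc y = 1.
Proof.
rewrite -pl1 [RHS](partition_big key xpredT) //=; apply: eq_bigr => gc _.
rewrite exchange_big /=; apply: eq_bigr => l _.
transitivity (\sum_o pl l * k l o); last by rewrite -mulr_sumr k1 mulr1.
by rewrite [RHS](partition_big fY xpredT).
Qed.

Lemma infoE : info =
  \sum_gyc m_gyc (gyc.1.1, gyc.2) gyc.1.2
    * ln (num (gyc.1.1, gyc.2) gyc.1.2 / den (gyc.1.1, gyc.2) gyc.1.2).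
Proof.
rewrite -(pair_bigA _ (fun gy c => m_gyc (gy.1, c) gy.2
    * ln (num (gy.1, c) gy.2 / den (gy.1, c) gy.2))) /=.
rewrite exchange_big /=.
under eq_bigr => c _ do rewrite -(pair_bigA _ (fun g y => m_gyc (g, c) y
    * ln (num (g, c) y / den (g, c) y))) /=.
rewrite exchange_big pair_bigA /= /info.
rewrite (partition_big key xpredT) //=; apply: eq_bigr => -[g c] _ /=.
transitivity (\sum_(l | key l == (g, c)) \sum_y \sum_(o | fY o == y)
    pl l * k l o * ln (num (g, c) y / den (g, c) y)).
  apply: eq_bigr => l /eqP lE; rewrite mulr_sumr (partition_big fY xpredT) //=.
  apply: eq_bigr => y _; apply: eq_bigr => o /eqP <-.
  by rewrite /info_density lE mulrA.
rewrite exchange_big /=; apply: eq_bigr => y _; rewrite /m_gyc mulr_suml.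
by apply: eq_bigr => l _; rewrite mulr_suml.
Qed.

Definition wrong_factor lam l g' :=
  \sum_o k l o * (num (g', fC l) (fY o) / (lam * den (g', fC l) (fY o))).

(** For a competitor drawn given [c] independently of [y], the likelihood ratio is a change of
    measure, of mean at most 1. Equality may fail because ratios with a zero denominator count as
    0. *)
Lemma wrong_factor_mean (Kg : Ct -> Gt -> R) lam : 0 < lam ->
  (forall g c, m_gc (g, c) = m_c c * Kg c g) ->
  \sum_l pl l * \sum_g Kg (fC l) g * wrong_factor lam l g <= lam^-1.
Proof.
move=> lam0 KgE.
pose phi c y := \sum_g Kg c g * (num (g, c) y / (lam * den (g, c) y)).
have -> : \sum_l pl l * \sum_g Kg (fC l) g * wrong_factor lam l g
    = \sum_l \sum_o pl l * k l o * phi (fC l) (fY o).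
  apply: eq_bigr => l _; rewrite mulr_sumr.
  under [RHS]eq_bigr do rewrite /phi mulr_sumr.
  rewrite exchange_big; apply: eq_bigr => g _ /=.
  rewrite mulrCA /wrong_factor !mulr_sumr; apply: eq_bigr => o _; ring.
have -> : \sum_l \sum_o pl l * k l o * phi (fC l) (fY o)
    = \sum_c \sum_y m_yc y c * phi c y.
  rewrite (partition_big fC xpredT) //=; apply: eq_bigr => c _.
  transitivity (\sum_(l | fC l == c) \sum_y
     \sum_(o | fY o == y) pl l * k l o * phi c y).
    apply: eq_bigr => l /eqP <-; rewrite (partition_big fY xpredT) //=.
    by apply: eq_bigr => y _; apply: eq_bigr => o /eqP ->.
  rewrite exchange_big; apply: eq_bigr => y _ /=; rewrite /m_yc mulr_suml.
  by apply: eq_bigr => l _; rewrite mulr_suml.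
rewrite -[leRHS]mulr1 -m_gyc_total mulr_sumr.
rewrite -(pair_bigA _ (fun g c => lam^-1 * \sum_y m_gyc (g, c) y)) /= [leRHS]exchange_big /=.
apply: ler_sum => c _.
under [leRHS]eq_bigr do rewrite mulr_sumr.
rewrite [leRHS]exchange_big; apply: ler_sum => y _ /=; rewrite /phi mulr_sumr.
apply: ler_sum => g _.
rewrite /num /den /=.
have := m_yc_ge0 y c; rewrite le_eqVlt => /orP[/eqP <-|y0].
  by rewrite mul0r mulr_ge0 ?m_gyc_ge0 // invr_ge0 ltW.
have := m_gc_ge0 (g, c); rewrite le_eqVlt => /orP[/eqP <-|g0].
  by rewrite mul0r mulr0 invr0 !mulr0 mulr_ge0 ?m_gyc_ge0 // invr_ge0 ltW.
have -> : m_yc y c * (Kg c g * (m_gyc (g, c) y * m_c c / (lam * (m_gc (g, c) * m_yc y c))))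
   = lam^-1 * (m_gyc (g, c) y) * ((m_c c * Kg c g) / m_gc (g, c)).
  by field; rewrite !gt_eqF.
by rewrite -KgE mulfV ?mulr1 // gt_eqF.
Qed.

Definition fail_factor s lam l := \sum_o k l o * expR (s * (ln lam - info_density l o)).

(** Chernoff's bound for [info_density - ln lam], whose mean is positive. *)
Lemma fail_factor_mean lam : ln lam < info ->
  exists2 s, 0 < s & \sum_l pl l * fail_factor s lam l < 1.
Proof.
move=> lt; pose p (lo : L * O) := pl lo.1 * k lo.1 lo.2.
pose Y (lo : L * O) := info_density lo.1 lo.2 - ln lam.
have p1 : \sum_lo p lo = 1.
  rewrite -(pair_bigA _ (fun l o => p (l, o))) /p /= -pl1.
  by apply: eq_bigr => l _; rewrite -mulr_sumr k1 mulr1.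
have [|//||s s0 H] := @chernoff R (prod L O) p Y.
- by move=> lo; rewrite mulr_ge0.
- rewrite /Y; under eq_bigr do rewrite mulrBr.
  rewrite sumrB -mulr_suml p1 mul1r subr_gt0 (lt_le_trans lt) //.
  rewrite -(pair_bigA _ (fun l o => p (l, o) * info_density l o)) /=.
  by apply: ler_sum => l _; rewrite mulr_sumr; apply: ler_sum => o _; rewrite mulrA.
exists s => //; apply: le_lt_trans H.
rewrite -(pair_bigA _ (fun l o => p (l, o) * expR (- (s * Y (l, o))))) /=.
apply: ler_sum => l _; rewrite mulr_sumr; apply: ler_sum => o _.
by rewrite -mulrN opprB mulrA.
Qed.

Lemma fail_factor_ge0 s lam l : 0 <= fail_factor s lam l.
Proof. by apply: sumr_ge0 => o _; rewrite mulr_ge0 ?expR_ge0. Qed.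

Lemma wrong_factor_ge0 lam l g : 0 < lam -> 0 <= wrong_factor lam l g.
Proof.
move=> lam0; apply: sumr_ge0 => o _.
apply: mulr_ge0 => //; apply: divr_ge0; first exact: num_ge0.
by apply: mulr_ge0; [exact: ltW|exact: den_ge0].
Qed.

Section Sequence.
Variables (N : nat) (S : pred 'I_N) (lam : R).
Hypothesis lam0 : 0 < lam.

(* A likelihood ratio test, cross-multiplied so as not to divide by zero. *)
Definition pass (gc : 'I_N -> Gt * Ct) (y : 'I_N -> Yt) : bool :=
  \prod_(i | S i) (lam * den (gc i) (y i)) < \prod_(i | S i) num (gc i) (y i).

Lemma eq_pass gc gc' y y' : (forall i, S i -> gc i = gc' i) ->
  (forall i, S i -> y i = y' i) -> pass gc y = pass gc' y'.
Proof.
by move=> gE yE; rewrite /pass; congr (_ < _); apply: eq_bigr => i Si; rewrite gE // yE.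
Qed.

(** Markov's inequality in product form: on outputs of positive probability the product of the [phi]
    dominates the indicator of [E]. A missed codeword and a wrong acceptance are both instances. *)
Lemma sequence_markov (li : 'I_N -> L) (phi : 'I_N -> O -> R)
    (E : {ffun 'I_N -> O} -> bool) :
  (forall i o, 0 <= phi i o) ->
  (forall o : {ffun 'I_N -> O}, (forall i, 0 < k (li i) (o i)) -> E o ->
     1 <= \prod_(i | S i) phi i (o i)) ->
  \sum_(o : {ffun 'I_N -> O} | E o) \prod_i k (li i) (o i)
    <= \prod_(i | S i) \sum_o k (li i) o * phi i o.
Proof.
move=> phi0 H; rewrite -sum_pick_prod; last by move=> i; exact: k1.
rewrite big_mkcond; apply: ler_sum => o _.
have P0 : 0 <= \prod_i k (li i) (o i) by apply: prodr_ge0.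
case: ifP => [Eo|_]; last by rewrite mulr_ge0 // prodr_ge0.
move: P0; rewrite le_eqVlt => /orP[/eqP <-|P0]; first by rewrite mul0r.
rewrite ler_peMr //; first exact: ltW.
apply: H => // i; rewrite lt_neqAle k0 andbT eq_sym.
by move: P0; rewrite (bigD1 i) //=; apply: contraTneq => ->; rewrite mul0r ltxx.
Qed.

Lemma true_fail (li : 'I_N -> L) s : 0 < s -> (forall i, 0 < pl (li i)) ->
  \sum_(o : {ffun 'I_N -> O} | ~~ pass (fun i => key (li i)) (fun i => fY (o i)))
     \prod_i k (li i) (o i)
  <= \prod_(i | S i) fail_factor s lam (li i).
Proof.
move=> s0 li0; apply: sequence_markov => [i o|o ko]; first exact: expR_ge0.
rewrite /pass -leNgt => H.
rewrite -expR_sum -mulr_sumr -expR0 ler_expR mulr_ge0 ?(ltW s0) //.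
have -> : \sum_(i | S i) (ln lam - info_density (li i) (o i))
   = ln (\prod_(i | S i) (lam * den (key (li i)) (fY (o i))))
     - ln (\prod_(i | S i) num (key (li i)) (fY (o i))).
  rewrite !ln_prod => [|i|i]; [|exact: num_gt0|by apply: mulr_gt0 => //; exact: den_gt0].
  rewrite -sumrB; apply: eq_bigr => i _.
  have n0 := num_gt0 (li0 i) (ko i); have d0 := den_gt0 (li0 i) (ko i).
  by rewrite /info_density (ln_div n0 d0) (lnM lam0 d0); ring.
have n0 : 0 < \prod_(i | S i) num (key (li i)) (fY (o i)).
  by apply: prodr_gt0 => j _; rewrite num_gt0.
by rewrite subr_ge0 ler_ln ?posrE // (lt_le_trans n0).
Qed.

(** The positivity of the competitor's marginals keeps the denominators nonzero, so passing means
    that the product of the ratios [num / (lam * den)] exceeds 1. *)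
Lemma wrong_pass (li : 'I_N -> L) (g' : 'I_N -> Gt) :
  (forall i, 0 < pl (li i)) -> (forall i, S i -> 0 < m_gc (g' i, fC (li i))) ->
  \sum_(o : {ffun 'I_N -> O} | pass (fun i => (g' i, fC (li i))) (fun i => fY (o i)))
     \prod_i k (li i) (o i)
  <= \prod_(i | S i) wrong_factor lam (li i) (g' i).
Proof.
move=> li0 g0; apply: sequence_markov => [i o|o ko H].
  apply: divr_ge0; first exact: num_ge0.
  by apply: mulr_ge0; [exact: ltW|exact: den_ge0].
have d0 : 0 < \prod_(i | S i) (lam * den (g' i, fC (li i)) (fY (o i))).
  apply: prodr_gt0 => i Si; rewrite mulr_gt0 //.
  by apply: mulr_gt0; [exact: g0|exact: m_yc_gt0].
by rewrite prodf_div ler_pdivlMr // mul1r ltW.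
Qed.

(** Union bound, in the form shared by the five tests: all candidates have the conditioning letters
    [c] of the true one and differ by [g]. *)
Lemma test_error (Q : finType) (q0 : Q) (gc : Q -> 'I_N -> Gt * Ct) (li : 'I_N -> L) s :
  0 < s -> (forall i, 0 < pl (li i)) -> (forall i, S i -> gc q0 i = key (li i)) ->
  (forall q i, S i -> (gc q i).2 = fC (li i)) ->
  (forall q i, S i -> 0 < m_gc (gc q i)) ->
  \sum_(o : {ffun 'I_N -> O} | ~~ pass (gc q0) (fun i => fY (o i))
      || [exists q, (q != q0) && pass (gc q) (fun i => fY (o i))])
     \prod_i k (li i) (o i)
  <= \prod_(i | S i) fail_factor s lam (li i)
     + \sum_(q | q != q0) \prod_(i | S i) wrong_factor lam (li i) (gc q i).1.
Proof.
move=> s0 li0 gc0 gcC gcp.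
have P0 (o : {ffun 'I_N -> O}) : 0 <= \prod_i k (li i) (o i) by apply: prodr_ge0.
apply: (@le_trans _ _
  (\sum_(o : {ffun 'I_N -> O} | ~~ pass (gc q0) (fun i => fY (o i))) \prod_i k (li i) (o i)
  + \sum_(q | q != q0) \sum_(o : {ffun 'I_N -> O} | pass (gc q) (fun i => fY (o i)))
       \prod_i k (li i) (o i))).
  under [X in _ + X]eq_bigr do rewrite big_mkcond.
  rewrite exchange_big big_mkcond [X in X + _]big_mkcond -big_split /=.
  apply: ler_sum => o _.
  case: (~~ pass _ _) => /=.
    by rewrite lerDl sumr_ge0 // => q _; case: ifP.
  rewrite add0r; case: ifP => [/existsP[q /andP[qn qp]]|_]; last first.
    by rewrite sumr_ge0 // => q _; case: ifP.
  by rewrite (bigD1 q) //= qp lerDl sumr_ge0 // => q' _; case: ifP.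
apply: lerD.
  apply: le_trans (true_fail s0 li0); rewrite le_eqVlt; apply/orP; left; apply/eqP.
  by apply: eq_bigl => o; congr (~~ _); exact: eq_pass.
apply: ler_sum => q _.
apply: le_trans (@wrong_pass li (fun i => (gc q i).1) li0 _).
  rewrite le_eqVlt; apply/orP; left; apply/eqP.
  apply: eq_bigl => o; apply: eq_pass => // i Si.
  by rewrite -(gcC q) //; case: (gc q i).
by move=> i Si; rewrite -(gcC q) // -surjective_pairing gcp.
Qed.

End Sequence.
End Letter.

(** * Random superposition codebook *)

Section Codebook.
Variables (R : realType) (A B C M J : finType) (N : nat).
Variables (PA : A -> R) (KB : A -> B -> R) (KC : A -> B -> C -> R).
Hypothesis PA0 : forall a, 0 <= PA a.
Hypothesis PA1 : \sum_a PA a = 1.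
Hypothesis KB0 : forall a b, 0 <= KB a b.
Hypothesis KB1 : forall a, \sum_b KB a b = 1.
Hypothesis KC0 : forall a b c, 0 <= KC a b c.
Hypothesis KC1 : forall a b, \sum_c KC a b c = 1.

Definition letter_law (l : A * B * C) := PA l.1.1 * KB l.1.1 l.1.2 * KC l.1.1 l.1.2 l.2.

Lemma letter_law_ge0 l : 0 <= letter_law l.
Proof. by rewrite !mulr_ge0. Qed.

Lemma sum_letter_law (f : A * B * C -> R) :
  \sum_l letter_law l * f l
  = \sum_a PA a * \sum_b KB a b * \sum_c KC a b c * f (a, b, c).
Proof.
transitivity (\sum_(l : A * B * C) letter_law (l.1.1, l.1.2, l.2) * f (l.1.1, l.1.2, l.2)).
  by apply: eq_bigr => -[[a b] c].
rewrite -(pair_bigA _ (fun ab c => letter_law (ab.1, ab.2, c) * f (ab.1, ab.2, c))) /=.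
rewrite -(pair_bigA _ (fun a b => \sum_c letter_law (a, b, c) * f (a, b, c))) /=.
apply: eq_bigr => a _; rewrite mulr_sumr; apply: eq_bigr => b _.
by rewrite mulrA mulr_sumr; apply: eq_bigr => c _; rewrite /letter_law /= !mulrA.
Qed.

Lemma letter_law_total : \sum_l letter_law l = 1.
Proof.
rewrite (eq_bigr _ (fun l _ => esym (mulr1 _))) sum_letter_law -[RHS]PA1.
apply: eq_bigr => a _; rewrite -[RHS]mulr1; congr (_ * _); rewrite -[RHS](KB1 a).
apply: eq_bigr => b _; rewrite -[RHS]mulr1; congr (_ * _); rewrite -[RHS](KC1 a b).
by apply: eq_bigr => c _; rewrite mulr1.
Qed.

(** Relay codewords are indexed by the previous common index, clouds by the previous and the current
    one, satellites by these two and their own index. *)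
Definition table_A := {ffun M -> {ffun 'I_N -> A}}.
Definition table_B := {ffun M * M -> {ffun 'I_N -> B}}.
Definition table_C := {ffun M * M * J -> {ffun 'I_N -> C}}.

Definition seq_A (a : {ffun 'I_N -> A}) := \prod_i PA (a i).
Definition seq_B (a : {ffun 'I_N -> A}) (b : {ffun 'I_N -> B}) := \prod_i KB (a i) (b i).
Definition seq_C (a : {ffun 'I_N -> A}) (b : {ffun 'I_N -> B}) (c : {ffun 'I_N -> C}) :=
  \prod_i KC (a i) (b i) (c i).

Definition law_A (ta : table_A) := \prod_m seq_A (ta m).
Definition law_B (ta : table_A) (tb : table_B) := \prod_p seq_B (ta p.1) (tb p).
Definition law_C (ta : table_A) (tb : table_B) (tc : table_C) :=
  \prod_q seq_C (ta q.1.1) (tb q.1) (tc q).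

Definition mean (F : table_A -> table_B -> table_C -> R) :=
  \sum_ta law_A ta * \sum_tb law_B ta tb * \sum_tc law_C ta tb tc * F ta tb tc.

Lemma seq_A_total : \sum_a seq_A a = 1.
Proof. by rewrite (sum_ffun_prod (fun=> PA)) big1. Qed.

Lemma seq_B_total a : \sum_b seq_B a b = 1.
Proof. by rewrite (sum_ffun_prod (fun i => KB (a i))) big1. Qed.

Lemma seq_C_total a b : \sum_c seq_C a b c = 1.
Proof. by rewrite (sum_ffun_prod (fun i => KC (a i) (b i))) big1. Qed.

Lemma law_A_total : \sum_ta law_A ta = 1.
Proof. by rewrite (sum_ffun_prod (fun=> seq_A)) big1 // => m _; exact: seq_A_total. Qed.

Lemma law_B_total ta : \sum_tb law_B ta tb = 1.
Proof.
rewrite (sum_ffun_prod (fun p => seq_B (ta p.1))) big1 // => p _; exact: seq_B_total.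
Qed.

Lemma law_C_total ta tb : \sum_tc law_C ta tb tc = 1.
Proof.
rewrite (sum_ffun_prod (fun q => seq_C (ta q.1.1) (tb q.1))) big1 // => q _.
exact: seq_C_total.
Qed.

Definition letters (ta : table_A) (tb : table_B) (tc : table_C) (p m : M) (j : J)
  (i : 'I_N) : A * B * C := (ta p i, tb (p, m) i, tc (p, m, j) i).

Section Means.
Variables (S : pred 'I_N) (p m : M) (j : J).

Lemma mean_true (f : A * B * C -> R) :
  mean (fun ta tb tc => \prod_(i | S i) f (letters ta tb tc p m j i))
  = \prod_(i | S i) \sum_l letter_law l * f l.
Proof.
transitivity (\sum_(ta : table_A) law_A ta * \sum_(tb : table_B) law_B ta tb *
   \prod_(i | S i) \sum_c KC (ta p i) (tb (p, m) i) c * f (ta p i, tb (p, m) i, c)).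
  apply: eq_bigr => ta _; congr (_ * _); apply: eq_bigr => tb _; congr (_ * _).
  rewrite (expect_one (w := fun q => seq_C (ta q.1.1) (tb q.1))
     (fun c : {ffun 'I_N -> C} => \prod_(i | S i) f (ta p i, tb (p, m) i, c i))) /=.
    by rewrite (sum_pick_prod (w := fun i => KC (ta p i) (tb (p, m) i)) S
      (fun i c => f (ta p i, tb (p, m) i, c))).
  by move=> q; exact: seq_C_total.
transitivity (\sum_(ta : table_A) law_A ta *
   \prod_(i | S i) \sum_b KB (ta p i) b * \sum_c KC (ta p i) b c * f (ta p i, b, c)).
  apply: eq_bigr => ta _; congr (_ * _).
  rewrite (expect_one (w := fun q => seq_B (ta q.1)) (fun b : {ffun 'I_N -> B} =>
     \prod_(i | S i) \sum_c KC (ta p i) (b i) c * f (ta p i, b i, c))) /=.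
    by rewrite (sum_pick_prod (w := fun i => KB (ta p i)) S (fun i b =>
      \sum_c KC (ta p i) b c * f (ta p i, b, c))).
  by move=> q; exact: seq_B_total.
rewrite (expect_one (w := fun=> seq_A) (fun a : {ffun 'I_N -> A} =>
   \prod_(i | S i) \sum_b KB (a i) b * \sum_c KC (a i) b c * f (a i, b, c))) /=.
  rewrite (sum_pick_prod (w := fun=> PA) S (fun i a =>
    \sum_b KB a b * \sum_c KC a b c * f (a, b, c))) //.
  by apply: eq_bigr => i _; rewrite sum_letter_law.
by move=> _; exact: seq_A_total.
Qed.

(** With the right previous index, a wrong current one shares the relay codeword: its cloud is fresh
    only conditionally on [A]. *)
Lemma mean_wrong_B (m' : M) (f : A * B * C -> B -> R) : m != m' ->
  mean (fun ta tb tc => \prod_(i | S i) f (letters ta tb tc p m j i) (tb (p, m') i))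
  = \prod_(i | S i) \sum_l letter_law l * \sum_b' KB l.1.1 b' * f l b'.
Proof.
move=> mm'.
transitivity (\sum_(ta : table_A) law_A ta * \sum_(tb : table_B) law_B ta tb *
   \prod_(i | S i) \sum_c KC (ta p i) (tb (p, m) i) c
       * f (ta p i, tb (p, m) i, c) (tb (p, m') i)).
  apply: eq_bigr => ta _; congr (_ * _); apply: eq_bigr => tb _; congr (_ * _).
  rewrite (expect_one (w := fun q => seq_C (ta q.1.1) (tb q.1))
     (fun c : {ffun 'I_N -> C} =>
       \prod_(i | S i) f (ta p i, tb (p, m) i, c i) (tb (p, m') i))) /=.
    by rewrite (sum_pick_prod (w := fun i => KC (ta p i) (tb (p, m) i)) S
      (fun i c => f (ta p i, tb (p, m) i, c) (tb (p, m') i))).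
  by move=> q; exact: seq_C_total.
transitivity (\sum_(ta : table_A) law_A ta *
   \prod_(i | S i) \sum_b KB (ta p i) b * \sum_b' KB (ta p i) b' *
      \sum_c KC (ta p i) b c * f (ta p i, b, c) b').
  apply: eq_bigr => ta _; congr (_ * _).
  rewrite (expect_two (w := fun q => seq_B (ta q.1))
     (fun b b' : {ffun 'I_N -> B} => \prod_(i | S i)
     \sum_c KC (ta p i) (b i) c * f (ta p i, b i, c) (b' i))) /=.
  - transitivity (\sum_b seq_B (ta p) b * \prod_(i | S i) \sum_b' KB (ta p i) b'
        * \sum_c KC (ta p i) (b i) c * f (ta p i, b i, c) b').
      apply: eq_bigr => b _; congr (_ * _).
      by rewrite (sum_pick_prod (w := fun i => KB (ta p i)) S (fun i b' =>
        \sum_c KC (ta p i) (b i) c * f (ta p i, b i, c) b')).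
    by rewrite (sum_pick_prod (w := fun i => KB (ta p i)) S (fun i b =>
       \sum_b' KB (ta p i) b' * \sum_c KC (ta p i) b c * f (ta p i, b, c) b')).
  - by move=> q; exact: seq_B_total.
  - by rewrite xpair_eqE eqxx.
rewrite (expect_one (w := fun=> seq_A) (fun a : {ffun 'I_N -> A} =>
   \prod_(i | S i) \sum_b KB (a i) b * \sum_b' KB (a i) b' *
      \sum_c KC (a i) b c * f (a i, b, c) b')) /=; last first.
  by move=> _; exact: seq_A_total.
rewrite (sum_pick_prod (w := fun=> PA) S (fun i a => \sum_b KB a b *
   \sum_b' KB a b' * \sum_c KC a b c * f (a, b, c) b')) //.
apply: eq_bigr => i _; rewrite sum_letter_law /=.
apply: eq_bigr => a _; congr (_ * _); apply: eq_bigr => b _; congr (_ * _).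
under eq_bigr do rewrite mulr_sumr.
under [RHS]eq_bigr do rewrite mulr_sumr.
rewrite exchange_big; apply: eq_bigr => c _; apply: eq_bigr => b' _.
by rewrite mulrCA.
Qed.

(** A wrong previous index changes both the relay codeword and the cloud, which are independent of
    everything sent. *)
Lemma mean_wrong_A (p' : M) (f : A * B * C -> B * A -> R) : p != p' ->
  mean (fun ta tb tc => \prod_(i | S i)
    f (letters ta tb tc p m j i) (tb (p', m) i, ta p' i))
  = \prod_(i | S i) \sum_l letter_law l * \sum_ba PA ba.2 * KB ba.2 ba.1 * f l ba.
Proof.
move=> pp'.
transitivity (\sum_(ta : table_A) law_A ta * \sum_(tb : table_B) law_B ta tb *
   \prod_(i | S i) \sum_c KC (ta p i) (tb (p, m) i) c
       * f (ta p i, tb (p, m) i, c) (tb (p', m) i, ta p' i)).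
  apply: eq_bigr => ta _; congr (_ * _); apply: eq_bigr => tb _; congr (_ * _).
  rewrite (expect_one (w := fun q => seq_C (ta q.1.1) (tb q.1))
     (fun c : {ffun 'I_N -> C} =>
       \prod_(i | S i) f (ta p i, tb (p, m) i, c i) (tb (p', m) i, ta p' i))) /=.
    by rewrite (sum_pick_prod (w := fun i => KC (ta p i) (tb (p, m) i)) S
      (fun i c => f (ta p i, tb (p, m) i, c) (tb (p', m) i, ta p' i))).
  by move=> q; exact: seq_C_total.
transitivity (\sum_(ta : table_A) law_A ta *
   \prod_(i | S i) \sum_b KB (ta p i) b * \sum_b' KB (ta p' i) b' *
      \sum_c KC (ta p i) b c * f (ta p i, b, c) (b', ta p' i)).
  apply: eq_bigr => ta _; congr (_ * _).
  rewrite (expect_two (w := fun q => seq_B (ta q.1))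
     (fun b b' : {ffun 'I_N -> B} => \prod_(i | S i)
     \sum_c KC (ta p i) (b i) c * f (ta p i, b i, c) (b' i, ta p' i))) /=.
  - transitivity (\sum_b seq_B (ta p) b * \prod_(i | S i) \sum_b' KB (ta p' i) b'
        * \sum_c KC (ta p i) (b i) c * f (ta p i, b i, c) (b', ta p' i)).
      apply: eq_bigr => b _; congr (_ * _).
      by rewrite (sum_pick_prod (w := fun i => KB (ta p' i)) S (fun i b' =>
        \sum_c KC (ta p i) (b i) c * f (ta p i, b i, c) (b', ta p' i))).
    by rewrite (sum_pick_prod (w := fun i => KB (ta p i)) S (fun i b =>
       \sum_b' KB (ta p' i) b' * \sum_c KC (ta p i) b c * f (ta p i, b, c) (b', ta p' i))).
  - by move=> q; exact: seq_B_total.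
  - by rewrite xpair_eqE eqxx andbT.
rewrite (expect_two (w := fun=> seq_A) (fun a a' : {ffun 'I_N -> A} =>
   \prod_(i | S i) \sum_b KB (a i) b * \sum_b' KB (a' i) b' *
      \sum_c KC (a i) b c * f (a i, b, c) (b', a' i))) //=; last first.
  by move=> _; exact: seq_A_total.
transitivity (\sum_a seq_A a * \prod_(i | S i) \sum_a' PA a' *
   \sum_b KB (a i) b * \sum_b' KB a' b' * \sum_c KC (a i) b c * f (a i, b, c) (b', a')).
  apply: eq_bigr => a _; congr (_ * _).
  by rewrite (sum_pick_prod (w := fun=> PA) S (fun i a' => \sum_b KB (a i) b *
    \sum_b' KB a' b' * \sum_c KC (a i) b c * f (a i, b, c) (b', a'))).
rewrite (sum_pick_prod (w := fun=> PA) S (fun i a => \sum_a' PA a' * \sum_b KB a b *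
   \sum_b' KB a' b' * \sum_c KC a b c * f (a, b, c) (b', a'))) //.
apply: eq_bigr => i _; rewrite sum_letter_law /=.
apply: eq_bigr => a _; congr (_ * _).
under eq_bigr do rewrite mulr_sumr.
rewrite exchange_big; apply: eq_bigr => b _ /=.
under eq_bigr do rewrite mulrCA.
rewrite -mulr_sumr; congr (_ * _).
have E c : \sum_ba PA ba.2 * KB ba.2 ba.1 * f (a, b, c) ba
    = \sum_a' PA a' * \sum_b' KB a' b' * f (a, b, c) (b', a').
  transitivity (\sum_(ba : B * A) PA ba.2 * KB ba.2 ba.1 * f (a, b, c) (ba.1, ba.2)).
    by apply: eq_bigr => -[b' a'].
  rewrite -(pair_bigA _ (fun b' a' => PA a' * KB a' b' * f (a, b, c) (b', a'))) /=.
  rewrite exchange_big; apply: eq_bigr => a' _ /=.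
  by rewrite mulr_sumr; apply: eq_bigr => b' _; rewrite mulrA.
under [RHS]eq_bigr do rewrite E mulr_sumr.
rewrite exchange_big; apply: eq_bigr => a' _ /=.
under [RHS]eq_bigr do rewrite mulrCA.
rewrite -mulr_sumr; congr (_ * _).
under eq_bigr do rewrite mulr_sumr.
under [RHS]eq_bigr do rewrite mulr_sumr.
rewrite exchange_big; apply: eq_bigr => c _; apply: eq_bigr => b' _.
by rewrite mulrCA.
Qed.

(** A wrong satellite is fresh conditionally on the relay and cloud letters. *)
Lemma mean_wrong_C (j' : J) (f : A * B * C -> C -> R) : j != j' ->
  mean (fun ta tb tc => \prod_(i | S i) f (letters ta tb tc p m j i) (tc (p, m, j') i))
  = \prod_(i | S i) \sum_l letter_law l * \sum_c' KC l.1.1 l.1.2 c' * f l c'.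
Proof.
move=> jj'.
transitivity (\sum_(ta : table_A) law_A ta * \sum_(tb : table_B) law_B ta tb *
   \prod_(i | S i) \sum_c KC (ta p i) (tb (p, m) i) c
       * \sum_c' KC (ta p i) (tb (p, m) i) c' * f (ta p i, tb (p, m) i, c) c').
  apply: eq_bigr => ta _; congr (_ * _); apply: eq_bigr => tb _; congr (_ * _).
  rewrite (expect_two (w := fun q => seq_C (ta q.1.1) (tb q.1))
     (fun c c' : {ffun 'I_N -> C} =>
       \prod_(i | S i) f (ta p i, tb (p, m) i, c i) (c' i))) /=.
  - transitivity (\sum_c seq_C (ta p) (tb (p, m)) c * \prod_(i | S i)
        \sum_c' KC (ta p i) (tb (p, m) i) c' * f (ta p i, tb (p, m) i, c i) c').
      apply: eq_bigr => c _; congr (_ * _).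
      by rewrite (sum_pick_prod (w := fun i => KC (ta p i) (tb (p, m) i)) S
         (fun i c' => f (ta p i, tb (p, m) i, c i) c')).
    by rewrite (sum_pick_prod (w := fun i => KC (ta p i) (tb (p, m) i)) S
      (fun i c => \sum_c' KC (ta p i) (tb (p, m) i) c' * f (ta p i, tb (p, m) i, c) c')).
  - by move=> q; exact: seq_C_total.
  - by rewrite xpair_eqE eqxx.
transitivity (\sum_(ta : table_A) law_A ta *
   \prod_(i | S i) \sum_b KB (ta p i) b *
      \sum_c KC (ta p i) b c * \sum_c' KC (ta p i) b c' * f (ta p i, b, c) c').
  apply: eq_bigr => ta _; congr (_ * _).
  rewrite (expect_one (w := fun q => seq_B (ta q.1))
     (fun b : {ffun 'I_N -> B} => \prod_(i | S i) \sum_c KC (ta p i) (b i) c *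
       \sum_c' KC (ta p i) (b i) c' * f (ta p i, b i, c) c')) /=.
    by rewrite (sum_pick_prod (w := fun i => KB (ta p i)) S (fun i b =>
       \sum_c KC (ta p i) b c * \sum_c' KC (ta p i) b c' * f (ta p i, b, c) c')).
  by move=> q; exact: seq_B_total.
rewrite (expect_one (w := fun=> seq_A) (fun a : {ffun 'I_N -> A} =>
   \prod_(i | S i) \sum_b KB (a i) b *
      \sum_c KC (a i) b c * \sum_c' KC (a i) b c' * f (a i, b, c) c')) /=; last first.
  by move=> _; exact: seq_A_total.
rewrite (sum_pick_prod (w := fun=> PA) S (fun i a => \sum_b KB a b *
   \sum_c KC a b c * \sum_c' KC a b c' * f (a, b, c) c')) //.
by apply: eq_bigr => i _; rewrite sum_letter_law.
Qed.

End Means.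

Definition positive_codebook (ta : table_A) (tb : table_B) (tc : table_C) :=
  forall p m j i, 0 < letter_law (letters ta tb tc p m j i).

Lemma prod_gt0_factor (I : finType) (f : I -> R) (i : I) :
  (forall i, 0 <= f i) -> 0 < \prod_i f i -> 0 < f i.
Proof.
move=> f0; rewrite (bigD1 i) //= => P0; rewrite lt_neqAle f0 andbT eq_sym.
by apply: contraTneq P0 => ->; rewrite mul0r ltxx.
Qed.

Lemma law_gt0_positive ta tb tc : 0 < law_A ta -> 0 < law_B ta tb ->
  0 < law_C ta tb tc -> positive_codebook ta tb tc.
Proof.
move=> a0 b0 c0 p m j i; rewrite !mulr_gt0 //=.
- apply: (prod_gt0_factor i (fun i => PA0 (ta p i))).
  by apply: (prod_gt0_factor p _ a0) => q; apply: prodr_ge0.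
- apply: (prod_gt0_factor i (fun i => KB0 (ta p i) (tb (p, m) i))).
  by apply: (prod_gt0_factor (p, m) _ b0) => q; apply: prodr_ge0.
- apply: (prod_gt0_factor i (fun i => KC0 (ta p i) (tb (p, m) i) (tc (p, m, j) i))).
  by apply: (prod_gt0_factor (p, m, j) _ c0) => q; apply: prodr_ge0.
Qed.

Lemma law_A_ge0 ta : 0 <= law_A ta.
Proof. by apply: prodr_ge0 => m _; apply: prodr_ge0. Qed.

Lemma law_B_ge0 ta tb : 0 <= law_B ta tb.
Proof. by apply: prodr_ge0 => m _; apply: prodr_ge0. Qed.

Lemma law_C_ge0 ta tb tc : 0 <= law_C ta tb tc.
Proof. by apply: prodr_ge0 => m _; apply: prodr_ge0. Qed.

Lemma ler_wM2l_supp (w x y : R) : 0 <= w -> (0 < w -> x <= y) -> w * x <= w * y.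
Proof.
by rewrite le_eqVlt => /orP[/eqP <-|w0 xy]; rewrite ?mul0r // ler_pM2l // xy.
Qed.

Lemma mean_le F F' : (forall ta tb tc, positive_codebook ta tb tc ->
  F ta tb tc <= F' ta tb tc) -> mean F <= mean F'.
Proof.
move=> H.
apply: ler_sum => ta _; apply: ler_wM2l_supp => [|a0]; first exact: law_A_ge0.
apply: ler_sum => tb _; apply: ler_wM2l_supp => [|b0]; first exact: law_B_ge0.
apply: ler_sum => tc _; apply: ler_wM2l_supp => [|c0]; first exact: law_C_ge0.
exact/H/law_gt0_positive.
Qed.

Lemma exists_le_codebook F x : mean F <= x ->
  exists ta tb tc, positive_codebook ta tb tc /\ F ta tb tc <= x.
Proof.
move=> H.
have [ta a0 Ha] := exists_le_mean law_A_ge0 law_A_total H.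
have [tb b0 Hb] := exists_le_mean (law_B_ge0 ta) (law_B_total ta) Ha.
have [tc c0 Hc] := exists_le_mean (law_C_ge0 ta tb) (law_C_total ta tb) Hb.
by exists ta, tb, tc; split => //; exact: law_gt0_positive.
Qed.

Lemma mean_sum (I : Type) (r : seq I) (P : pred I) F :
  mean (fun ta tb tc => \sum_(i <- r | P i) F i ta tb tc) = \sum_(i <- r | P i) mean (F i).
Proof.
rewrite /mean exchange_big; apply: eq_bigr => ta _ /=.
rewrite -mulr_sumr exchange_big; congr (_ * _); apply: eq_bigr => tb _ /=.
rewrite -mulr_sumr exchange_big; congr (_ * _); apply: eq_bigr => tc _ /=.
by rewrite -mulr_sumr.
Qed.

Lemma meanD F F' : mean (fun ta tb tc => F ta tb tc + F' ta tb tc) = mean F + mean F'.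
Proof.
rewrite /mean -big_split; apply: eq_bigr => ta _ /=; rewrite -mulrDr; congr (_ * _).
rewrite -big_split; apply: eq_bigr => tb _ /=; rewrite -mulrDr; congr (_ * _).
by rewrite -big_split; apply: eq_bigr => tc _ /=; rewrite -mulrDr.
Qed.

Lemma meanZ x F : mean (fun ta tb tc => x * F ta tb tc) = x * mean F.
Proof.
rewrite /mean mulr_sumr; apply: eq_bigr => ta _; rewrite mulrCA; congr (_ * _).
rewrite mulr_sumr; apply: eq_bigr => tb _; rewrite mulrCA; congr (_ * _).
by rewrite mulr_sumr; apply: eq_bigr => tc _; rewrite mulrCA.
Qed.

End Codebook.

(** * Law of a code with a deterministic relay *)

Section CodeLaw.
Variables (R : realType) (L X X1 Y Y1 Z TQ : finType) (N M0 M1 : nat).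
Variables (W : X -> X1 -> Y -> Y1 -> Z -> R) (k : L -> X -> R).
Variables (li : 'I_M0 * 'I_M1 * TQ -> 'I_N -> L) (rel : 'I_N -> {ffun 'I_N -> Y1} -> X1).

Lemma sum_outputs (h : {ffun 'I_N -> X} -> {ffun 'I_N -> Y} -> {ffun 'I_N -> Y1} ->
    {ffun 'I_N -> Z} -> R) :
  \sum_x \sum_y \sum_y1 \sum_z h x y y1 z
  = \sum_(o : {ffun 'I_N -> X * Y * Y1 * Z})
      h [ffun i => (o i).1.1.1] [ffun i => (o i).1.1.2] [ffun i => (o i).1.2]
        [ffun i => (o i).2].
Proof.
rewrite (sum_ffun_pair (fun x y => \sum_y1 \sum_z h x y y1 z)).
rewrite (sum_ffun_pair (fun (f : {ffun 'I_N -> X * Y}) y1 =>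
  \sum_z h [ffun i => (f i).1] [ffun i => (f i).2] y1 z)).
rewrite (sum_ffun_pair (fun (f : {ffun 'I_N -> X * Y * Y1}) z =>
  h [ffun i => ([ffun j => (f j).1] i).1] [ffun i => ([ffun j => (f j).1] i).2]
    [ffun i => (f i).2] z)).
by apply: eq_bigr => o _; congr h; apply/ffunP => i; rewrite !ffunE.
Qed.

Definition joint_of (enc : 'I_M0 -> 'I_M1 -> {ffun 'I_N -> X} -> R)
    (t : 'I_M0 * 'I_M1 * {ffun 'I_N -> X} * {ffun 'I_N -> X1} *
    {ffun 'I_N -> Y} * {ffun 'I_N -> Y1} * {ffun 'I_N -> Z}) :=
  (M0%:R * M1%:R)^-1 * enc t.1.1.1.1.1.1 t.1.1.1.1.1.2 t.1.1.1.1.2 *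
  \prod_i ((t.1.1.1.2 i == rel i t.1.2)%:R *
     W (t.1.1.1.1.2 i) (t.1.1.1.2 i) (t.1.1.2 i) (t.1.2 i) (t.2 i)).

Definition msg_z_law enc a c :=
  \sum_(t | (t.1.1.1.1.1.2 == a) && (t.2 == c)) joint_of enc t.
Definition code_equiv enc := - \sum_a \sum_c msg_z_law enc a c *
  ln (msg_z_law enc a c / \sum_(t | t.2 == c) joint_of enc t).

(** The encoder draws a uniform dummy index [q], then sends its code letters through the prefix
    channel [k]. *)
Definition mix_enc w0 w1 (x : {ffun 'I_N -> X}) :=
  \sum_q #|TQ|%:R^-1 * \prod_i k (li (w0, w1, q) i) (x i).

Definition joint_law := joint_of mix_enc.

Definition mixed_law g (o : {ffun 'I_N -> X * Y * Y1 * Z}) :=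
  #|{: 'I_M0 * 'I_M1 * TQ}|%:R^-1 * \prod_i (k (li g i) (o i).1.1.1 *
    W (o i).1.1.1 (rel i [ffun j => (o j).1.2]) (o i).1.1.2 (o i).1.2 (o i).2).

(** The relay input is a function of the relay observations, so its sum collapses; the dummy index,
    hidden in the encoder, joins the data [g]. *)
Lemma joint_law_sum (F : 'I_M0 -> 'I_M1 -> {ffun 'I_N -> Y} -> {ffun 'I_N -> Z} -> R) :
  \sum_t joint_law t * F t.1.1.1.1.1.1 t.1.1.1.1.1.2 t.1.1.2 t.2
  = \sum_g \sum_o mixed_law g o *
      F g.1.1 g.1.2 [ffun i => (o i).1.1.2] [ffun i => (o i).2].
Proof.
transitivity (\sum_w0 \sum_w1 \sum_x \sum_x1 \sum_y \sum_y1 \sum_z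
    joint_law (w0, w1, x, x1, y, y1, z) * F w0 w1 y z).
  by rewrite !pair_bigA /=; apply: eq_bigr => -[[[[[[w0 w1] x] x1] y] y1] z] _.
transitivity (\sum_w0 \sum_w1 \sum_q \sum_o mixed_law (w0, w1, q) o *
      F w0 w1 [ffun i => (o i).1.1.2] [ffun i => (o i).2]); last first.
  by rewrite !pair_bigA /=; apply: eq_bigr => -[[[w0 w1] q] o] _.
apply: eq_bigr => w0 _; apply: eq_bigr => w1 _.
have inner x y y1 z : \sum_x1 joint_law (w0, w1, x, x1, y, y1, z) * F w0 w1 y z
   = (M0%:R * M1%:R)^-1 * mix_enc w0 w1 x * F w0 w1 y z *
     \prod_i W (x i) (rel i y1) (y i) (y1 i) (z i).
  transitivity ((M0%:R * M1%:R)^-1 * mix_enc w0 w1 x * F w0 w1 y z *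
     \sum_(x1 : {ffun 'I_N -> X1}) \prod_i ((x1 i == rel i y1)%:R *
        W (x i) (x1 i) (y i) (y1 i) (z i))).
    by rewrite mulr_sumr; apply: eq_bigr => x1 _; rewrite /joint_law /joint_of /=; ring.
  congr (_ * _); rewrite (sum_ffun_prod (fun i a => (a == rel i y1)%:R *
        W (x i) a (y i) (y1 i) (z i))).
  apply: eq_bigr => i _; rewrite (bigD1 (rel i y1)) //= eqxx mul1r big1 ?addr0 //.
  by move=> a /negbTE ->; rewrite mul0r.
transitivity (\sum_x \sum_y \sum_y1 \sum_z (M0%:R * M1%:R)^-1 * mix_enc w0 w1 x *
     F w0 w1 y z * \prod_i W (x i) (rel i y1) (y i) (y1 i) (z i)).
  apply: eq_bigr => x _; rewrite exchange_big; apply: eq_bigr => y _ /=.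
  rewrite exchange_big; apply: eq_bigr => y1 _ /=.
  by rewrite exchange_big; apply: eq_bigr => z _ /=; exact: inner.
rewrite (sum_outputs (fun x y y1 z => (M0%:R * M1%:R)^-1 * mix_enc w0 w1 x *
     F w0 w1 y z * \prod_i W (x i) (rel i y1) (y i) (y1 i) (z i))).
rewrite [RHS]exchange_big; apply: eq_bigr => o _ /=.
rewrite -mulr_suml mulrAC; congr (_ * _).
rewrite mulr_sumr mulr_suml; apply: eq_bigr => q _.
rewrite /mixed_law big_split /= !card_prod !card_ord !natrM [in RHS]invfM -!mulrA.
do 2! congr (_ * _); congr (_ * _); last by apply: eq_bigr => i _; rewrite !ffunE.
by apply: eq_bigr => i _; rewrite !ffunE.
Qed.

Lemma joint_law_sum_cond (P : 'I_M0 -> 'I_M1 -> {ffun 'I_N -> Y} -> {ffun 'I_N -> Z} -> bool) :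
  \sum_(t | P t.1.1.1.1.1.1 t.1.1.1.1.1.2 t.1.1.2 t.2) joint_law t
  = \sum_g \sum_(o : {ffun 'I_N -> X * Y * Y1 * Z} |
      P g.1.1 g.1.2 [ffun i => (o i).1.1.2] [ffun i => (o i).2]) mixed_law g o.
Proof.
rewrite big_mkcond /=.
have := joint_law_sum (fun w0 w1 y z => (P w0 w1 y z)%:R).
rewrite (eq_bigr (fun t => if P t.1.1.1.1.1.1 t.1.1.1.1.1.2 t.1.1.2 t.2 then joint_law t else 0)).
  move=> ->; apply: eq_bigr => g _; rewrite [RHS]big_mkcond; apply: eq_bigr => o _.
  by case: (P _ _ _ _); rewrite ?mulr1 ?mulr0.
by move=> t _; case: (P _ _ _ _); rewrite ?mulr1 ?mulr0.
Qed.

Lemma code_equivE : code_equiv mix_enc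
  = equiv_nats mixed_law (fun g => g.1.2) (fun o => [ffun i => (o i).2]).
Proof.
have mE a c : msg_z_law mix_enc a c
   = law_wz mixed_law (fun g => g.1.2) (fun o => [ffun i => (o i).2]) a c.
  rewrite /msg_z_law (joint_law_sum_cond (fun _ w1 _ z => (w1 == a) && (z == c))).
  rewrite /law_wz [RHS]big_mkcond; apply: eq_bigr => g _.
  by case: (g.1.2 == a) => //=; rewrite big_pred0.
congr (- _); apply: eq_bigr => a _; apply: eq_bigr => c _; rewrite mE; congr (_ * ln (_ / _)).
rewrite (partition_big (fun t => t.1.1.1.1.1.2) xpredT) //=.
by apply: eq_bigr => b _; rewrite -mE; apply: eq_bigl => t; rewrite andbC.
Qed.

Lemma mix_enc_ge0 : (forall l x, 0 <= k l x) -> forall w0 w1 x, 0 <= mix_enc w0 w1 x.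
Proof.
move=> k0 w0 w1 x; apply: sumr_ge0 => q _.
by apply: mulr_ge0; [rewrite invr_ge0 ler0n|apply: prodr_ge0].
Qed.

Lemma mix_enc_total : TQ -> (forall l, \sum_x k l x = 1) ->
  forall w0 w1, \sum_x mix_enc w0 w1 x = 1.
Proof.
move=> q0 k1 w0 w1; rewrite exchange_big /=.
rewrite (eq_bigr (fun=> #|TQ|%:R^-1)) => [|q _].
  rewrite sumr_const -[_^-1 *+ _]mulr_natl mulfV // pnatr_eq0 -lt0n.
  by apply/card_gt0P; exists q0.
rewrite -mulr_sumr (sum_ffun_prod (fun i x => k (li (w0, w1, q) i) x)).
by rewrite big1 ?mulr1 // => i _; exact: k1.
Qed.

End CodeLaw.

(** [lo] and [hi] bound the equivocation in nats of the whole transmission, not divided by [N]. *)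
Definition code_with (R : realType) (X X1 Y Y1 Z : finType)
    (W : X -> X1 -> Y -> Y1 -> Z -> R) (N M0 M1 : nat) (beta lo hi : R) :=
  exists (enc : 'I_M0 -> 'I_M1 -> {ffun 'I_N -> X} -> R)
    (rel : 'I_N -> {ffun 'I_N -> Y1} -> X1)
    (dec1 : {ffun 'I_N -> Y} -> 'I_M0 * 'I_M1) (dec2 : {ffun 'I_N -> Z} -> 'I_M0),
  [/\ (forall w0 w1 x, 0 <= enc w0 w1 x), (forall w0 w1, \sum_x enc w0 w1 x = 1),
      (forall (i : 'I_N) (y1 y1' : {ffun 'I_N -> Y1}),
         (forall j : 'I_N, (j < i)%N -> y1 j = y1' j) -> rel i y1 = rel i y1') &
  [/\ \sum_(t | dec1 t.1.1.2 != (t.1.1.1.1.1.1, t.1.1.1.1.1.2)) joint_of W rel enc t <= beta,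
      \sum_(t | dec2 t.2 != t.1.1.1.1.1.1) joint_of W rel enc t <= beta,
      lo <= code_equiv W rel enc & code_equiv W rel enc <= hi]].

(** * Block Markov scheme *)

Section Scheme.
Variables (R : realType) (X X1 Y Y1 Z U V : finType).
Variables (W : X -> X1 -> Y -> Y1 -> Z -> R) (PA : X1 -> R) (KB : X1 -> U -> R).
Variables (KC : X1 -> U -> V -> R) (KX : X1 -> U -> V -> X -> R).
Hypothesis W0 : forall x x1 y y1 z, 0 <= W x x1 y y1 z.
Hypothesis W1 : forall x x1, \sum_(t : Y * Y1 * Z) W x x1 t.1.1 t.1.2 t.2 = 1.
Hypothesis PA0 : forall a, 0 <= PA a.
Hypothesis PA1 : \sum_a PA a = 1.
Hypothesis KB0 : forall a b, 0 <= KB a b.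
Hypothesis KB1 : forall a, \sum_b KB a b = 1.
Hypothesis KC0 : forall a b c, 0 <= KC a b c.
Hypothesis KC1 : forall a b, \sum_c KC a b c = 1.
Hypothesis KX0 : forall a b c x, 0 <= KX a b c x.
Hypothesis KX1 : forall a b c, \sum_x KX a b c x = 1.

Definition out : finType := (X * Y * Y1 * Z)%type.
(* [l] is the triple of codeword letters seen by the encoder, [a] the letter that the
   relay really sends; the two agree as long as the relay decodes correctly. *)
Definition out_law (l : X1 * U * V) (a : X1) (o : out) : R :=
  KX l.1.1 l.1.2 l.2 o.1.1.1 * W o.1.1.1 a o.1.1.2 o.1.2 o.2.
Definition kernel (l : X1 * U * V) (o : out) : R := out_law l l.1.1 o.

Lemma out_law_ge0 l a o : 0 <= out_law l a o.
Proof. exact: mulr_ge0. Qed.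

Lemma out_law_total l a : \sum_o out_law l a o = 1.
Proof.
pose f (t : X * (Y * Y1 * Z)) : out := (t.1, t.2.1.1, t.2.1.2, t.2.2).
rewrite (reindex f) /=; last first.
  by exists (fun o : out => (o.1.1.1, (o.1.1.2, o.1.2, o.2))); [case=> ? [[]]|do 3!case].
rewrite -(pair_bigA _ (fun x (t : Y * Y1 * Z) => out_law l a (f (x, t)))) /=.
rewrite -[RHS](KX1 l.1.1 l.1.2 l.2); apply: eq_bigr => x _.
by rewrite /out_law /= -mulr_sumr W1 mulr1.
Qed.

Local Notation pl := (letter_law PA KB KC).

Definition out_y (o : out) := o.1.1.2.
Definition out_y1 (o : out) := o.1.2.
Definition out_z (o : out) := o.2.
Definition letter_U (l : X1 * U * V) := l.1.2.
Definition letter_A (l : X1 * U * V) := l.1.1.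
Definition letter_UA (l : X1 * U * V) := (l.1.2, l.1.1).
Definition letter_V (l : X1 * U * V) := l.2.
Definition letter_tt (l : X1 * U * V) := tt.

Variables (N B M0 M1 : nat) (TQ M Js Je : finType).
Variable blk : 'I_N -> nat.
Hypothesis blk_le : forall i, (blk i <= B)%N.
Hypothesis blk_mono : forall i j : 'I_N, (i <= j)%N -> (blk i <= blk j)%N.
Local Notation common := ('I_M0 * 'I_M1)%type.
Local Notation data := ('I_M0 * 'I_M1 * TQ)%type.
Variables (mu : common -> nat -> M) (sg : 'I_M1 -> nat -> Js) (ep : 'I_M1 * TQ -> nat -> Je).
Hypothesis mu_first : forall g g', mu g 0 = mu g' 0.
Hypothesis mu_last : forall g g', mu g B.+1 = mu g' B.+1.
Hypothesis mu_w0 : forall g g', (forall b, (b <= B.+1)%N -> mu g b = mu g' b) -> g.1 = g'.1.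
Hypothesis data_inj : forall g g' : data,
  (forall b, (b <= B.+1)%N -> mu g.1 b = mu g'.1 b) ->
  (forall b, (b <= B)%N -> sg g.1.2 b = sg g'.1.2 b) ->
  (forall b, (b <= B)%N -> ep (g.1.2, g.2) b = ep (g'.1.2, g'.2) b) -> g = g'.

Definition secret (w1 : 'I_M1) : {ffun 'I_B.+1 -> Js} := [ffun b => sg w1 (val b)].

Variables (lamR lam1 lam2 lamS lamG : R).
Variable g0 : data.

Section FixedCodebook.
Variables (ta : table_A X1 M N) (tb : table_B U M N) (tc : table_C V M (Js * Je)%type N).

(* Codewords have full length [N], and block [b] uses only its own coordinates: the same
   codebook then serves all the blocks, whose lengths may differ. *)
Definition in_block b : pred 'I_N := fun i => blk i == b.

(* In block [b] the previous index is [p], the current one [m], the satellite one [j].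
   R: the relay looks for [m] knowing [p]; 1 and 2: receivers 1 and 2 look for [p] knowing
   [m]; S: receiver 1 looks for [j]; G: receiver 2, told the secret half of [j], looks for
   the other half, which only serves to estimate the equivocation. *)
Definition passR b p m (y1 : 'I_N -> Y1) :=
  pass pl kernel letter_U letter_A out_y1 (in_block b) lamR (fun i => (tb (p, m) i, ta p i)) y1.
Definition pass1 b p m (y : 'I_N -> Y) :=
  pass pl kernel letter_UA letter_tt out_y (in_block b) lam1
    (fun i => ((tb (p, m) i, ta p i), tt)) y.
Definition pass2 b p m (z : 'I_N -> Z) :=
  pass pl kernel letter_UA letter_tt out_z (in_block b) lam2
    (fun i => ((tb (p, m) i, ta p i), tt)) z.
Definition passS b p m j (y : 'I_N -> Y) :=
  pass pl kernel letter_V letter_UA out_y (in_block b) lamS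
    (fun i => (tc (p, m, j) i, (tb (p, m) i, ta p i))) y.
Definition passG b p m j (z : 'I_N -> Z) :=
  pass pl kernel letter_V letter_UA out_z (in_block b) lamG
    (fun i => (tc (p, m, j) i, (tb (p, m) i, ta p i))) z.

Definition badR b p m y1 := ~~ passR b p m y1 || [exists m', (m' != m) && passR b p m' y1].
Definition bad1 b p m y := ~~ pass1 b p m y || [exists p', (p' != p) && pass1 b p' m y].
Definition bad2 b p m z := ~~ pass2 b p m z || [exists p', (p' != p) && pass2 b p' m z].
Definition badS b p m j y :=
  ~~ passS b p m j y || [exists j', (j' != j) && passS b p m j' y].
Definition badG b p m (s : Js) (e : Je) z :=
  ~~ passG b p m (s, e) z || [exists e', (e' != e) && passG b p m (s, e') z].

Definition bad_block (g : data) (o : {ffun 'I_N -> out}) (b : nat) :=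
  let p := mu g.1 b in let m := mu g.1 b.+1 in
  let s := sg g.1.2 b in let e := ep (g.1.2, g.2) b in
  [|| badR b p m (fun i => out_y1 (o i)), bad1 b p m (fun i => out_y (o i)),
      bad2 b p m (fun i => out_z (o i)), badS b p m (s, e) (fun i => out_y (o i))
    | badG b p m s e (fun i => out_z (o i))].

Definition bad g o := [exists b : 'I_B.+1, bad_block g o b].

Lemma not_bad g o b : ~~ bad g o -> (b <= B)%N -> ~~ bad_block g o b.
Proof.
rewrite negb_exists => /forallP H bB.
by have := H (Ordinal (bB : (b < B.+1)%N)).
Qed.

(** Only blocks before [b] are tested, as causality requires. The message pair found may be wrong;
    only its indices up to [b] matter. *)
Definition relay_guess b (y1 : 'I_N -> Y1) : common :=
  odflt g0.1 [pick g : common | [forall b' : 'I_b, passR b' (mu g b') (mu g b'.+1) y1]].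
Definition relay_in (i : 'I_N) (y1 : {ffun 'I_N -> Y1}) : X1 :=
  ta (mu (relay_guess (blk i) y1) (blk i)) i.
Definition guess1 (y : 'I_N -> Y) : data :=
  odflt g0 [pick g : data | [forall b : 'I_B.+1, pass1 b (mu g.1 b) (mu g.1 b.+1) y
     && passS b (mu g.1 b) (mu g.1 b.+1) (sg g.1.2 b, ep (g.1.2, g.2) b) y]].
Definition guess2 (z : 'I_N -> Z) : common :=
  odflt g0.1 [pick g : common | [forall b : 'I_B.+1, pass2 b (mu g b) (mu g b.+1) z]].
Definition guessG (s : {ffun 'I_B.+1 -> Js}) (z : 'I_N -> Z) : data :=
  odflt g0 [pick g : data | (secret g.1.2 == s) &&
    [forall b : 'I_B.+1, pass2 b (mu g.1 b) (mu g.1 b.+1) z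
     && passG b (mu g.1 b) (mu g.1 b.+1) (sg g.1.2 b, ep (g.1.2, g.2) b) z]].

(** Induction from the idle index 0: once the index of a block is right, the uniqueness in [badR]
    forces the next one. *)
Lemma relay_guessP g o b : ~~ bad g o -> (b <= B.+1)%N ->
  mu (relay_guess b (fun i => out_y1 (o i))) b = mu g.1 b.
Proof.
move=> nb bB; rewrite /relay_guess; case: pickP => [g' /forallP H|H]; last first.
  have := H g.1; rewrite (introT forallP) // => b'.
  have : (b' <= B)%N by rewrite -ltnS (leq_trans _ bB).
  by move/(not_bad nb)/norP => [/norP[/negPn]].
rewrite /=; suff Hk k : (k <= b)%N -> mu g' k = mu g.1 k by exact: Hk.
elim: k => [_|k IH kb]; first exact: mu_first.
have kB : (k <= B)%N by rewrite -ltnS (leq_trans kb).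
have := H (Ordinal kb); rewrite /= IH ?(ltnW kb) // => pk.
have /norP[/norP[_ /existsPn/(_ (mu g' k.+1)) h] _] := not_bad nb kB.
by move: h; rewrite pk andbT => /negPn/eqP.
Qed.

Lemma backward (g g' : common) (test : nat -> M -> M -> bool) :
  (forall b p, (b <= B)%N -> p != mu g b -> ~~ test b p (mu g b.+1)) ->
  (forall b, (b <= B)%N -> test b (mu g' b) (mu g' b.+1)) ->
  forall b, (b <= B.+1)%N -> mu g' b = mu g b.
Proof.
move=> H H' b bB; rewrite -(subKn bB).
elim: (B.+1 - b)%N => [|k IH]; first by rewrite subn0; exact: mu_last.
(* Past [B.+1] steps the truncated subtraction stays at 0, where the index is idle too. *)
case: (leqP B.+1 k) => kB.
  by rewrite (_ : B.+1 - k.+1 = 0)%N ?mu_first //; apply/eqP; rewrite subn_eq0 ltnW.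
have E : (B.+1 - k = (B.+1 - k.+1).+1)%N by rewrite subnS prednK ?subn_gt0.
have le : (B.+1 - k.+1 <= B)%N by rewrite subSS leq_subr.
have := H' _ le; rewrite -E IH E => t.
by apply/eqP; apply: contraTT t; exact: H.
Qed.

(** Only the indices are claimed to be right: they determine [W0] by [mu_w0], whereas the
    confidential message may stay ambiguous. *)
Lemma guess2P g o : ~~ bad g o -> forall b, (b <= B.+1)%N ->
  mu (guess2 (fun i => out_z (o i))) b = mu g.1 b.
Proof.
move=> nb; rewrite /guess2; case: pickP => [g' /forallP H|H]; last first.
  have := H g.1; rewrite (introT forallP) // => b'.
  by have /norP[_ /norP[_ /norP[/norP[/negPn]]]] := not_bad nb (ltn_ord b' : (b' <= B)%N).
apply: (@backward _ _ (fun b p m => pass2 b p m (fun i => out_z (o i)))).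
  move=> b p bB pn; have /norP[_ /norP[_ /norP[/norP[_ /existsPn/(_ p) h] _]]] := not_bad nb bB.
  by move: h; rewrite pn.
by move=> b bB; exact: (H (Ordinal (bB : (b < B.+1)%N))).
Qed.

Lemma guess1P g o : ~~ bad g o -> guess1 (fun i => out_y (o i)) = g.
Proof.
move=> nb; rewrite /guess1; case: pickP => [g' /forallP H|H]; last first.
  have := H g; rewrite (introT forallP) // => b'.
  have /norP[_ /norP[/norP[/negPn-> _] /norP[_ /norP[/norP[/negPn-> _] _]]]] :=
    not_bad nb (ltn_ord b' : (b' <= B)%N).
  by [].
have Hb b (bB : (b <= B)%N) := H (Ordinal (bB : (b < B.+1)%N)).
have muE : forall b, (b <= B.+1)%N -> mu g'.1 b = mu g.1 b.
  apply: (@backward _ _ (fun b p m => pass1 b p m (fun i => out_y (o i)))).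
    move=> b p bB pn; have /norP[_ /norP[/norP[_ /existsPn/(_ p) h] _]] := not_bad nb bB.
    by move: h; rewrite pn.
  by move=> b bB; have /andP[] := Hb b bB.
have jE b : (b <= B)%N -> (sg g'.1.2 b, ep (g'.1.2, g'.2) b) = (sg g.1.2 b, ep (g.1.2, g.2) b).
  move=> bB; have /andP[_] := Hb b bB; rewrite /= !muE ?(leqW bB) // => t.
  apply/eqP; apply: contraTT t => jn.
  have /norP[_ /norP[_ /norP[_ /norP[/norP[_ /existsPn H'] _]]]] := not_bad nb bB.
  have h := H' (sg g'.1.2 b, ep (g'.1.2, g'.2) b).
  by move: h; rewrite jn.
by apply: data_inj => // b bB; have [] := jE b bB.
Qed.

Lemma guessGP g o : ~~ bad g o -> guessG (secret g.1.2) (fun i => out_z (o i)) = g.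
Proof.
move=> nb; rewrite /guessG; case: pickP => [g' /andP[/eqP sE /forallP H]|H]; last first.
  have := H g; rewrite eqxx (introT forallP) // => b'.
  have /norP[_ /norP[_ /norP[/norP[/negPn-> _] /norP[_ /norP[/negPn-> _]]]]] :=
    not_bad nb (ltn_ord b' : (b' <= B)%N).
  by [].
have Hb b (bB : (b <= B)%N) := H (Ordinal (bB : (b < B.+1)%N)).
have muE : forall b, (b <= B.+1)%N -> mu g'.1 b = mu g.1 b.
  apply: (@backward _ _ (fun b p m => pass2 b p m (fun i => out_z (o i)))).
    move=> b p bB pn.
    have /norP[_ /norP[_ /norP[/norP[_ /existsPn/(_ p) h] _]]] := not_bad nb bB.
    by move: h; rewrite pn.
  by move=> b bB; have /andP[] := Hb b bB.
have sgE b : (b <= B)%N -> sg g'.1.2 b = sg g.1.2 b.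
  by move=> bB; move/ffunP/(_ (Ordinal (bB : (b < B.+1)%N))): sE; rewrite !ffunE.
apply: data_inj => // b bB.
have /andP[_] := Hb b bB; rewrite /= !muE ?(leqW bB) // sgE // => t.
apply/eqP; apply: contraTT t => jn.
have /norP[_ /norP[_ /norP[_ /norP[_ /norP[_ /existsPn/(_ (ep (g'.1.2, g'.2) b)) h]]]]]
    := not_bad nb bB.
by move: h; rewrite jn.
Qed.

Definition code_letters (g : data) (i : 'I_N) : X1 * U * V :=
  letters ta tb tc (mu g.1 (blk i)) (mu g.1 (blk i).+1)
    (sg g.1.2 (blk i), ep (g.1.2, g.2) (blk i)) i.
Definition y1_of (o : {ffun 'I_N -> out}) : {ffun 'I_N -> Y1} := [ffun i => out_y1 (o i)].

Definition ideal_law (g : data) (o : {ffun 'I_N -> out}) : R :=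
  #|{: data}|%:R^-1 * \prod_i kernel (code_letters g i) (o i).
Definition actual_law (g : data) (o : {ffun 'I_N -> out}) : R :=
  #|{: data}|%:R^-1 * \prod_i out_law (code_letters g i) (relay_in i (y1_of o)) (o i).

(** The tests read belong to strictly earlier blocks which, [blk] being monotone, lie before time
    [i]. *)
Lemma relay_causal (i : 'I_N) (y1 y1' : {ffun 'I_N -> Y1}) :
  (forall j : 'I_N, (j < i)%N -> y1 j = y1' j) -> relay_in i y1 = relay_in i y1'.
Proof.
move=> yE; rewrite /relay_in; congr (ta (mu _ _) _).
rewrite /relay_guess; congr odflt; apply: eq_pick => g.
apply: eq_forallb => b; apply: eq_pass => // j /eqP jb; apply: yE.
by rewrite ltnNge; apply/negP => /blk_mono; rewrite jb leqNgt ltn_ord.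
Qed.

Lemma y1_ofE o : (y1_of o : 'I_N -> Y1) = (fun i => out_y1 (o i)).
Proof. by apply: funext => i; rewrite ffunE. Qed.

Lemma laws_agree g o : ~~ bad g o -> actual_law g o = ideal_law g o.
Proof.
move=> nb; congr (_ * _); apply: eq_bigr => i _; rewrite /kernel; congr out_law.
by rewrite /relay_in y1_ofE (relay_guessP nb) // leqW.
Qed.

Lemma data_card_gt0 : 0 < #|{: data}|%:R :> R.
Proof. by rewrite ltr0n; apply/card_gt0P; exists g0. Qed.

Lemma ideal_law_ge0 g o : 0 <= ideal_law g o.
Proof.
by apply: mulr_ge0; [rewrite invr_ge0 ler0n|apply: prodr_ge0 => i _; exact: out_law_ge0].
Qed.

Lemma actual_law_ge0 g o : 0 <= actual_law g o.
Proof.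
by apply: mulr_ge0; [rewrite invr_ge0 ler0n|apply: prodr_ge0 => i _; exact: out_law_ge0].
Qed.

Lemma sum_uniform_data : \sum_(g : data) #|{: data}|%:R^-1 = 1 :> R.
Proof.
by rewrite sumr_const -[_^-1 *+ _]mulr_natl mulfV // gt_eqF // data_card_gt0.
Qed.

Lemma ideal_law_total : \sum_g \sum_o ideal_law g o = 1.
Proof.
rewrite -[RHS]sum_uniform_data; apply: eq_bigr => g _.
rewrite -mulr_sumr (sum_ffun_prod (fun i o => kernel (code_letters g i) o)) big1 ?mulr1 //.
by move=> i _; exact: out_law_total.
Qed.

Lemma actual_law_total (o0 : out) : \sum_g \sum_o actual_law g o = 1.
Proof.
rewrite -[RHS]sum_uniform_data; apply: eq_bigr => g _; rewrite -mulr_sumr.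
rewrite (@causal_total _ _ _ o0
  (fun i o => out_law (code_letters g i) (relay_in i (y1_of o)))) ?mulr1 //.
  move=> i o o' t oE; congr out_law; apply: relay_causal => j ji.
  by rewrite !ffunE oE.
by move=> i o; exact: out_law_total.
Qed.

End FixedCodebook.

Lemma kernel_ge0 l o : 0 <= kernel l o.
Proof. exact: out_law_ge0. Qed.

Lemma kernel_total l : \sum_o kernel l o = 1.
Proof. exact: out_law_total. Qed.

Lemma sum_indic (T : finType) (f : T -> R) (x : T) : \sum_y f y * (y == x)%:R = f x.
Proof.
rewrite (bigD1 x) //= eqxx mulr1 big1 ?addr0 // => y /negbTE ->; exact: mulr0.
Qed.

(** * One-letter marginals entering the tests *)

Lemma marginal_letters (P : pred (X1 * U * V)) : \sum_(l | P l) pl l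
  = \sum_a PA a * \sum_b KB a b * \sum_c KC a b c * (P (a, b, c))%:R.
Proof.
rewrite -(sum_letter_law PA KB KC (fun l => (P l)%:R)) big_mkcond.
by apply: eq_bigr => l _; case: (P l); rewrite ?mulr1 ?mulr0.
Qed.

Lemma m_c_A a : m_c pl letter_A a = PA a.
Proof.
rewrite /m_c marginal_letters /letter_A /= -[RHS]sum_indic; apply: eq_bigr => a' _.
under eq_bigr do rewrite -mulr_suml KC1 mul1r.
by rewrite -mulr_suml KB1 mul1r.
Qed.

Lemma m_gc_UA u a : m_gc pl letter_U letter_A (u, a) = PA a * KB a u.
Proof.
rewrite /m_gc marginal_letters /key /letter_U /letter_A /=.
transitivity (\sum_a' PA a' * KB a' u * (a' == a)%:R); last exact: sum_indic.
apply: eq_bigr => a' _; rewrite -mulrA; congr (_ * _).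
under eq_bigr do rewrite -mulr_suml KC1 mul1r xpair_eqE andbC -mulnb natrM mulrCA.
by rewrite -mulr_sumr sum_indic mulrC.
Qed.

Lemma m_c_tt : m_c pl letter_tt tt = 1.
Proof. exact: (letter_law_total PA1 KB1 KC1). Qed.

Lemma m_gc_tt ua : m_gc pl letter_UA letter_tt (ua, tt) = PA ua.2 * KB ua.2 ua.1.
Proof.
case: ua => u a; rewrite -m_gc_UA; apply: eq_bigl => l.
by rewrite /key /letter_UA /letter_U /letter_A xpair_eqE eqxx andbT.
Qed.

Lemma m_c_UA u a : m_c pl letter_UA (u, a) = PA a * KB a u.
Proof. by rewrite -m_gc_UA; apply: eq_bigl. Qed.

(** In the satellite tests the key is the whole letter triple reordered, so its marginal is the
    letter law itself. *)
Lemma key_V_inj l l' : (key letter_V letter_UA l == key letter_V letter_UA l') = (l == l').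
Proof.
case: l => [[a u] v]; case: l' => [[a' u'] v'].
rewrite /key /letter_V /letter_UA !xpair_eqE /=.
by case: (u == u'); case: (a == a'); case: (v == v').
Qed.

Lemma m_gc_V l : m_gc pl letter_V letter_UA (key letter_V letter_UA l) = pl l.
Proof. by rewrite /m_gc (big_pred1 l) // => l'; rewrite key_V_inj. Qed.

Local Notation code_mean := (@mean R X1 U V M (Js * Je)%type N PA KB KC).
Local Notation positive := (@positive_codebook R X1 U V M (Js * Je)%type N PA KB KC).

Section Performance.
Variables (n : nat) (rho : R).
Hypothesis rho0 : 0 <= rho.
Hypothesis rho1 : rho <= 1.
Hypothesis block_size : forall b, (b <= B)%N -> (n <= #|in_block b|)%N.

(** What a test among [cnt] candidates needs so that each of its two kinds of error has mean at most
    [rho ^+ n] in every block of length at least [n]. *)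
Definition reliable (Gt Ct Yt : finType) (fG : X1 * U * V -> Gt) (fC : X1 * U * V -> Ct)
    (fY : out -> Yt) (cnt : nat) (s lam : R) :=
  [/\ 0 < s, 0 < lam, \sum_l pl l * fail_factor pl kernel fG fC fY s lam l <= rho
    & forall c, (n <= c)%N -> cnt.-1%:R * lam^-1 ^+ c <= rho ^+ n].

Lemma prod_block_const (b : nat) (x : R) :
  \prod_(i | in_block b i) x = x ^+ #|in_block b|.
Proof. by rewrite -prodr_const; apply: eq_bigl. Qed.

Section OneTest.
Variables (Gt Ct Yt : finType) (fG : X1 * U * V -> Gt) (fC : X1 * U * V -> Ct).
Variables (fY : out -> Yt) (cnt : nat) (s lam : R).
Hypothesis ok : reliable fG fC fY cnt s lam.
Variables (b : nat) (p m : M) (j : Js * Je).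
Hypothesis bB : (b <= B)%N.

Lemma mean_fail : code_mean (fun ta tb tc => \prod_(i | in_block b i)
    fail_factor pl kernel fG fC fY s lam (letters ta tb tc p m j i)) <= rho ^+ n.
Proof.
case: ok => s0 lam0 H _; rewrite mean_true // prod_block_const.
apply: (@le_trans _ _ (rho ^+ #|in_block b|)).
  rewrite lerXn2r ?nnegrE // sumr_ge0 // => l _.
  apply: mulr_ge0; first exact: letter_law_ge0.
  by apply: fail_factor_ge0 => // *; exact: kernel_ge0.
by rewrite ler_wiXn2l ?block_size.
Qed.

Lemma mean_wrongs (I : finType) (q0 : I) F (Kg : Ct -> Gt -> R) : #|I| = cnt ->
  (forall g c, m_gc pl fG fC (g, c) = m_c pl fC c * Kg c g) ->
  (forall c g, 0 <= Kg c g) ->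
  (forall q, q != q0 -> code_mean (F q) = \prod_(i | in_block b i)
     \sum_l pl l * \sum_g Kg (fC l) g * wrong_factor pl kernel fG fC fY lam l g) ->
  code_mean (fun ta tb tc => \sum_(q | q != q0) F q ta tb tc) <= rho ^+ n.
Proof.
case: ok => s0 lam0 _ H cI KgE Kg0 FE; rewrite mean_sum (eq_bigr _ FE).
apply: le_trans (H _ (block_size bB)).
rewrite -cI -(cardC1 q0) mulr_natl -sumr_const.
rewrite [leRHS](eq_bigl (fun q => q != q0)); last by move=> q; rewrite !inE.
apply: ler_sum => q _; rewrite prod_block_const lerXn2r ?nnegrE ?invr_ge0 ?(ltW lam0) //.
  apply: sumr_ge0 => l _; apply: mulr_ge0; first exact: letter_law_ge0.
  apply: sumr_ge0 => g _; apply: mulr_ge0 => //.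
  apply: wrong_factor_ge0 => // *; [exact: letter_law_ge0|exact: kernel_ge0].
apply: wrong_factor_mean => //.
- by move=> l; exact: letter_law_ge0.
- exact: letter_law_total.
- by move=> *; exact: kernel_ge0.
- by move=> *; exact: kernel_total.
Qed.

End OneTest.

Variables (sR s1 s2 sS sG : R).
Hypothesis okR : reliable letter_U letter_A out_y1 #|M| sR lamR.
Hypothesis ok1 : reliable letter_UA letter_tt out_y #|M| s1 lam1.
Hypothesis ok2 : reliable letter_UA letter_tt out_z #|M| s2 lam2.
Hypothesis okS : reliable letter_V letter_UA out_y #|{: Js * Je}| sS lamS.
Hypothesis okG : reliable letter_V letter_UA out_z #|Je| sG lamG.

Definition error_bound (p m : M) (s : Js) (e : Je) (b : nat) ta tb tc : R :=
  let S := in_block b in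
  let l := letters ta tb tc p m (s, e) in
  (\prod_(i | S i) fail_factor pl kernel letter_U letter_A out_y1 sR lamR (l i)
   + \sum_(m' | m' != m) \prod_(i | S i)
      wrong_factor pl kernel letter_U letter_A out_y1 lamR (l i) (tb (p, m') i))
  + (\prod_(i | S i) fail_factor pl kernel letter_UA letter_tt out_y s1 lam1 (l i)
   + \sum_(p' | p' != p) \prod_(i | S i)
      wrong_factor pl kernel letter_UA letter_tt out_y lam1 (l i) (tb (p', m) i, ta p' i))
  + (\prod_(i | S i) fail_factor pl kernel letter_UA letter_tt out_z s2 lam2 (l i)
   + \sum_(p' | p' != p) \prod_(i | S i)
      wrong_factor pl kernel letter_UA letter_tt out_z lam2 (l i) (tb (p', m) i, ta p' i))
  + (\prod_(i | S i) fail_factor pl kernel letter_V letter_UA out_y sS lamS (l i)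
   + \sum_(j' | j' != (s, e)) \prod_(i | S i)
      wrong_factor pl kernel letter_V letter_UA out_y lamS (l i) (tc (p, m, j') i))
  + (\prod_(i | S i) fail_factor pl kernel letter_V letter_UA out_z sG lamG (l i)
   + \sum_(e' | e' != e) \prod_(i | S i)
      wrong_factor pl kernel letter_V letter_UA out_z lamG (l i) (tc (p, m, (s, e')) i)).

Lemma mean_error_bound p m s e b : (b <= B)%N ->
  code_mean (error_bound p m s e b) <= 10 * rho ^+ n.
Proof.
move=> bB; rewrite /error_bound !meanD.
(* Ten terms: each of the five tests may reject the true codeword or accept a competitor. *)
have -> : 10 * rho ^+ n = (rho ^+ n + rho ^+ n) + (rho ^+ n + rho ^+ n)
   + (rho ^+ n + rho ^+ n) + (rho ^+ n + rho ^+ n) + (rho ^+ n + rho ^+ n) by ring.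
have fR := mean_fail okR p m (s, e) bB.
have f1 := mean_fail ok1 p m (s, e) bB.
have f2 := mean_fail ok2 p m (s, e) bB.
have fS := mean_fail okS p m (s, e) bB.
have fG := mean_fail okG p m (s, e) bB.
have wR := @mean_wrongs _ _ _ _ _ _ _ _ _ okR b bB M m (fun m' ta tb tc =>
  \prod_(i | in_block b i) wrong_factor pl kernel letter_U letter_A out_y1 lamR
    (letters ta tb tc p m (s, e) i) (tb (p, m') i)) KB erefl.
have w1 := @mean_wrongs _ _ _ _ _ _ _ _ _ ok1 b bB M p (fun p' ta tb tc =>
  \prod_(i | in_block b i) wrong_factor pl kernel letter_UA letter_tt out_y lam1
    (letters ta tb tc p m (s, e) i) (tb (p', m) i, ta p' i))
    (fun _ ua => PA ua.2 * KB ua.2 ua.1) erefl.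
have w2 := @mean_wrongs _ _ _ _ _ _ _ _ _ ok2 b bB M p (fun p' ta tb tc =>
  \prod_(i | in_block b i) wrong_factor pl kernel letter_UA letter_tt out_z lam2
    (letters ta tb tc p m (s, e) i) (tb (p', m) i, ta p' i))
    (fun _ ua => PA ua.2 * KB ua.2 ua.1) erefl.
have wS := @mean_wrongs _ _ _ _ _ _ _ _ _ okS b bB _ (s, e) (fun j' ta tb tc =>
  \prod_(i | in_block b i) wrong_factor pl kernel letter_V letter_UA out_y lamS
    (letters ta tb tc p m (s, e) i) (tc (p, m, j') i))
    (fun ua v => KC ua.2 ua.1 v) erefl.
have wG := @mean_wrongs _ _ _ _ _ _ _ _ _ okG b bB _ e (fun e' ta tb tc =>
  \prod_(i | in_block b i) wrong_factor pl kernel letter_V letter_UA out_z lamG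
    (letters ta tb tc p m (s, e) i) (tc (p, m, (s, e')) i))
    (fun ua v => KC ua.2 ua.1 v) erefl.
have gV g c : m_gc pl letter_V letter_UA (g, c) = m_c pl letter_UA c * KC c.2 c.1 g.
  by case: c => u a; rewrite m_c_UA (m_gc_V (a, u, g)).
have gt g c : m_gc pl letter_UA letter_tt (g, c) = m_c pl letter_tt c * (PA g.2 * KB g.2 g.1).
  by case: c; rewrite m_c_tt m_gc_tt mul1r.
have KU (c : unit) g : 0 <= PA g.2 * KB g.2 g.1 by exact: mulr_ge0.
apply: lerD; last first.
  apply: (lerD fG); apply: wG => [g c|c g|q qn]; [exact: gV|exact: KC0|].
  by rewrite mean_wrong_C // xpair_eqE eqxx eq_sym.
apply: lerD; last first.
  apply: (lerD fS); apply: wS => [g c|c g|q qn]; [exact: gV|exact: KC0|].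
  by rewrite mean_wrong_C // eq_sym.
apply: lerD; last first.
  apply: (lerD f2); apply: w2 => [g c|c g|q qn]; [exact: gt|exact: KU|].
  by rewrite mean_wrong_A // eq_sym.
apply: lerD; last first.
  apply: (lerD f1); apply: w1 => [g c|c g|q qn]; [exact: gt|exact: KU|].
  by rewrite mean_wrong_A // eq_sym.
apply: (lerD fR); apply: wR => [g c|c g|q qn]; [by rewrite m_c_A m_gc_UA|exact: KB0|].
by rewrite mean_wrong_B // eq_sym.
Qed.

Lemma sum_orb_le (T : finType) (P Q : pred T) (f : T -> R) : (forall t, 0 <= f t) ->
  \sum_(t | P t || Q t) f t <= \sum_(t | P t) f t + \sum_(t | Q t) f t.
Proof.
move=> f0; rewrite big_mkcond [X in X + _]big_mkcond [X in _ + X]big_mkcond -big_split /=.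
by apply: ler_sum => t _; case: (P t); case: (Q t); rewrite ?addr0 ?add0r ?lerDl.
Qed.

Lemma code_letters_in_block ta tb tc g b i : in_block b i ->
  code_letters ta tb tc g i
  = letters ta tb tc (mu g.1 b) (mu g.1 b.+1) (sg g.1.2 b, ep (g.1.2, g.2) b) i.
Proof. by rewrite /in_block => /eqP <-. Qed.

Lemma error_terms_le (L T : Type) (Q : finType) (S : pred 'I_N) (l l' : 'I_N -> L)
    (f : L -> R) (P : pred Q) (w : L -> T -> R) (h : Q -> 'I_N -> T) :
  (forall i, S i -> l i = l' i) ->
  \prod_(i | S i) f (l i) + \sum_(q | P q) \prod_(i | S i) w (l i) (h q i)
  <= \prod_(i | S i) f (l' i) + \sum_(q | P q) \prod_(i | S i) w (l' i) (h q i).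
Proof.
move=> lE; rewrite (eq_bigr (fun i => f (l' i))); last by move=> i Si; rewrite lE.
rewrite lerD2l; apply: ler_sum => q _.
by rewrite (eq_bigr (fun i => w (l' i) (h q i))) // => i Si; rewrite lE.
Qed.

(** Positivity of the codebook serves the competitors too, since [wrong_pass] divides by their
    marginals. *)
Lemma block_error ta tb tc g b : positive ta tb tc ->
  \sum_(o | bad_block ta tb tc g o b) \prod_i kernel (code_letters ta tb tc g i) (o i)
  <= error_bound (mu g.1 b) (mu g.1 b.+1) (sg g.1.2 b) (ep (g.1.2, g.2) b) b ta tb tc.
Proof.
move=> pos.
have [sR0 lR0 _ _] := okR; have [s10 l10 _ _] := ok1; have [s20 l20 _ _] := ok2.
have [sS0 lS0 _ _] := okS; have [sG0 lG0 _ _] := okG.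
have P0 (o : {ffun 'I_N -> out}) : 0 <= \prod_i kernel (code_letters ta tb tc g i) (o i).
  by apply: prodr_ge0 => i _; exact: kernel_ge0.
have pl0 : forall l, 0 <= pl l by move=> l; exact: letter_law_ge0.
have li0 i : 0 < pl (code_letters ta tb tc g i) by exact: pos.
have liE := @code_letters_in_block ta tb tc g b.
rewrite /bad_block /=; set p := mu g.1 b; set m := mu g.1 b.+1.
set s := sg _ _; set e := ep _ _; rewrite -/p -/m -/s -/e in liE.
apply: (le_trans (sum_orb_le _ _ P0)); rewrite /error_bound -!addrA addrA.
apply: lerD.
  apply: le_trans (error_terms_le _ _ _ _ liE).
  apply: (test_error out_y1 pl0 kernel_ge0 kernel_total lR0
    (gc := fun m' i => (tb (p, m') i, ta p i)) sR0 li0) => // [i Si|m' i Si|m' i Si].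
  - by rewrite liE.
  - by rewrite liE.
  - exact: (m_gc_gt0 letter_U letter_A pl0 (pos p m' (s, e) i)).
apply: (le_trans (sum_orb_le _ _ P0)); rewrite addrA.
apply: lerD.
  apply: le_trans (error_terms_le _ _ _ _ liE).
  apply: (test_error out_y pl0 kernel_ge0 kernel_total l10
    (gc := fun p' i => ((tb (p', m) i, ta p' i), tt)) s10 li0) => // [i Si|p' i Si].
  - by rewrite liE.
  - exact: (m_gc_gt0 letter_UA letter_tt pl0 (pos p' m (s, e) i)).
apply: (le_trans (sum_orb_le _ _ P0)); rewrite addrA.
apply: lerD.
  apply: le_trans (error_terms_le _ _ _ _ liE).
  apply: (test_error out_z pl0 kernel_ge0 kernel_total l20
    (gc := fun p' i => ((tb (p', m) i, ta p' i), tt)) s20 li0) => // [i Si|p' i Si].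
  - by rewrite liE.
  - exact: (m_gc_gt0 letter_UA letter_tt pl0 (pos p' m (s, e) i)).
apply: (le_trans (sum_orb_le _ _ P0)); rewrite addrA.
apply: lerD.
  apply: le_trans (error_terms_le _ _ _ _ liE).
  apply: (test_error out_y pl0 kernel_ge0 kernel_total lS0
    (gc := fun j' i => (tc (p, m, j') i, (tb (p, m) i, ta p i))) sS0 li0)
    => // [i Si|j' i Si|j' i Si].
  - by rewrite liE.
  - by rewrite liE.
  - exact: (m_gc_gt0 letter_V letter_UA pl0 (pos p m j' i)).
apply: le_trans (error_terms_le _ _ _ _ liE).
  apply: (test_error out_z pl0 kernel_ge0 kernel_total lG0
    (gc := fun e' i => (tc (p, m, (s, e')) i, (tb (p, m) i, ta p i))) sG0 li0)
    => // [i Si|e' i Si|e' i Si].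
- by rewrite liE.
- by rewrite liE.
- exact: (m_gc_gt0 letter_V letter_UA pl0 (pos p m (s, e') i)).
Qed.

Lemma mean_bad_mass : code_mean (fun ta tb tc =>
    bad_mass (ideal_law ta tb tc) (bad ta tb tc)) <= B.+1%:R * (10 * rho ^+ n).
Proof.
apply: (@le_trans _ _ (code_mean (fun ta tb tc => \sum_(g : data) #|{: data}|%:R^-1 *
   \sum_(b < B.+1) error_bound (mu g.1 b) (mu g.1 b.+1) (sg g.1.2 b) (ep (g.1.2, g.2) b)
      b ta tb tc))).
  apply: mean_le => // ta tb tc pos; apply: ler_sum => g _; rewrite -mulr_sumr.
  rewrite ler_wpM2l ?invr_ge0 ?ler0n //.
  apply: (@le_trans _ _ (\sum_(b < B.+1) \sum_(o | bad_block ta tb tc g o b)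
      \prod_i kernel (code_letters ta tb tc g i) (o i))).
    rewrite (exchange_big_dep xpredT) //= big_mkcond /=; apply: ler_sum => o _.
    have P0 : 0 <= \prod_i kernel (code_letters ta tb tc g i) (o i).
      by apply: prodr_ge0 => i _; exact: kernel_ge0.
    case: ifP => [/existsP[b bb]|_]; last exact: sumr_ge0.
    by rewrite (bigD1 b) //= lerDl sumr_ge0.
  by apply: ler_sum => b _; exact: block_error.
rewrite mean_sum -[leRHS]mul1r -[X in _ <= X * _]sum_uniform_data mulr_suml.
apply: ler_sum => g _; rewrite meanZ ler_wpM2l ?invr_ge0 ?ler0n // mean_sum.
rewrite mulr_natl -[X in _ *+ X]card_ord -sumr_const; apply: ler_sum => b _.
by apply: mean_error_bound; rewrite -ltnS.
Qed.

(** * Leakage of the satellite to receiver 2 *)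

Definition z_of (o : {ffun 'I_N -> out}) : {ffun 'I_N -> Z} := [ffun i => out_z (o i)].
Definition z_law l z := \sum_(o | out_z o == z) kernel l o.
(** The conditional law of [z] given the cloud and relay letters. *)
Definition z_ref ua z := m_yc pl kernel letter_UA out_z z ua / m_c pl letter_UA ua.
Definition z_ideal ta tb tc (g : data) (z : {ffun 'I_N -> Z}) : R :=
  #|{: data}|%:R^-1 * \prod_i z_law (code_letters ta tb tc g i) (z i).
Definition z_cloud ta tb tc (g : data) (z : {ffun 'I_N -> Z}) : R :=
  #|{: data}|%:R^-1 * \prod_i z_ref (letter_UA (code_letters ta tb tc g i)) (z i).
(** At letters of positive probability, the relative entropy of the law of [z] given the full letter
    to its law given the cloud; its mean is [I(V;Z|U,X1)]. *)
Definition leak l := \sum_o kernel l o * info_density pl kernel letter_V letter_UA out_z l o.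
Definition divergence ta tb tc := \sum_g \sum_o ideal_law ta tb tc g o *
  ln (z_ideal ta tb tc g (z_of o) / z_cloud ta tb tc g (z_of o)).

Lemma z_idealE ta tb tc g z :
  z_ideal ta tb tc g z = \sum_(o | z_of o == z) ideal_law ta tb tc g o.
Proof.
rewrite -mulr_sumr; congr (_ * _).
transitivity (\prod_i \sum_o
   if out_z o == z i then kernel (code_letters ta tb tc g i) o else 0).
  by apply: eq_bigr => i _; rewrite -big_mkcond.
rewrite -(sum_ffun_prod (fun i o =>
   if out_z o == z i then kernel (code_letters ta tb tc g i) o else 0)).
rewrite [RHS]big_mkcond; apply: eq_bigr => o _; case: eqP => [<-|/eqP zn].
  by apply: eq_bigr => i _; rewrite ffunE eqxx.
have /existsP[i ni] : [exists i, out_z (o i) != z i].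
  apply: contraNT zn; rewrite negb_exists => /forallP H.
  by apply/eqP/ffunP => i; rewrite ffunE; apply/eqP; rewrite -[_ == _]negbK.
by rewrite (bigD1 i) //= (negbTE ni) mul0r.
Qed.

Lemma m_gyc_z_law l z :
  m_gyc pl kernel letter_V letter_UA out_z (key letter_V letter_UA l) z = pl l * z_law l z.
Proof.
rewrite /m_gyc (big_pred1 l) => [|l']; last by rewrite key_V_inj.
by rewrite mulr_sumr.
Qed.

Lemma info_density_z l o : 0 < pl l -> info_density pl kernel letter_V letter_UA out_z l o
  = ln (z_law l (out_z o) / z_ref (letter_UA l) (out_z o)).
Proof.
move=> l0; rewrite /info_density /num /den m_gyc_z_law m_gc_V /z_ref /=.
have pV : pl l * (pl l)^-1 = 1 by rewrite mulfV // gt_eqF.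
by congr ln; rewrite invf_div invfM -[RHS]mul1r -[X in _ = X * _]pV; ring.
Qed.

Lemma letter_ge0 l : 0 <= pl l. Proof. exact: letter_law_ge0. Qed.

Lemma z_law_gt0 l o : 0 < kernel l o -> 0 < z_law l (out_z o).
Proof.
move=> k0; apply: (lt_le_trans k0); rewrite /z_law (bigD1 o) //= lerDl.
by apply: sumr_ge0 => o' _; exact: kernel_ge0.
Qed.

Lemma z_law_ge0 l z : 0 <= z_law l z.
Proof. by apply: sumr_ge0 => o' _; exact: kernel_ge0. Qed.

Lemma z_ref_ge0 ua z : 0 <= z_ref ua z.
Proof.
apply: divr_ge0; last exact: (m_c_ge0 _ letter_ge0).
exact: (m_yc_ge0 _ _ letter_ge0 kernel_ge0).
Qed.

Lemma z_ref_gt0 l z : 0 < pl l -> 0 < z_law l z -> 0 < z_ref (letter_UA l) z.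
Proof.
move=> l0 z0; apply: divr_gt0; last exact: (m_c_gt0 letter_UA letter_ge0).
apply: lt_le_trans
  (m_gyc_le letter_V letter_UA out_z letter_ge0 kernel_ge0 (key letter_V letter_UA l) z).
by rewrite m_gyc_z_law mulr_gt0.
Qed.

Lemma z_ref_total l : 0 < pl l -> \sum_z z_ref (letter_UA l) z = 1.
Proof.
move=> l0; rewrite -mulr_suml.
have c0 : 0 < m_c pl letter_UA (letter_UA l) by exact: (m_c_gt0 letter_UA letter_ge0).
rewrite (_ : \sum_z _ = m_c pl letter_UA (letter_UA l)) ?mulfV ?gt_eqF //.
rewrite /m_yc exchange_big; apply: eq_bigr => l' _ /=.
transitivity (\sum_o pl l' * kernel l' o); last by rewrite -mulr_sumr kernel_total mulr1.
by rewrite [RHS](partition_big out_z xpredT).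
Qed.

Lemma z_law_sum l (f : Z -> R) : \sum_o kernel l o * f (out_z o) = \sum_z z_law l z * f z.
Proof.
rewrite (partition_big out_z xpredT) //=; apply: eq_bigr => z _.
by rewrite mulr_suml; apply: eq_bigr => o /eqP ->.
Qed.

(** Gibbs' inequality at each letter. The sign is needed for every codebook: otherwise a negative
    divergence could hide large errors in [exists_codebook]. *)
Lemma leak_ge0 l : 0 < pl l -> 0 <= leak l.
Proof.
move=> l0.
have H : \sum_o kernel l o * (z_ref (letter_UA l) (out_z o) / z_law l (out_z o)) <= 1.
  rewrite (z_law_sum l (fun z => z_ref (letter_UA l) z / z_law l z)) -(z_ref_total l0).
  apply: ler_sum => z _; have := z_law_ge0 l z.
  rewrite le_eqVlt => /orP[/eqP <-|z0]; first by rewrite mul0r z_ref_ge0.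
  by rewrite mulrCA mulfV ?mulr1 // gt_eqF.
apply: (@le_trans _ _
   (1 - \sum_o kernel l o * (z_ref (letter_UA l) (out_z o) / z_law l (out_z o)))).
  by rewrite subr_ge0.
rewrite -[X in X - _](kernel_total l) -sumrB; apply: ler_sum => o _.
rewrite -[X in X - _]mulr1 -mulrBr; apply: ler_wM2l_supp; first exact: kernel_ge0.
move=> k0; rewrite info_density_z //; have z0 := z_law_gt0 k0.
have r0 := z_ref_gt0 l0 z0.
have := ln_le_sub1 (divr_gt0 r0 z0); rewrite (ln_div r0 z0) (ln_div z0 r0); lra.
Qed.

Lemma info_leak_ge0 : 0 <= info pl kernel letter_V letter_UA out_z.
Proof.
apply: sumr_ge0 => l _; rewrite -[X in X <= _](mulr0 (pl l)).
by apply: ler_wM2l_supp; [exact: letter_ge0|exact: leak_ge0].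
Qed.

Lemma divergenceE ta tb tc : positive ta tb tc -> divergence ta tb tc
  = #|{: data}|%:R^-1 * \sum_g \sum_i leak (code_letters ta tb tc g i).
Proof.
move=> pos; rewrite mulr_sumr; apply: eq_bigr => g _.
pose li := code_letters ta tb tc g.
have li0 i : 0 < pl (li i) by exact: pos.
transitivity (\sum_o ideal_law ta tb tc g o *
    \sum_i info_density pl kernel letter_V letter_UA out_z (li i) (o i)).
  apply: eq_bigr => o _; rewrite /ideal_law -/li.
  have P0 : 0 <= \prod_i kernel (li i) (o i) by apply: prodr_ge0 => i _; exact: kernel_ge0.
  move: P0; rewrite le_eqVlt => /orP[/eqP <-|P0]; first by rewrite mulr0 !mul0r.
  congr (_ * _).
  have k0 i : 0 < kernel (li i) (o i) by apply: (prod_gt0_factor i _ P0) => j; exact: kernel_ge0.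
  rewrite /z_ideal /z_cloud -mulf_div mulfV ?mul1r; last first.
    by rewrite invr_eq0 gt_eqF // data_card_gt0.
  rewrite -prodf_div ln_prod => [|i].
    by apply: eq_bigr => i _; rewrite info_density_z // ffunE.
  rewrite ffunE; apply: divr_gt0; first exact: z_law_gt0.
  by apply: z_ref_gt0; [exact: li0|exact: z_law_gt0].
rewrite /ideal_law; under eq_bigr do rewrite -mulrA.
rewrite -mulr_sumr; congr (_ * _).
under eq_bigr do rewrite mulr_sumr.
rewrite exchange_big; apply: eq_bigr => i _ /=.
apply: (expect_one (w := fun i => kernel (li i))
  (fun o => info_density pl kernel letter_V letter_UA out_z (li i) o)) => j.
exact: kernel_total.
Qed.

Lemma mean_divergence : code_mean divergence
  <= N%:R * info pl kernel letter_V letter_UA out_z.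
Proof.
apply: (@le_trans _ _ (code_mean (fun ta tb tc =>
   \sum_g #|{: data}|%:R^-1 * \sum_i leak (code_letters ta tb tc g i)))).
  by apply: mean_le => // ta tb tc pos; rewrite divergenceE // mulr_sumr.
rewrite mean_sum -[leRHS]mul1r -[X in _ <= X * _]sum_uniform_data mulr_suml.
apply: ler_sum => g _; rewrite meanZ ler_wpM2l ?invr_ge0 ?ler0n // mean_sum.
rewrite mulr_natl -[X in _ *+ X]card_ord -sumr_const; apply: ler_sum => i _.
(* A single letter is treated as a product over the set reduced to [i], so that [mean_true]
   applies. *)
rewrite [leLHS](_ : _ = \prod_(i' | pred1 i i') \sum_l pl l * leak l).
  by rewrite big_pred1_eq.
rewrite -(mean_true PA1 KB1 KC1 (pred1 i) (mu g.1 (blk i)) (mu g.1 (blk i).+1)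
  (sg g.1.2 (blk i), ep (g.1.2, g.2) (blk i))).
apply: eq_bigr => ta _; congr (_ * _); apply: eq_bigr => tb _; congr (_ * _).
by apply: eq_bigr => tc _; congr (_ * _); rewrite big_pred1_eq.
Qed.

Lemma divergence_ge0 ta tb tc : positive ta tb tc -> 0 <= divergence ta tb tc.
Proof.
move=> pos; rewrite divergenceE // mulr_ge0 ?invr_ge0 ?ler0n //.
by apply: sumr_ge0 => g _; apply: sumr_ge0 => i _; apply: leak_ge0; exact: pos.
Qed.

Lemma bad_mass_nonneg ta tb tc : 0 <= bad_mass (ideal_law ta tb tc) (bad ta tb tc).
Proof. by apply: bad_mass_ge0 => g o; exact: ideal_law_ge0. Qed.

(* One codebook must have both few errors and small leakage: the errors are weighted
   by a large [K], so that averaging the sum controls both terms. *)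
Lemma exists_codebook (K : R) : 0 < K -> exists ta tb tc, [/\ positive ta tb tc,
  bad_mass (ideal_law ta tb tc) (bad ta tb tc)
   <= B.+1%:R * (10 * rho ^+ n) + N%:R * info pl kernel letter_V letter_UA out_z / K &
  divergence ta tb tc
   <= K * (B.+1%:R * (10 * rho ^+ n)) + N%:R * info pl kernel letter_V letter_UA out_z].
Proof.
move=> K0.
have H : code_mean (fun ta tb tc => K * bad_mass (ideal_law ta tb tc) (bad ta tb tc)
   + divergence ta tb tc)
   <= K * (B.+1%:R * (10 * rho ^+ n)) + N%:R * info pl kernel letter_V letter_UA out_z.
  by rewrite meanD meanZ lerD ?mean_divergence // ler_pM2l // mean_bad_mass.
have [ta [tb [tc [pos le]]]] := exists_le_codebook PA0 PA1 KB0 KB1 KC0 KC1 H.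
exists ta, tb, tc; split => //.
  rewrite -(ler_pM2l K0) mulrDr [K * (_ / K)]mulrC mulfVK ?gt_eqF //.
  by have := divergence_ge0 pos; lra.
by have := mulr_ge0 (ltW K0) (bad_mass_nonneg ta tb tc); lra.
Qed.

Definition equivocation_nats ta tb tc :=
  equiv_nats (actual_law ta tb tc) (fun g : data => g.1.2) z_of.

Lemma equivocation_upper (o0 : out) ta tb tc : equivocation_nats ta tb tc
  <= ln #|{ffun 'I_B.+1 -> Js}|%:R + ln 2
     + bad_mass (ideal_law ta tb tc) (bad ta tb tc) * ln #|'I_M1|%:R.
Proof.
have H := @equiv_upper R _ _ _ _ _ (actual_law ta tb tc) (ideal_law ta tb tc)
  (bad ta tb tc) (fun g : data => g.1.2) z_of secret (fun s z => guessG ta tb tc s z).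
apply: le_trans (H _ _ _ _ _) _ => //.
- by move=> g o; exact: actual_law_ge0.
- by move=> g o; exact: laws_agree.
- exact: actual_law_total.
- exact: ideal_law_total.
- move=> g o nb; rewrite -[RHS](guessGP nb); congr guessG.
  by apply: funext => i; rewrite ffunE.
Qed.

(** Data with the same common indices have the same cloud letters, hence the same [z_cloud];
    counting them by [fib] yields the hypothesis [LQ] of [equiv_lower]. *)
Lemma equivocation_lower (o0 : out) ta tb tc (L : R) : positive ta tb tc -> 0 < L ->
  (forall g : common, L <= #|[pred g' : data | [forall b : 'I_B.+2, mu g'.1 b == mu g b]]|%:R) ->
  (1 - bad_mass (ideal_law ta tb tc) (bad ta tb tc)) * ln L - divergence ta tb tc - 1
  <= equivocation_nats ta tb tc.
Proof.
move=> pos L0 fib.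
have H := @equiv_lower R _ _ _ _ _ (actual_law ta tb tc) (ideal_law ta tb tc)
  (bad ta tb tc) (fun g : data => g.1.2) z_of secret (fun s z => guessG ta tb tc s z).
apply: (H _ _ _ _ _ (z_ideal ta tb tc) (z_cloud ta tb tc)) => //.
- by move=> g o; exact: actual_law_ge0.
- by move=> g o; exact: ideal_law_ge0.
- by move=> g o; exact: laws_agree.
- exact: ideal_law_total.
- move=> g o nb; rewrite -[RHS](guessGP nb); congr guessG.
  by apply: funext => i; rewrite ffunE.
- by move=> g z; exact: z_idealE.
- move=> g z; apply: mulr_ge0; first by rewrite invr_ge0 ler0n.
  by apply: prodr_ge0 => i _; exact: z_ref_ge0.
- rewrite -sum_uniform_data; apply: ler_sum => g _; rewrite -mulr_sumr.
  rewrite (sum_ffun_prod (fun i z => z_ref (letter_UA (code_letters ta tb tc g i)) z)).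
  by rewrite big1 ?mulr1 // => i _; apply: z_ref_total; exact: pos.
- move=> g z; rewrite pmulr_rgt0 ?invr_gt0 ?data_card_gt0 // => P0.
  apply: mulr_gt0; first by rewrite invr_gt0 data_card_gt0.
  apply: prodr_gt0 => i _; apply: z_ref_gt0; first exact: pos.
  by apply: (prod_gt0_factor i _ P0) => j; exact: z_law_ge0.
- move=> g z.
  have Q0 g' : 0 <= z_cloud ta tb tc g' z.
    apply: mulr_ge0; first by rewrite invr_ge0 ler0n.
    by apply: prodr_ge0 => i _; exact: z_ref_ge0.
  apply: (@le_trans _ _
     (\sum_(g' in [pred g' : data | [forall b : 'I_B.+2, mu g'.1 b == mu g.1 b]])
        z_cloud ta tb tc g z)).
    rewrite sumr_const -[leRHS]mulr_natl; apply: ler_wpM2r; first exact: Q0.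
    exact: fib.
  rewrite [leRHS](bigID (mem [pred g' : data | [forall b : 'I_B.+2, mu g'.1 b == mu g.1 b]])).
  rewrite -[leLHS]addr0; apply: lerD; last exact: sumr_ge0.
  rewrite le_eqVlt; apply/orP; left; apply/eqP; apply: eq_bigr => g'.
  rewrite inE => /forallP E; congr (_ * _); apply: eq_bigr => i _.
  have E' b : (b <= B.+1)%N -> mu g.1 b = mu g'.1 b.
    by move=> bB; apply/esym/eqP; exact: (E (Ordinal (bB : (b < B.+2)%N))).
  by rewrite /code_letters /letters /letter_UA /= !E' ?ltnS ?blk_le // leqW.
Qed.

Lemma scheme_code (K L : R) (o0 : out) : 0 < K -> 1 <= L ->
  (forall g : common, L <= #|[pred g' : data | [forall b : 'I_B.+2, mu g'.1 b == mu g b]]|%:R) ->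
  let beta0 := B.+1%:R * (10 * rho ^+ n) in
  let I := N%:R * info pl kernel letter_V letter_UA out_z in
  let beta := beta0 + I / K in
  code_with W N M0 M1 beta ((1 - beta) * ln L - (K * beta0 + I) - 1)
    (ln #|{ffun 'I_B.+1 -> Js}|%:R + ln 2 + beta * ln M1%:R).
Proof.
move=> K0 L1 fib beta0 I beta.
have [ta [tb [tc [pos bad_le div_le]]]] := exists_codebook K0.
pose k (l : X1 * U * V) x := KX l.1.1 l.1.2 l.2 x.
pose li := code_letters ta tb tc.
pose rel := relay_in ta tb.
pose bm := bad_mass (ideal_law ta tb tc) (bad ta tb tc).
have yE (o : {ffun 'I_N -> X * Y * Y1 * Z}) :
    (([ffun i => (o i).1.1.2] : {ffun 'I_N -> Y}) : 'I_N -> Y)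
    = (fun i => out_y (o i)) by apply: funext => i; rewrite ffunE.
have zE (o : {ffun 'I_N -> X * Y * Y1 * Z}) :
    (([ffun i => (o i).2] : {ffun 'I_N -> Z}) : 'I_N -> Z)
    = (fun i => out_z (o i)) by apply: funext => i; rewrite ffunE.
have errE (E : data -> {ffun 'I_N -> out} -> bool) :
    (forall g o, ~~ bad ta tb tc g o -> ~~ E g o) ->
    \sum_g \sum_(o | E g o) actual_law ta tb tc g o <= bm.
  move=> H; apply: actual_le_bad_mass => [g o|g o|||g o].
  - exact: actual_law_ge0.
  - exact: laws_agree.
  - exact: actual_law_total.
  - exact: ideal_law_total.
  - by apply: contraTT => /H.
have bm_le : bm <= beta := bad_le.
have w1_gt0 : (0 < M1)%N by case: (g0.1.2) => w wM; exact: leq_ltn_trans wM.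
exists (mix_enc k li), rel, (fun y => (guess1 ta tb tc y).1), (fun z => (guess2 ta tb z).1).
split.
- by apply: mix_enc_ge0 => l x; exact: KX0.
- have kt (l : X1 * U * V) : \sum_x k l x = 1 by exact: KX1.
  exact: (mix_enc_total li g0.2 kt).
- by move=> i y1 y1' yy; exact: relay_causal.
split.
- rewrite (joint_law_sum_cond W k li rel
    (fun w0 w1 y _ => (guess1 ta tb tc y).1 != (w0, w1))).
  apply: le_trans (errE (fun g o => (guess1 ta tb tc [ffun i => (o i).1.1.2]).1
     != (g.1.1, g.1.2)) _) bm_le => g o nb.
  by rewrite yE (guess1P nb) -surjective_pairing negbK.
- rewrite (joint_law_sum_cond W k li rel (fun w0 _ _ z => (guess2 ta tb z).1 != w0)).
  apply: le_trans (errE (fun g o => (guess2 ta tb [ffun i => (o i).2]).1 != g.1.1) _) bm_le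
    => g o nb.
  by rewrite zE negbK; apply/eqP/mu_w0 => b bB; rewrite (guess2P nb).
- rewrite code_equivE; apply: le_trans (equivocation_lower o0 pos _ fib).
    have := ler_wpM2r (ln_ge0 L1) (lerB (lexx 1) bm_le); rewrite -/bm => ?.
    by rewrite lerD2r; apply: lerB.
  exact: lt_le_trans L1.
- rewrite code_equivE; apply: (le_trans (equivocation_upper o0 ta tb tc)).
  by rewrite card_ord lerD2l ler_wpM2r // ln_ge0 // ler1n.
Qed.

End Performance.
End Scheme.

(** * Rates and block lengths *)

Section BlockMessages.
Variables (B k0 ka ks kd kq : nat).
Hypotheses (k0_gt0 : (0 < k0)%N) (ka_gt0 : (0 < ka)%N) (ks_gt0 : (0 < ks)%N).
Hypotheses (kd_gt0 : (0 < kd)%N) (kq_gt0 : (0 < kq)%N).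

(** Sizes per block: [k0] for the common message; [ka], [ks] and [kd] for the parts of the
    confidential one sent in the cloud, kept secret, and used as randomization; [kq] for the dummy
    bits. *)
Definition common_msg : finType := {ffun 'I_B -> 'I_k0}.
Definition private_msg : finType := {ffun 'I_B -> 'I_ka * 'I_ks * 'I_kd}.
Definition dummy_idx : finType := {ffun 'I_B -> 'I_kq}.
Definition idle_idx : 'I_k0 * 'I_ka := (Ordinal k0_gt0, Ordinal ka_gt0).

(* The indices 0 and [B.+1] are idle: the relay decodes forward from the former, the
   receivers decode backward from the latter. *)
Definition msg_mu (g : 'I_#|common_msg| * 'I_#|private_msg|) (b : nat) : 'I_k0 * 'I_ka :=
  if b is b'.+1 then
    if insub b' is Some i
    then ((enum_val g.1 : common_msg) i, ((enum_val g.2 : private_msg) i).1.1) else idle_idx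
  else idle_idx.
(** Messages have [B] entries for [B.+1] blocks: the satellite of block [B] is idle, like its
    current common index. *)
Definition msg_sg (w1 : 'I_#|private_msg|) (b : nat) : 'I_ks :=
  if insub b is Some i then ((enum_val w1 : private_msg) i).1.2 else Ordinal ks_gt0.
Definition msg_ep (wq : 'I_#|private_msg| * dummy_idx) (b : nat) : 'I_kd * 'I_kq :=
  if insub b is Some i then (((enum_val wq.1 : private_msg) i).2, wq.2 i)
  else (Ordinal kd_gt0, Ordinal kq_gt0).

Lemma msg_mu_first g g' : msg_mu g 0 = msg_mu g' 0. Proof. by []. Qed.

Lemma msg_mu_last g g' : msg_mu g B.+1 = msg_mu g' B.+1.
Proof. by rewrite /msg_mu insubF // ltnn. Qed.

Lemma msg_mu_in g (i : 'I_B) :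
  msg_mu g i.+1 = ((enum_val g.1 : common_msg) i, ((enum_val g.2 : private_msg) i).1.1).
Proof. by rewrite /msg_mu valK. Qed.

Lemma msg_mu_w0 g g' : (forall b, (b <= B.+1)%N -> msg_mu g b = msg_mu g' b) -> g.1 = g'.1.
Proof.
move=> H; apply: enum_val_inj; apply/ffunP => i.
have := H i.+1; rewrite ltnS ltnW // => /(_ isT).
by rewrite !msg_mu_in => -[].
Qed.

Lemma msg_inj (g g' : 'I_#|common_msg| * 'I_#|private_msg| * dummy_idx) :
  (forall b, (b <= B.+1)%N -> msg_mu g.1 b = msg_mu g'.1 b) ->
  (forall b, (b <= B)%N -> msg_sg g.1.2 b = msg_sg g'.1.2 b) ->
  (forall b, (b <= B)%N -> msg_ep (g.1.2, g.2) b = msg_ep (g'.1.2, g'.2) b) -> g = g'.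
Proof.
move=> Hm Hs He; have E0 := msg_mu_w0 Hm.
have Es (i : 'I_B) :
    ((enum_val g.1.2 : private_msg) i).1.2 = ((enum_val g'.1.2 : private_msg) i).1.2.
  by have := Hs i (ltnW (ltn_ord i)); rewrite /msg_sg valK.
have Ee (i : 'I_B) : (((enum_val g.1.2 : private_msg) i).2, g.2 i)
    = (((enum_val g'.1.2 : private_msg) i).2, g'.2 i).
  by have := He i (ltnW (ltn_ord i)); rewrite /msg_ep valK.
have Em (i : 'I_B) :
    ((enum_val g.1.2 : private_msg) i).1.1 = ((enum_val g'.1.2 : private_msg) i).1.1.
  by have := Hm i.+1; rewrite ltnS ltnW // => /(_ isT); rewrite !msg_mu_in => -[].
case: g g' E0 Es Ee Em {Hm Hs He} => [[w0 w1] q] [[w0' w1'] q'] /= -> Es Ee Em.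
have -> : q = q' by apply/ffunP => i; case: (Ee i).
suff -> : w1 = w1' by [].
apply: enum_val_inj; apply/ffunP => i.
move: (Es i) (Ee i) (Em i).
case: ((enum_val w1 : private_msg) i) => [[? ?] ?].
by case: ((enum_val w1' : private_msg) i) => [[? ?] ?] /= -> [-> _] ->.
Qed.

(** With the cloud entries of [g] kept, all satellite entries are free, which embeds their choices
    into the fiber. *)
Lemma msg_fiber (g : 'I_#|common_msg| * 'I_#|private_msg|) : ((ks * kd * kq) ^ B <=
  #|[pred g' : 'I_#|common_msg| * 'I_#|private_msg| * dummy_idx |
      [forall b : 'I_B.+2, msg_mu g'.1 b == msg_mu g b]]|)%N.
Proof.
pose F : finType := {ffun 'I_B -> 'I_ks * 'I_kd * 'I_kq}.
have -> : ((ks * kd * kq) ^ B = #|F|)%N by rewrite card_ffun !card_prod !card_ord.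
pose w1 (f : F) : private_msg :=
  [ffun i => (((enum_val g.2 : private_msg) i).1.1, (f i).1.1, (f i).1.2)].
pose h (f : F) : 'I_#|common_msg| * 'I_#|private_msg| * dummy_idx :=
  (g.1, enum_rank (w1 f), [ffun i => (f i).2]).
have h_inj : injective h.
  move=> f f' [] /enum_rank_inj/ffunP E1 /ffunP E2; apply/ffunP => i.
  have := E1 i; have := E2 i; rewrite !ffunE.
  by case: (f i) => [[? ?] ?]; case: (f' i) => [[? ?] ?] /= -> [-> ->].
rewrite -(card_codom h_inj); apply: subset_leq_card; apply/subsetP => _ /codomP[f ->].
rewrite inE; apply/forallP => -[[|b] bB] //=; rewrite /msg_mu.
by case: insubP => // i _ _; rewrite /= enum_rankK ffunE.
Qed.

Lemma card_common_msg : #|common_msg| = (k0 ^ B)%N. Proof. by rewrite card_ffun !card_ord. Qed.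
Lemma card_private_msg : #|private_msg| = ((ka * ks * kd) ^ B)%N.
Proof. by rewrite card_ffun !card_prod !card_ord. Qed.

End BlockMessages.

Section Blocks.
Variables (N B n : nat).
Hypotheses (n_gt0 : (0 < n)%N) (nB : (B.+1 * n <= N)%N).

(** The letters left over by the division of [N] join block [B], so [n] is only a lower bound on the
    block lengths. *)
Definition block_of (i : 'I_N) : nat := minn (i %/ n) B.

Lemma block_of_le i : (block_of i <= B)%N. Proof. exact: geq_minr. Qed.

Lemma block_of_mono (i j : 'I_N) : (i <= j)%N -> (block_of i <= block_of j)%N.
Proof.
move=> ij; rewrite /block_of leq_min geq_minr andbT.
by apply: leq_trans (geq_minl _ _) _; exact: leq_div2r.
Qed.

Lemma block_of_size b : (b <= B)%N -> (n <= #|in_block block_of b|)%N.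
Proof.
move=> bB.
have lt (j : 'I_n) : (b * n + j < N)%N.
  apply: leq_trans nB; apply: (@leq_trans (b.+1 * n)); last by rewrite leq_mul2r ltnS bB orbT.
  by rewrite mulSn addnC ltn_add2r.
pose h (j : 'I_n) := Ordinal (lt j).
have h_inj : injective h by move=> j j' [] /eqP; rewrite eqn_add2l => /eqP /val_inj.
rewrite -[X in (X <= _)%N]card_ord -(card_codom h_inj).
apply: subset_leq_card; apply/subsetP => _ /codomP[j ->].
rewrite unfold_in /in_block /block_of /= divnMDl // divn_small // addn0.
by rewrite (minn_idPl bB).
Qed.

End Blocks.

Lemma expr_small (R : realType) (rho c : R) : 0 < rho < 1 -> 0 < c ->
  exists n0, forall n, (n0 <= n)%N -> rho ^+ n <= c.
Proof.
move=> /andP[r0 r1] c0.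
have l0 : ln rho < 0 by rewrite ln_lt0 // r0 r1.
exists (Num.truncn (ln c / ln rho)).+1 => n nn.
rewrite -(lnK (x := rho)) ?posrE // -expRM_natl -[leRHS](lnK (x := c)) ?posrE // ler_expR.
rewrite -ler_ndivrMr //; apply: ltW; apply: (lt_le_trans (truncnS_gt _)).
by rewrite ler_nat.
Qed.

Lemma ln2_le1 (R : realType) : ln 2 <= 1 :> R.
Proof. by apply: (le_trans (ln_le_sub1 _)); rewrite ?ltr0n //; lra. Qed.

(** Since [expR t < k + 1 <= 2 * k], truncation costs at most [ln 2], which is below 1. *)
Lemma trunc_expR (R : realType) (t : R) : 0 <= t -> let k := Num.truncn (expR t) in
  [/\ (0 < k)%N, k%:R <= expR t, t - 1 <= ln k%:R :> R & ln k%:R <= t].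
Proof.
move=> t0 k.
have e1 : 1 <= expR t by rewrite -expR0 ler_expR.
have k0 : (0 < k)%N by rewrite truncn_gt0.
have /andP[ke ke'] := truncn_itv (expR_ge0 t); rewrite -/k in ke ke'.
have kp : 0 < k%:R :> R by rewrite ltr0n.
split => //.
  have k2 : expR t <= 2 * k%:R.
    apply: ltW; apply: (lt_le_trans ke').
    by rewrite -natrM ler_nat mul2n -addnn -addn1 leq_add2l.
  have l2 := ln2_le1 R.
  have : ln (expR t) <= ln (2 * k%:R) by rewrite ler_ln ?posrE ?expR_gt0 ?mulr_gt0.
  rewrite expRK (lnM (x := 2)) ?posrE //; lra.
by rewrite -[leRHS]expRK ler_ln ?posrE ?expR_gt0.
Qed.

(** The loss has three parts: the backoff [1 - gam], the idle block of length [n <= gam * N], and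
    the roundings, covered by [B.+1 * (S + 1) <= gam * N]. The last bound, with [B.+1], is for
    [secret], which also has an entry for the idle block. *)
Lemma block_rate (R : realType) (N B n : nat) (gam S r : R) : 0 < gam < 1 -> 0 <= r -> r <= S ->
  1 <= gam * B.+1%:R -> (B.+1 * n <= N)%N -> (N <= B.+1 * n + B.+1)%N ->
  B.+1%:R * (S + 1) <= gam * N%:R ->
  let k := Num.truncn (expR (n%:R * ((1 - gam) * r))) in
  [/\ (0 < k)%N, k%:R <= expR (n%:R * ((1 - gam) * r)),
     N%:R * r - gam * N%:R * (2 * S + 1) <= B%:R * ln k%:R,
     B%:R * ln k%:R <= N%:R * r & B.+1%:R * ln k%:R <= N%:R * r].
Proof.
move=> /andP[gam0 gam1] r_ge0 rS B_gt nB Nn CN k.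
have B0 : 0 < B.+1%:R :> R by rewrite ltr0n.
have n0R : 0 <= n%:R :> R by rewrite ler0n.
have nBR : B.+1%:R * n%:R <= N%:R :> R by rewrite -natrM ler_nat.
have NnR : N%:R <= B.+1%:R * n%:R + B.+1%:R :> R by rewrite -natrM -natrD ler_nat.
have ngam : n%:R <= gam * N%:R.
  have : n%:R <= gam * B.+1%:R * n%:R by rewrite ler_peMl.
  by rewrite -mulrA => /le_trans; apply; rewrite ler_pM2l.
have BE : B.+1%:R = B%:R + 1 :> R by rewrite -addn1 natrD.
have g1 : 0 <= 1 - gam by rewrite subr_ge0 ltW.
have [k_gt0 k_le klo khi] : [/\ (0 < k)%N, k%:R <= expR (n%:R * ((1 - gam) * r)),
    n%:R * ((1 - gam) * r) - 1 <= ln k%:R & ln k%:R <= n%:R * ((1 - gam) * r)].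
  by apply: trunc_expR; rewrite !mulr_ge0.
have lk0 : 0 <= ln k%:R :> R by rewrite ln_ge0 // ler1n.
have up : B.+1%:R * ln k%:R <= N%:R * r.
  apply: (@le_trans _ _ (B.+1%:R * (n%:R * ((1 - gam) * r)))); first by rewrite ler_pM2l.
  rewrite mulrA; apply: ler_pM => //; rewrite ?mulr_ge0 ?(ltW B0) //.
  by rewrite ler_piMl // gerBl ltW.
split => //; last by apply: le_trans up; rewrite BE mulrDl mul1r lerDl.
apply: (@le_trans _ _ (B%:R * (n%:R * ((1 - gam) * r) - 1))); last by rewrite ler_wpM2l.
have Bn_lo : N%:R - B.+1%:R - gam * N%:R <= B%:R * n%:R.
  by rewrite BE mulrDl mul1r in NnR *; move: NnR ngam; clear; lra.
have Bn_hi : B%:R * n%:R <= N%:R :> R.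
  by apply: le_trans nBR; rewrite BE mulrDl mul1r lerDl.
have a1 := ler_wpM2r r_ge0 Bn_lo.
have a2 : gam * (B%:R * n%:R) * r <= gam * N%:R * r.
  by rewrite ler_wpM2r // ler_pM2l.
have gN0 : 0 <= gam * N%:R by rewrite mulr_ge0 // ltW.
have a3 := ler_wpM2l gN0 rS.
have a4 := ler_wpM2l (ltW B0) rS.
have a5 : B%:R <= B.+1%:R :> R by rewrite ler_nat.
move: CN a1 a2 a3 a4 a5; clear; lra.
Qed.

Lemma equivocation_rate_lower (R : realType) (N S rs I e1 del beta kb lnL : R) :
  0 <= N -> 0 <= lnL -> beta <= 2 * e1 -> 0 <= e1 ->
  N * (rs + I) - N * del / 2 <= lnL -> lnL <= N * S -> kb <= N * e1 ->
  1 <= e1 * N -> 0 <= S -> e1 * (2 * (4 * S + 2)) = del ->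
  N * (rs - del) <= (1 - beta) * lnL - (kb + N * I) - 1.
Proof.
move=> N0 l0 be e0 lo hi kb1 eN S0 delE; subst del.
have a3 : 0 <= e1 * N * S by rewrite !mulr_ge0.
have a1 := ler_wpM2r l0 be.
have a2 := ler_wpM2l (mulr_ge0 (ler0n R 2) e0) hi.
move: lo kb1 eN a1 a2 a3; clear; lra.
Qed.

Lemma equivocation_rate_upper (R : realType) (N S rs e1 del beta lnS l2 lnM : R) :
  0 <= N -> 0 <= lnM -> beta <= 2 * e1 -> 0 <= e1 ->
  lnS <= N * rs -> lnM <= N * S -> l2 <= 1 -> 1 <= e1 * N ->
  0 <= S -> e1 * (2 * (4 * S + 2)) = del -> lnS + l2 + beta * lnM <= N * (rs + del).
Proof.
move=> N0 l0 be e0 lS lM l21 eN S0 <-.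
have a1 := ler_wpM2r l0 be.
have a2 := ler_wpM2l (mulr_ge0 (ler0n R 2) e0) lM.
have a3 : 0 <= e1 * N by rewrite mulr_ge0.
have a4 : 0 <= e1 * N * S by rewrite mulr_ge0.
move: lS l21 eN a1 a2 a3 a4; clear; lra.
Qed.

Lemma summands_le (R : realType) (a b c d e S : R) : 0 <= a -> 0 <= b -> 0 <= c -> 0 <= d ->
  0 <= e -> S = a + b + c + d + e + 1 -> [/\ a <= S, b <= S, c <= S, d <= S & e <= S].
Proof. by move=> *; split; lra. Qed.

Lemma summands45_le (R : realType) (a b c d e : R) : 0 <= a -> 0 <= b -> 0 <= c ->
  d + e <= a + b + c + d + e + 1.
Proof. by move=> *; lra. Qed.

Lemma summands345_le (R : realType) (a b c d e : R) : 0 <= a -> 0 <= b ->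
  c + d + e <= a + b + c + d + e + 1.
Proof. by move=> *; lra. Qed.

Lemma summands234_le (R : realType) (a b c d e : R) : 0 <= a -> 0 <= e ->
  b + c + d <= a + b + c + d + e + 1.
Proof. by move=> *; lra. Qed.

Lemma rate_dist (R : realType) (x t D : R) : 0 <= D -> t - D / 6 <= x -> x <= t ->
  `|x - t| <= D.
Proof. by move=> *; rewrite ler_norml; apply/andP; split; lra. Qed.

Lemma rate_dist3 (R : realType) (N r r' r'' x x' x'' D : R) : 0 <= D ->
  N * r - D / 6 <= x -> x <= N * r -> N * r' - D / 6 <= x' -> x' <= N * r' ->
  N * r'' - D / 6 <= x'' -> x'' <= N * r'' ->
  [/\ `|x + x' + x'' - N * (r + r' + r'')| <= D, x + x' + x'' <= N * (r + r' + r'')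
    & N * (r + (r' + r'')) - D / 2 <= x + x' + x''].
Proof. by move=> *; split; [rewrite ler_norml; apply/andP; split| |]; lra. Qed.

Section Asymptotics.
Variables (R : realType) (X X1 Y Y1 Z U V : finType).
Variables (W : X -> X1 -> Y -> Y1 -> Z -> R) (PA : X1 -> R) (KB : X1 -> U -> R).
Variables (KC : X1 -> U -> V -> R) (KX : X1 -> U -> V -> X -> R).
Hypothesis W0 : forall x x1 y y1 z, 0 <= W x x1 y y1 z.
Hypothesis W1 : forall x x1, \sum_(t : Y * Y1 * Z) W x x1 t.1.1 t.1.2 t.2 = 1.
Hypothesis PA0 : forall a, 0 <= PA a.
Hypothesis PA1 : \sum_a PA a = 1.
Hypothesis KB0 : forall a b, 0 <= KB a b.
Hypothesis KB1 : forall a, \sum_b KB a b = 1.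
Hypothesis KC0 : forall a b c, 0 <= KC a b c.
Hypothesis KC1 : forall a b, \sum_c KC a b c = 1.
Hypothesis KX0 : forall a b c x, 0 <= KX a b c x.
Hypothesis KX1 : forall a b c, \sum_x KX a b c x = 1.

Local Notation pl := (letter_law PA KB KC).
Local Notation kern := (kernel W KX).
Local Notation infoR := (info pl kern (@letter_U X1 U V) (@letter_A X1 U V) (@out_y1 X Y Y1 Z)).
Local Notation info1 := (info pl kern (@letter_UA X1 U V) (@letter_tt X1 U V) (@out_y X Y Y1 Z)).
Local Notation info2 := (info pl kern (@letter_UA X1 U V) (@letter_tt X1 U V) (@out_z X Y Y1 Z)).
Local Notation infoS := (info pl kern (@letter_V X1 U V) (@letter_UA X1 U V) (@out_y X Y Y1 Z)).
Local Notation infoG := (info pl kern (@letter_V X1 U V) (@letter_UA X1 U V) (@out_z X Y Y1 Z)).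

(** [s], [lam] and [r] are found before [rho] and [n], so that the five tests can then share one
    [rho]. *)
Lemma reliable_exists (Gt Ct Yt : finType) (fG : X1 * U * V -> Gt) (fC : X1 * U * V -> Ct)
    (fY : out X Y Y1 Z -> Yt) (gam : R) :
  0 <= info pl kern fG fC fY -> 0 < gam < 1 ->
  exists s lam r, [/\ 0 <= r, r < 1 & forall rho n cnt, r <= rho -> (0 < cnt)%N ->
    cnt%:R <= expR (n%:R * ((1 - gam) * info pl kern fG fC fY)) ->
    reliable W PA KB KC KX n rho fG fC fY cnt s lam].
Proof.
set I := info _ _ _ _ _ => I0 /andP[gam0 gam1].
have pl0 : forall l, 0 <= pl l by move=> l; exact: letter_law_ge0.
have ff0 s lam : 0 <= \sum_l pl l * fail_factor pl kern fG fC fY s lam l.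
  apply: sumr_ge0 => l _; apply: mulr_ge0 => //.
  by apply: fail_factor_ge0 => // *; exact: kernel_ge0.
have fm := @fail_factor_mean R _ _ _ _ _ pl kern fG fC fY pl0
   (letter_law_total PA1 KB1 KC1) (kernel_ge0 W0 KX0) (kernel_total W1 KX1).
move: I0; rewrite le_eqVlt => /orP[/eqP I0|I0].
  (* With zero information, any threshold with a negative logarithm satisfies [fail_factor_mean]. *)
  have [s s0 slt] := fm (expR (- 1)) (eq_ind _ (fun x => x < I) (eq_ind _ (fun x => - 1 < x)
     (ltrN10 R) _ I0) _ (esym (expRK (- 1)))).
  exists s, (expR (- 1)), (\sum_l pl l * fail_factor pl kern fG fC fY s (expR (- 1)) l).
  split=> // rho n cnt rr cnt0; rewrite -I0 !mulr0 expR0 => cnt1.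
  have -> : cnt = 1%N by apply/eqP; rewrite eqn_leq cnt0 andbT -(@ler_nat R).
  (* Without information there is a single candidate, hence no competitor to exclude. *)
  split; [exact: s0|exact: expR_gt0|exact: rr|] => c nc; rewrite mul0r exprn_ge0 //.
  exact: le_trans rr.
(* Midway between the rate [(1 - gam) * I] of the candidates and [I]: the lower gap pays for the
   union bound ([r2]), the upper one for Chernoff's bound ([r1]). *)
pose th := (1 - gam / 2) * I.
have thI : th < I.
  by rewrite /th mulrBl mul1r gtrBl; apply: mulr_gt0 => //; lra.
have [s s0 slt] := fm (expR th) (eq_ind _ (fun x => x < I) thI _ (esym (expRK th))).
pose r1 := \sum_l pl l * fail_factor pl kern fG fC fY s (expR th) l.
pose r2 := expR (- (gam / 2 * I)).
have r2_lt : r2 < 1 by rewrite /r2 expR_lt1 oppr_lt0 mulr_gt0 //; lra.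
exists s, (expR th), (Num.max r1 r2); split.
- by rewrite le_max ff0.
- by rewrite gt_max slt r2_lt.
move=> rho n cnt; rewrite ge_max => /andP[r1r r2r] cnt0 cntle.
split; [exact: s0|exact: expR_gt0|exact: r1r|] => c nc.
have r20 : 0 <= r2 by exact: expR_ge0.
apply: (@le_trans _ _ (r2 ^+ n)); last by rewrite lerXn2r ?nnegrE // (le_trans r20).
have th0 : 0 < th by apply: mulr_gt0 => //; lra.
apply: (@le_trans _ _ (cnt%:R * (expR th)^-1 ^+ n)).
  apply: ler_pM; rewrite ?ler0n ?exprn_ge0 ?invr_ge0 ?expR_ge0 // ?ler_nat ?leq_pred //.
  rewrite ler_wiXn2l ?invr_ge0 ?expR_ge0 // invf_le1 ?expR_gt0 //.
  by rewrite -expR0 ler_expR ltW.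
rewrite -expRN -!expRM_natl.
apply: (@le_trans _ _ (expR (n%:R * ((1 - gam) * I)) * expR (n%:R * - th))).
  by rewrite ler_wpM2r ?expR_ge0.
rewrite -expRD ler_expR le_eqVlt; apply/orP; left; apply/eqP; by rewrite /th; field.
Qed.

Lemma code_with_weaken N M0 M1 (b b' lo lo' hi hi' : R) : b <= b' -> lo' <= lo -> hi <= hi' ->
  code_with W N M0 M1 b lo hi -> code_with W N M0 M1 b' lo' hi'.
Proof.
move=> bb ll hh [enc [rel [d1 [d2 [e0 e1 c [p1 p2 l h]]]]]].
exists enc, rel, d1, d2; split => //; split.
- exact: le_trans bb.
- exact: le_trans bb.
- exact: le_trans l.
- exact: le_trans hh.
Qed.

(** The equality [rd + rq = infoG] makes the two bounds meet: the satellite carries about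
    [N * (rs + rd + rq)] nats, of which the leak removes [N * infoG], leaving [N * rs]. *)
Lemma asymptotic_code (o0 : out X Y Y1 Z) (r0 ra rs rd rq del : R) :
  0 <= r0 -> 0 <= ra -> 0 <= rs -> 0 <= rd -> 0 <= rq ->
  r0 + ra <= infoR -> r0 + ra <= info1 -> r0 + ra <= info2 ->
  rs + rd + rq <= infoS -> rd + rq = infoG -> 0 < del <= 1 ->
  exists N0, forall N, (N0 <= N)%N -> exists M0 M1, [/\ (0 < M0)%N, (0 < M1)%N,
    `|ln M0%:R - N%:R * r0| <= N%:R * del, `|ln M1%:R - N%:R * (ra + rs + rd)| <= N%:R * del &
    code_with W N M0 M1 del (N%:R * (rs - del)) (N%:R * (rs + del))].
Proof.
move=> r00 ra0 rs0 rd0 rq0 leR le1 le2 leS eqG /andP[del0 del1].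
have [S SE] : exists S : R, S = r0 + ra + rs + rd + rq + 1 by eexists.
have S1 : 1 <= S by lra.
(* Half of [del] is kept for rounding the rates in the lower bound; the other half,
   [e1 * (4 * S + 2)], absorbs the errors and the additive constants. *)
pose e1 := del / (2 * (4 * S + 2)).
have e10 : 0 < e1 by rewrite divr_gt0 //; lra.
have e1E : e1 * (2 * (4 * S + 2)) = del by rewrite mulfVK // gt_eqF //; lra.
(* Each rate then loses at most [del / 6] per letter in [block_rate], and a sum of three rates at
   most [del / 2]. *)
pose gam := del / (6 * (2 * S + 1)).
have gam0 : 0 < gam by rewrite divr_gt0 //; lra.
have gamE : gam * (6 * (2 * S + 1)) = del by rewrite mulfVK // gt_eqF //; lra.
have gam1 : gam < 1.
  by rewrite ltr_pdivrMr ?mul1r; lra.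
have gam01 : 0 < gam < 1 by rewrite gam0.
pose B := Num.truncn gam^-1.
have B_gt : 1 <= gam * B.+1%:R.
  by rewrite -ler_pdivrMl // mulr1 ltW // truncnS_gt.
have iR0 : 0 <= infoR by lra.
have i10 : 0 <= info1 by lra.
have i20 : 0 <= info2 by lra.
have iS0 : 0 <= infoS by lra.
have iG0 : 0 <= infoG by lra.
have [sR [lR [tR [tR0 tR1 okR]]]] := reliable_exists iR0 gam01.
have [s1 [l1 [t1 [t10 t11 ok1]]]] := reliable_exists i10 gam01.
have [s2 [l2 [t2 [t20 t21 ok2]]]] := reliable_exists i20 gam01.
have [sS [lS [tS [tS0 tS1 okS]]]] := reliable_exists iS0 gam01.
have [sG [lG [tG [tG0 tG1 okG]]]] := reliable_exists iG0 gam01.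
have [rho [rho0 rho1 [hR h1 h2 hS hG]]] : exists rho : R, [/\ 0 < rho, rho < 1 &
   [/\ tR <= rho, t1 <= rho, t2 <= rho, tS <= rho & tG <= rho]].
  pose m := Num.max tR (Num.max t1 (Num.max t2 (Num.max tS tG))).
  (* The maximum with 1/2 keeps [rho] positive, as [expr_small] takes its logarithm. *)
  exists (Num.max m 2^-1); rewrite !lt_max !gt_max tR1 t11 t21 tS1 tG1 invr_gt0 ltr0n orbT.
  have -> : 2^-1 < 1 :> R by rewrite invf_lt1 ?ltr1n ?ltr0n.
  by split=> //; split; rewrite !le_max lexx ?orbT.
(* With the weight [K = N * kap] the leak adds at most [e1] to the errors, because [infoG <= S]. In
   exchange the errors enter the divergence multiplied by [K], so their mean is first brought below
   [e1 / (kap + 1)]. *)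
pose kap := S / e1.
have S0 : 0 < S by exact: lt_le_trans S1.
have kap0 : 0 < kap by exact: divr_gt0.
have kap1 : 0 < kap + 1 by apply: addr_gt0.
have B0 : 0 < B.+1%:R :> R by rewrite ltr0n.
have [||n0 n0P] := @expr_small R rho (e1 / (kap + 1) / (10 * B.+1%:R)).
- by rewrite rho0.
- by apply: divr_gt0; [exact: divr_gt0|apply: mulr_gt0].
exists (maxn (B.+1 * n0.+1) (maxn (Num.truncn (B.+1%:R * (S + 1) / gam)).+1
  (Num.truncn e1^-1).+1)) => N.
rewrite !geq_max => /andP[N1 /andP[N2 N3]].
pose n := (N %/ B.+1)%N.
have n0n : (n0 < n)%N by rewrite leq_divRL // mulnC.
have n_gt0 : (0 < n)%N by exact: leq_ltn_trans n0n.
have nB : (B.+1 * n <= N)%N by rewrite mulnC leq_trunc_div.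
have Nn : (N <= B.+1 * n + B.+1)%N by rewrite mulnC ltnW // {1}(divn_eq N B.+1) ltn_add2l ltn_mod.
have CN : B.+1%:R * (S + 1) <= gam * N%:R.
  rewrite -ler_pdivrMl // mulrC; apply: ltW; apply: (lt_le_trans (truncnS_gt _)).
  by rewrite ler_nat.
have eN : 1 <= e1 * N%:R.
  rewrite -ler_pdivrMl // mulr1; apply: ltW; apply: (lt_le_trans (truncnS_gt _)).
  by rewrite ler_nat.
have N0 : 0 < N%:R :> R by rewrite ltr0n (leq_trans _ N1).
pose k r := Num.truncn (expR (n%:R * ((1 - gam) * r))).
have kB r (r_ge0 : 0 <= r) (rS : r <= S) := block_rate gam01 r_ge0 rS B_gt nB Nn CN.
have [r0S raS rsS rdS rqS] := summands_le r00 ra0 rs0 rd0 rq0 SE.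
have [k0p k0e b01 b02 b03] := kB r0 r00 r0S.
have [kap_ kae ba1 ba2 ba3] := kB ra ra0 raS.
have [ksp kse bs1 bs2 bs3] := kB rs rs0 rsS.
have [kdp kde bd1 bd2 bd3] := kB rd rd0 rdS.
have [kqp kqe bq1 bq2 bq3] := kB rq rq0 rqS.
rewrite -/(k _) in k0p k0e b01 b02 b03 kap_ kae ba1 ba2 ba3 ksp kse bs1 bs2 bs3
  kdp kde bd1 bd2 bd3 kqp kqe bq1 bq2 bq3.
have gN : gam * N%:R * (2 * S + 1) = N%:R * del / 6 by rewrite -gamE; field.
rewrite gN in b01 ba1 bs1 bd1 bq1.
have lnk j : (0 < j)%N -> 0 < j%:R :> R by rewrite ltr0n.
have lnprod a b c : (0 < a)%N -> (0 < b)%N -> (0 < c)%N ->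
    ln ((a * b * c)%N ^ B)%:R = B%:R * ln a%:R + B%:R * ln b%:R + B%:R * ln c%:R :> R.
  move=> a0 b0 c0; rewrite natrX lnXn ?lnk ?muln_gt0 ?a0 ?b0 // !natrM.
  rewrite (lnM (y := c%:R)) ?(lnM (x := a%:R)) ?posrE ?mulr_gt0 ?lnk //.
  by rewrite -[LHS]mulr_natl !mulrDr.
have lnM0 : ln (#|common_msg B (k r0)|%:R) = B%:R * ln (k r0)%:R :> R.
  by rewrite card_common_msg natrX lnXn ?lnk // mulr_natl.
have lnM1 : ln (#|private_msg B (k ra) (k rs) (k rd)|%:R)
    = B%:R * ln (k ra)%:R + B%:R * ln (k rs)%:R + B%:R * ln (k rd)%:R :> R.
  by rewrite card_private_msg lnprod.
have M1_gt0 : (0 < #|private_msg B (k ra) (k rs) (k rd)|)%N.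
  by rewrite card_private_msg expn_gt0 !muln_gt0 kap_ ksp kdp.
have Ndel : 0 <= N%:R * del by rewrite mulr_ge0 // ltW.
exists #|common_msg B (k r0)|, #|private_msg B (k ra) (k rs) (k rd)|; split=> //.
- by rewrite card_common_msg expn_gt0 k0p.
- by rewrite lnM0; exact: rate_dist b01 b02.
- by rewrite lnM1; have [] := rate_dist3 Ndel ba1 ba2 bs1 bs2 bd1 bd2.
pose L : R := ((k rs * k rd * k rq)^B)%N%:R.
have lnL : ln L = B%:R * ln (k rs)%:R + B%:R * ln (k rd)%:R + B%:R * ln (k rq)%:R.
  by rewrite lnprod.
have L1 : 1 <= L by rewrite ler1n expn_gt0 !muln_gt0 ksp kdp kqp.
pose K := N%:R * kap.
have K0 : 0 < K by rewrite mulr_gt0.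
have mulk a b I : 0 <= a -> 0 <= b -> a + b <= I ->
    (k a)%:R <= expR (n%:R * ((1 - gam) * a)) -> (k b)%:R <= expR (n%:R * ((1 - gam) * b)) ->
    (k a * k b)%:R <= expR (n%:R * ((1 - gam) * I)).
  move=> a0 b0 abI ea eb; rewrite natrM; apply: (le_trans (ler_pM _ _ ea eb)) => //.
  rewrite -expRD ler_expR -!mulrDr ler_wpM2l // ler_wpM2l // subr_ge0; exact: ltW.
have g0 : 'I_#|common_msg B (k r0)| * 'I_#|private_msg B (k ra) (k rs) (k rd)| * dummy_idx B (k rq).
  split; last exact: [ffun=> Ordinal kqp].
  split; apply: enum_rank; first exact: [ffun=> Ordinal k0p].
  exact: [ffun=> (Ordinal kap_, Ordinal ksp, Ordinal kdp)].
have iG : (k rd * k rq)%:R <= expR (n%:R * ((1 - gam) * infoG)).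
  by apply: mulk => //; rewrite eqG.
have iS : (k rs * (k rd * k rq))%:R <= expR (n%:R * ((1 - gam) * infoS)).
  rewrite natrM; apply: (le_trans (ler_pM _ _ kse (mulk rd rq _ rd0 rq0 (lexx _) kde kqe))) => //.
  rewrite -expRD ler_expR -!mulrDr ler_wpM2l // ler_wpM2l ?subr_ge0 ?(ltW gam1) //.
  by rewrite addrA.
have m0p : (0 < k r0 * k ra)%N by rewrite muln_gt0 k0p kap_.
have dp : (0 < k rd * k rq)%N by rewrite muln_gt0 kdp kqp.
have sp : (0 < k rs * (k rd * k rq))%N by rewrite muln_gt0 ksp dp.
have RR := okR rho n _ hR m0p (mulk r0 ra _ r00 ra0 leR k0e kae).
have RR1 := ok1 rho n _ h1 m0p (mulk r0 ra _ r00 ra0 le1 k0e kae).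
have RR2 := ok2 rho n _ h2 m0p (mulk r0 ra _ r00 ra0 le2 k0e kae).
have RRS := okS rho n _ hS sp iS.
have RRG := okG rho n _ hG dp iG.
have cM : #|{: 'I_(k r0) * 'I_(k ra)}| = (k r0 * k ra)%N by rewrite card_prod !card_ord.
have cG : #|{: 'I_(k rd) * 'I_(k rq)}| = (k rd * k rq)%N by rewrite card_prod !card_ord.
have cS : #|{: 'I_(k rs) * ('I_(k rd) * 'I_(k rq))}| = (k rs * (k rd * k rq))%N.
  by rewrite card_prod cG card_ord.
rewrite -cM in RR RR1 RR2; rewrite -cS in RRS; rewrite -cG in RRG.
have H := @scheme_code R X X1 Y Y1 Z U V W PA KB KC KX W0 W1 PA0 PA1 KB0 KB1 KC0 KC1 KX0 KX1
  N B _ _ (dummy_idx B (k rq)) _ _ _ (block_of B n) (block_of_le B n) (block_of_mono B n)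
  (msg_mu k0p kap_) (msg_sg ksp) (msg_ep kdp kqp) (@msg_mu_first _ _ _ _ _ _ _)
  (@msg_mu_last _ _ _ _ _ _ _) (@msg_mu_w0 _ _ _ _ _ _ _) (@msg_inj _ _ _ _ _ _ _ _ _ _ _)
  lR l1 l2 lS lG g0 n rho (ltW rho0) (ltW rho1) (block_of_size n_gt0 nB) sR s1 s2 sS sG
  RR RR1 RR2 RRS RRG K L o0 K0 L1.
have {}H := H (fun g => etrans (ler_nat R _ _) (msg_fiber _ _ _ g)).
have beta0_le : B.+1%:R * (10 * rho ^+ n) <= e1 / (kap + 1).
  have := n0P n (ltnW n0n); rewrite ler_pdivlMr; last by apply: mulr_gt0.
  by rewrite mulrC -mulrA mulrCA [10 * _]mulrC mulrA.
have q1 : e1 / (kap + 1) <= e1.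
  by rewrite ler_pdivrMr // ler_peMr ?(ltW e10) // lerDr ltW.
have q2 : kap * (e1 / (kap + 1)) <= e1.
  by rewrite mulrCA ler_piMr ?(ltW e10) // ler_pdivrMr // mul1r lerDl.
have IS : infoG <= S by rewrite -eqG SE; move: r00 ra0 rs0 => *; exact: summands45_le.
have q3 : N%:R * infoG / K <= e1.
  have -> : N%:R * infoG / K = infoG / S * e1.
    by rewrite /K /kap; field; rewrite !gt_eqF.
  by rewrite ler_piMl ?(ltW e10) // ler_pdivrMr // mul1r.
have beta_le : B.+1%:R * (10 * rho ^+ n) + N%:R * infoG / K <= 2 * e1.
  by rewrite [leRHS](_ : _ = e1 + e1); [apply: lerD => //; exact: le_trans q1|ring].
have [_ lM1 _] := rate_dist3 Ndel ba1 ba2 bs1 bs2 bd1 bd2.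
have [_ lL hL] := rate_dist3 Ndel bs1 bs2 bd1 bd2 bq1 bq2.
rewrite -lnM1 in lM1; rewrite -lnL in lL hL.
have lL' : ln L <= N%:R * S.
  by apply: (le_trans lL); rewrite ler_pM2l // SE; exact: summands345_le.
have lM1' : ln (#|private_msg B (k ra) (k rs) (k rd)|%:R) <= N%:R * S.
  by apply: (le_trans lM1); rewrite ler_pM2l // SE; exact: summands234_le.
apply: code_with_weaken H.
- apply: (le_trans beta_le); rewrite -e1E mulrC ler_wpM2l ?(ltW e10) //.
  by rewrite ler_peMr // (le_trans (ler1n R 2)) // lerDr mulr_ge0 // ltW.
- apply: (equivocation_rate_lower (ltW N0) (ln_ge0 L1) beta_le (ltW e10) _ lL' _ eN (ltW S0) e1E).
    by rewrite -eqG.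
  rewrite /K -mulrA ler_pM2l //; apply: le_trans q2; exact: ler_wpM2l (ltW kap0) _ _ beta0_le.
- apply: (equivocation_rate_upper (ltW N0) _ beta_le (ltW e10) _ lM1' (ln2_le1 R) eN (ltW S0) e1E).
    by rewrite ln_ge0 // ler1n.
  by rewrite card_ffun !card_ord natrX lnXn ?lnk // -[leLHS]mulr_natl.
Qed.

End Asymptotics.

(** * Logarithms to base 2 and codes over the reals *)

(** A conditional law; where the marginal vanishes, the point mass at [b0] stands in for it. *)
Lemma kernel_exists (R : realType) (A B : finType) (b0 : B) (P : A -> B -> R) :
  (forall a b, 0 <= P a b) -> exists K : A -> B -> R,
  [/\ forall a b, 0 <= K a b, forall a, \sum_b K a b = 1
    & forall a b, P a b = (\sum_b' P a b') * K a b].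
Proof.
move=> P0; exists (fun a b => if \sum_b' P a b' == 0 then (b == b0)%:R
   else P a b / \sum_b' P a b'); split => [a b|a|a b]; case: eqP => [S0|/eqP S0].
- by rewrite ler0n.
- by rewrite divr_ge0 // sumr_ge0.
- rewrite (bigD1 b0) //= eqxx big1 ?addr0 // => b /negbTE ->; exact: erefl.
- by rewrite -mulr_suml mulfV.
- by rewrite S0 mul0r; exact: (psumr_eq0P _ S0).
- by rewrite mulrCA mulfV ?mulr1.
Qed.

Lemma log2E (x : R) : log2 x = exp.ln x / exp.ln 2.
Proof. by rewrite /log2 !RlnE RdivE. Qed.

Lemma plogqE (a b : R) : 0 <= a -> plogq a b = a * exp.ln b / exp.ln 2.
Proof.
move=> a0; rewrite /plogq; case: Rlt_dec => /= [_|/RltP a0'].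
  by rewrite log2E RmultE mulrA.
have -> : a = 0 by apply/eqP; rewrite eq_le a0 andbT leNgt.
by rewrite !mul0r.
Qed.

Section Bridge.
Variables (X X1 Y Y1 Z U V : finType) (W : X -> X1 -> Y -> Y1 -> Z -> R).
Variables (PUV : U -> V -> R) (PX : U -> V -> X -> X1 -> R).
Variables (PA : X1 -> R) (KB : X1 -> U -> R) (KC : X1 -> U -> V -> R).
Variable KX : X1 -> U -> V -> X -> R.
Hypothesis W0 : forall x x1 y y1 z, 0 <= W x x1 y y1 z.
Hypothesis PA0 : forall a, 0 <= PA a.
Hypothesis KB0 : forall a b, 0 <= KB a b.
Hypothesis KC0 : forall a b c, 0 <= KC a b c.
Hypothesis KX0 : forall a b c x, 0 <= KX a b c x.
Hypothesis factor : forall u v x a,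
  PUV u v * PX u v x a = letter_law PA KB KC (a, u, v) * KX a u v x.

Local Notation pl := (letter_law PA KB KC).
Local Notation kern := (kernel W KX).
Local Notation D7 := (U * V * X * X1 * Y * Y1 * Z)%type.

Definition split7 (l : X1 * U * V) (o : out X Y Y1 Z) : D7 :=
  (l.1.2, l.2, o.1.1.1, l.1.1, o.1.1.2, o.1.2, o.2).

Lemma joint7E l o : joint7 PUV PX W (split7 l o) = pl l * kern l o.
Proof.
case: l => [[a u] v]; case: o => [[[x y] y1] z].
by rewrite /joint7 /split7 /= !RmultE factor /kernel /out_law /= mulrA.
Qed.

Lemma margE (T : finType) (f : D7 -> T) (t : T) :
  marg (joint7 PUV PX W) f t
  = \sum_l \sum_o (if f (split7 l o) == t then pl l * kern l o else 0).
Proof.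
transitivity (\sum_(d : D7 | f d == t) joint7 PUV PX W d); first by [].
rewrite big_mkcond pair_bigA /=.
rewrite (reindex (fun lo : (X1 * U * V) * out X Y Y1 Z => split7 lo.1 lo.2)).
  by apply: eq_bigr => lo _; rewrite joint7E.
exists (fun d : D7 => ((d.1.1.1.2, d.1.1.1.1.1.1, d.1.1.1.1.1.2),
   (d.1.1.1.1.2, d.1.1.2, d.1.2, d.2))).
  by case=> [[[a u] v] [[[x y] y1] z]] _.
by move=> [[[[[[u v] x] x1] y] y1] z] _.
Qed.

Lemma cond_mutinfoE (Gt Ct Yt : finType) (fA : D7 -> Gt) (fB : D7 -> Yt) (fC : D7 -> Ct)
    (fG : X1 * U * V -> Gt) (fC' : X1 * U * V -> Ct) (fY : out X Y Y1 Z -> Yt) :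
  (forall l o, fA (split7 l o) = fG l) -> (forall l o, fC (split7 l o) = fC' l) ->
  (forall l o, fB (split7 l o) = fY o) -> (forall l, \sum_o kern l o = 1) ->
  cond_mutinfo (joint7 PUV PX W) fA fB fC = info pl kern fG fC' fY / exp.ln 2.
Proof.
move=> EA EC EB k1.
have pl0 : forall l, 0 <= pl l by move=> l; exact: letter_law_ge0.
have k0 : forall l o, 0 <= kern l o by move=> l o; exact: kernel_ge0.
have m_abc g y c : marg (joint7 PUV PX W) (fun t => (fA t, fB t, fC t)) (g, y, c)
    = m_gyc pl kern fG fC' fY (g, c) y.
  rewrite margE /m_gyc [RHS]big_mkcond; apply: eq_bigr => l _.
  rewrite /key; case: ifP => [/eqP[<- <-]|H].
    rewrite [RHS]big_mkcond; apply: eq_bigr => o _.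
    by rewrite EA EB EC !xpair_eqE !eqxx andbT.
  apply: big1 => o _; rewrite EA EB EC !xpair_eqE; case: ifP => // /andP[/andP[h1 _] h2].
  by rewrite xpair_eqE h1 h2 in H.
have m_ac g c : marg (joint7 PUV PX W) (fun t => (fA t, fC t)) (g, c) = m_gc pl fG fC' (g, c).
  rewrite margE /m_gc [RHS]big_mkcond; apply: eq_bigr => l _.
  under eq_bigr do rewrite EA EC.
  by rewrite /key; case: ifP => _; [rewrite -mulr_sumr k1 mulr1|rewrite big1].
have m_bc y c : marg (joint7 PUV PX W) (fun t => (fB t, fC t)) (y, c)
    = m_yc pl kern fC' fY y c.
  rewrite margE /m_yc [RHS]big_mkcond; apply: eq_bigr => l _.
  case: ifP => [/eqP <-|H].
    rewrite [RHS]big_mkcond; apply: eq_bigr => o _.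
    by rewrite EB EC !xpair_eqE !eqxx andbT.
  by apply: big1 => o _; rewrite EB EC !xpair_eqE H andbF.
have m_cc c : marg (joint7 PUV PX W) fC c = m_c pl fC' c.
  rewrite margE /m_c [RHS]big_mkcond; apply: eq_bigr => l _.
  under eq_bigr do rewrite EC.
  by case: ifP => _; [rewrite -mulr_sumr k1 mulr1|rewrite big1].
rewrite infoE mulr_suml /cond_mutinfo.
apply: eq_bigr => -[[g y] c] _ /=.
by rewrite m_abc m_ac m_bc m_cc plogqE ?m_gyc_ge0 // RdivE !RmultE.
Qed.

End Bridge.

Section CodeBridge.
Variables (X X1 Y Y1 Z : finType) (W : X -> X1 -> Y -> Y1 -> Z -> R) (N M0 M1 : nat).
Hypothesis W0 : forall x x1 y y1 z, 0 <= W x x1 y y1 z.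
Variables (enc : 'I_M0 -> 'I_M1 -> {ffun 'I_N -> X} -> R).
Variables (rel : 'I_N -> {ffun 'I_N -> Y1} -> X1).
Variables (dec1 : {ffun 'I_N -> Y} -> 'I_M0 * 'I_M1) (dec2 : {ffun 'I_N -> Z} -> 'I_M0).
Hypothesis enc0 : forall w0 w1 x, 0 <= enc w0 w1 x.

Definition det_relay (i : 'I_N) (y1 : {ffun 'I_N -> Y1}) (x1 : {ffun 'I_N -> X1}) (a : X1) : R :=
  (a == rel i y1)%:R.
Definition det_code : code X X1 Y Y1 Z N M0 M1 := Code enc det_relay dec1 dec2.

Lemma code_jointE t : code_joint W det_code t = joint_of W rel enc t.
Proof.
case: t => [[[[[[w0 w1] x] x1] y] y1] z].
by rewrite /code_joint /joint_of /= !RmultE !INRE RinvE.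
Qed.

Lemma joint_of_ge0 t : 0 <= joint_of W rel enc t.
Proof.
rewrite /joint_of; apply: mulr_ge0.
  by apply: mulr_ge0 => //; rewrite invr_ge0 mulr_ge0.
by apply: prodr_ge0 => i _; rewrite mulr_ge0.
Qed.

Lemma Pe1E : Pe1 W det_code
  = \sum_(t | dec1 t.1.1.2 != (t.1.1.1.1.1.1, t.1.1.1.1.1.2)) joint_of W rel enc t.
Proof. by apply: eq_bigr => t _; exact: code_jointE. Qed.

Lemma Pe2E : Pe2 W det_code = \sum_(t | dec2 t.2 != t.1.1.1.1.1.1) joint_of W rel enc t.
Proof. by apply: eq_bigr => t _; exact: code_jointE. Qed.

Lemma marg_codeE (S : finType) (f : code_space X X1 Y Y1 Z N M0 M1 -> S) s :
  marg (code_joint W det_code) f s = \sum_(t | f t == s) joint_of W rel enc t.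
Proof. by apply: eq_bigr => t _; exact: code_jointE. Qed.

Lemma equivocationE : (0 < N)%N ->
  N%:R * (equivocation W det_code * exp.ln 2) = code_equiv W rel enc.
Proof.
move=> N0; rewrite /equivocation /cond_entropy INRE RmultE RinvE RoppE.
have l2 : 0 < exp.ln 2 :> R by rewrite ln_gt0 // ltr1n.
rewrite -mulrA mulVKf ?pnatr_eq0 -?lt0n // /code_equiv mulNr; congr (- _).
rewrite -[X in X * _ = _]/(\sum_(ac : 'I_M1 * {ffun 'I_N -> Z}) _) mulr_suml pair_bigA /=.
apply: eq_bigr => -[a c] _ /=.
have E1 : marg (code_joint W det_code) (fun t => (t.1.1.1.1.1.2, t.2)) (a, c)
    = msg_z_law W rel enc a c.
  by rewrite marg_codeE; apply: eq_bigl => t; rewrite xpair_eqE.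
rewrite E1 marg_codeE plogqE ?RdivE ?mulfVK ?gt_eqF //.
by apply: sumr_ge0 => t _; exact: joint_of_ge0.
Qed.

Lemma det_code_valid : (0 < M0)%N -> (0 < M1)%N ->
  (forall w0 w1, \sum_x enc w0 w1 x = 1) ->
  (forall (i : 'I_N) (y1 y1' : {ffun 'I_N -> Y1}),
     (forall j : 'I_N, (j < i)%N -> y1 j = y1' j) -> rel i y1 = rel i y1') ->
  valid_code det_code.
Proof.
move=> M00 M10 enc1 causal; do 2! split => //.
split; first by move=> w0 w1 x; apply/RleP; exact: enc0.
split; first exact: enc1.
split; first by move=> i y1 x1 a; apply/RleP; rewrite ler0n.
split.
  move=> i y1 x1; change (\sum_a (a == rel i y1)%:R = 1 :> R).
  by rewrite (bigD1 (rel i y1)) //= eqxx big1 ?addr0 // => a /negbTE ->.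
move=> i y1 y1' x1 x1' H; apply: funext => a /=; rewrite /det_relay (causal i y1 y1') //.
by move=> j ji; have [] := H j ji.
Qed.

End CodeBridge.

Lemma code_of_code_with (X X1 Y Y1 Z : finType) (W : X -> X1 -> Y -> Y1 -> Z -> R)
    (N M0 M1 : nat) (beta lo hi : R) : (forall x x1 y y1 z, 0 <= W x x1 y y1 z) ->
  (0 < N)%N -> (0 < M0)%N -> (0 < M1)%N -> code_with W N M0 M1 beta lo hi ->
  exists c : code X X1 Y Y1 Z N M0 M1, [/\ valid_code c, Pe1 W c <= beta, Pe2 W c <= beta
    & lo <= N%:R * (equivocation W c * exp.ln 2) <= hi].
Proof.
move=> W0 N0 M00 M10 [enc [rel [d1 [d2 [e0 e1 causal [p1 p2 l h]]]]]].
exists (det_code enc rel d1 d2); split.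
- exact: det_code_valid.
- by rewrite Pe1E.
- by rewrite Pe2E.
- by rewrite equivocationE // l h.
Qed.

(** * Diagonal extraction *)

Section Diagonal.
Variables (X X1 Y Y1 Z : finType) (W : X -> X1 -> Y -> Y1 -> Z -> R).
Variables (R0 R1 Re : R).

(** The sizes of the message sets are packed with the code, so that one choice for each length
    yields all three sequences. *)
Definition any_code (N : nat) := {p : nat * nat & code X X1 Y Y1 Z N p.1 p.2}.

Definition close_code (del : R) (N : nat) (s : any_code N) :=
  [/\ valid_code (projT2 s), `|log2 (INR (projT1 s).1) / INR N - R0| <= del,
      `|log2 (INR (projT1 s).2) / INR N - R1| <= del,
      `|equivocation W (projT2 s) - Re| <= del &
      Pe1 W (projT2 s) <= del /\ Pe2 W (projT2 s) <= del].

Lemma close_weaken del del' N (s : any_code N) :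
  del <= del' -> close_code del s -> close_code del' s.
Proof.
move=> le [v a b c [d e]].
by split; rewrite ?(le_trans _ le) //; split; rewrite (le_trans _ le).
Qed.

(** Validity is required at every length, including those too short for a good code. *)
Lemma trivial_code (x0 : X) (a0 : X1) N : exists s : any_code N, valid_code (projT2 s).
Proof.
exists (existT (fun p => code X X1 Y Y1 Z N p.1 p.2) (1%N, 1%N)
  (det_code (fun _ _ x => (x == [ffun=> x0])%:R) (fun _ _ => a0)
     (fun _ => (ord0, ord0)) (fun _ => ord0))).
apply: det_code_valid => // w0 w1.
rewrite (bigD1 [ffun=> x0]) //= eqxx big1 ?addr0 // => x /negbTE ->; exact: erefl.
Qed.

Hypothesis near : forall del : R, 0 < del ->
  exists N0, forall N, (N0 <= N)%N -> exists s : any_code N, close_code del s.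

(* The rates have to be exact in the limit along a single sequence of codes, so the
   accuracy must tend to 0 with the length. *)
Lemma best_code (x0 : X) (a0 : X1) N : exists s : any_code N, valid_code (projT2 s) /\
  forall k, (k <= N)%N -> (exists s' : any_code N, close_code k.+1%:R^-1 s') ->
    close_code k.+1%:R^-1 s.
Proof.
suff H m : exists s : any_code N, valid_code (projT2 s) /\
  forall k, (k < m)%N -> (exists s' : any_code N, close_code k.+1%:R^-1 s') ->
    close_code k.+1%:R^-1 s.
  by have [s [v Hs]] := H N.+1; exists s.
elim: m => [|m [s [v Hs]]]; first by have [s v] := trivial_code x0 a0 N; exists s.
have [[s' cs']|no] := pselect (exists s' : any_code N, close_code m.+1%:R^-1 s').
  exists s'; split; first by case: cs'.
  move=> k km _; apply: close_weaken cs'.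
  by rewrite lef_pV2 ?posrE ?ltr0n // ler_nat.
exists s; split => // k; rewrite ltnS leq_eqVlt => /orP[/eqP -> //|]; exact: Hs.
Qed.

Lemma diagonal (x0 : X) (a0 : X1) (eps : R) : 0 < eps ->
  exists (M0 M1 : nat -> nat) (c : forall N : nat, code X X1 Y Y1 Z N (M0 N) (M1 N)),
    (forall N, valid_code (c N)) /\
    Un_cv (fun N => Rdiv (log2 (INR (M0 N))) (INR N)) R0 /\
    Un_cv (fun N => Rdiv (log2 (INR (M1 N))) (INR N)) R1 /\
    Un_cv (fun N => equivocation W (c N)) Re /\
    (exists N0 : nat, forall N : nat, (N0 <= N)%N -> Pe1 W (c N) <= eps /\ Pe2 W (c N) <= eps).
Proof.
move=> eps0.
pose s N := sval (cid (best_code x0 a0 N)).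
have sP N : valid_code (projT2 (s N)) /\ forall k, (k <= N)%N ->
    (exists s' : any_code N, close_code k.+1%:R^-1 s') -> close_code k.+1%:R^-1 (s N).
  exact: svalP (cid (best_code x0 a0 N)).
have ev (e : R) : 0 < e -> exists N0, forall N, (N0 <= N)%N -> close_code e (s N).
  move=> e0; pose k := Num.truncn e^-1.
  have ke : k.+1%:R^-1 <= e.
    by rewrite -[leRHS]invrK lef_pV2 ?posrE ?invr_gt0 // ltW // truncnS_gt.
  have [|N0 N0P] := near (del := k.+1%:R^-1); first by rewrite invr_gt0.
  exists (maxn N0 k) => N; rewrite geq_max => /andP[h1 h2].
  by apply: (close_weaken ke); apply: (proj2 (sP N)) => //; exact: N0P.
have cv (u : nat -> R) (l : R) : (forall e : R, 0 < e -> exists N0, forall N, (N0 <= N)%N ->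
    `|u N - l| <= e) -> Un_cv u l.
  move=> H e /RltP e0; have e20 : 0 < e / 2 by rewrite divr_gt0.
  have [N0 N0P] := H _ e20; exists N0 => n /ssrnat.leP nN.
  apply/RltP; rewrite RdistE; apply: le_lt_trans (N0P _ nN) _.
  by rewrite ltr_pdivrMr // ltr_pMr // ltr1n.
exists (fun N => (projT1 (s N)).1), (fun N => (projT1 (s N)).2), (fun N => projT2 (s N)).
split; first by move=> N; case: (sP N).
split.
  by apply: cv => e /ev[N0 H]; exists N0 => N /H[]; rewrite RdivE.
split.
  by apply: cv => e /ev[N0 H]; exists N0 => N /H[_ _ +]; rewrite RdivE.
split; first by apply: cv => e /ev[N0 H]; exists N0 => N /H[].
by have [N0 H] := ev _ eps0; exists N0 => N /H[].
Qed.

End Diagonal.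

(** * The decode-and-forward region *)

(* [Re'] is the secret rate, and the exact limit of the equivocation; [Ra] is the part of
   the confidential message sent in the common layer, [Rb] the part which, together with
   dummy bits of rate [Rq], plays the role of the wiretap randomization. *)
Lemma rate_split (F : realType) (R0 R1 Re M IS IG : F) : 0 < R0 -> 0 < R1 -> 0 < Re ->
  Re <= R1 -> R0 <= M -> R0 + R1 <= M + IS -> Re <= IS - IG -> 0 <= IG ->
  exists Re' Ra Rb Rq, [/\ Re <= Re', 0 <= Ra, 0 <= Rb, 0 <= Rq &
    [/\ Ra + Re' + Rb = R1, R0 + Ra <= M, Re' + Rb + Rq <= IS & Rb + Rq = IG]].
Proof.
move=> R00 R10 Re0 ReR1 R0M sumM ReI IG0.
(* The confidential message first fills the secret rate [IS - IG]; any surplus replaces dummy bits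
   up to [IG], and what still remains goes to the common layer. *)
have [c|c] := lerP R1 (IS - IG).
  by exists R1, 0, 0, IG; split => //; split; lra.
have [c'|c'] := lerP (R1 - (IS - IG)) IG.
  by exists (IS - IG), 0, (R1 - (IS - IG)), (IG - (R1 - (IS - IG))); split; first (by []);
    try split; lra.
by exists (IS - IG), (R1 - IS), IG, 0; split => //; try split; lra.
Qed.

Lemma scale_dist (F : realType) (x n r d l : F) : 0 < n -> 0 < l ->
  `|x - n * (r * l)| <= n * (d * l) -> `|x / l / n - r| <= d.
Proof.
move=> n0 l0 H.
have -> : x / l / n - r = (x - n * (r * l)) / (n * l) by field; rewrite !gt_eqF.
have nl0 : 0 < n * l by exact: mulr_gt0.
rewrite normrM [`|(n * l)^-1|]gtr0_norm ?invr_gt0 // ler_pdivrMr //.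
by apply: (le_trans H); rewrite mulrCA.
Qed.

Lemma scale_itv (F : realType) (e n r d l : F) : 0 < n -> 0 < l ->
  n * (r * l - d * l) <= n * (e * l) <= n * (r * l + d * l) -> `|e - r| <= d.
Proof.
move=> n0 l0; rewrite !ler_pM2l // -mulrBl -mulrDl !ler_pM2r // => /andP[h1 h2].
by rewrite ler_norml; apply/andP; split; lra.
Qed.

Lemma sum_eq1_inhabited (F : realType) (T : finType) (f : T -> F) : \sum_t f t = 1 -> T.
Proof.
move=> H; have [t _|T0] := pickP (@predT T); first exact: t.
by move: H; rewrite big_pred0 // => /esym/eqP; rewrite oner_eq0.
Qed.

(** Chain rule: [X], then [V], then [U] are split off from the successive marginals, which leaves
    the law of the relay letter. *)
Lemma factor_inputs (F : realType) (U V X X1 : finType) (u0 : U) (v0 : V) (x0 : X)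
    (q : U -> V -> X -> X1 -> F) : (forall u v x a, 0 <= q u v x a) ->
  \sum_u \sum_v \sum_x \sum_a q u v x a = 1 ->
  exists (PA : X1 -> F) (KB : X1 -> U -> F) (KC : X1 -> U -> V -> F)
    (KX : X1 -> U -> V -> X -> F),
  [/\ (forall a, 0 <= PA a) /\ \sum_a PA a = 1,
      (forall a b, 0 <= KB a b) /\ (forall a, \sum_b KB a b = 1),
      (forall a b c, 0 <= KC a b c) /\ (forall a b, \sum_c KC a b c = 1),
      (forall a b c x, 0 <= KX a b c x) /\ (forall a b c, \sum_x KX a b c x = 1) &
      forall u v x a, q u v x a = letter_law PA KB KC (a, u, v) * KX a u v x].
Proof.
move=> q0 q1.
have [KX [KX0 KX1 KXE]] := @kernel_exists F (X1 * U * V)%type X x0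
  (fun t x => q t.1.2 t.2 x t.1.1) (fun t x => q0 _ _ _ _).
have s3 (t : X1 * U * V) : 0 <= \sum_x q t.1.2 t.2 x t.1.1 by apply: sumr_ge0.
have [KC [KC0 KC1 KCE]] := @kernel_exists F (X1 * U)%type V v0
  (fun t v => \sum_x q t.2 v x t.1) (fun t v => s3 (t, v)).
have s2 (t : X1 * U) : 0 <= \sum_v \sum_x q t.2 v x t.1.
  by apply: sumr_ge0 => v _; exact: (s3 (t, v)).
have [KB [KB0 KB1 KBE]] := @kernel_exists F X1 U u0
  (fun a u => \sum_v \sum_x q u v x a) (fun a u => s2 (a, u)).
exists (fun a => \sum_u \sum_v \sum_x q u v x a), KB, (fun a u => KC (a, u)),
  (fun a u v => KX (a, u, v)); split => //.
  split; first by move=> a; apply: sumr_ge0 => u _; exact: (s2 (a, u)).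
  rewrite -q1 exchange_big; apply: eq_bigr => u _ /=.
  rewrite exchange_big; apply: eq_bigr => v _ /=.
  by rewrite exchange_big.
move=> u v x a; rewrite (KXE (a, u, v) x) /= (KCE (a, u) v) /= (KBE a u).
by rewrite /letter_law.
Qed.

Local Open Scope R_scope.

Theorem theorem10 (X X1 Y Y1 Z U V : finType)
  (W : X -> X1 -> Y -> Y1 -> Z -> R) (HW : is_channel W)
  (PUV : U -> V -> R) (HPUV : is_pmf2 PUV)
  (PX : U -> V -> X -> X1 -> R) (HPX : is_cond2 PX)
  (R0 R1 Re : R) :
  let p := joint7 PUV PX W in
  let M := Rmin (cond_mutinfo p prU prY1 prX1)
             (Rmin (mutinfo p prUX1 prY) (mutinfo p prUX1 prZ)) in
  0 < R0 -> 0 < R1 -> 0 < Re ->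
  Re <= R1 ->
  R0 <= M ->
  R0 + R1 <= M + cond_mutinfo p prV prY prUX1 ->
  Re <= cond_mutinfo p prV prY prUX1 - cond_mutinfo p prV prZ prUX1 ->
  achievable W R0 R1 Re.
Proof.
move=> p M hR0 hR1 hRe /RleP hReR1 /RleP hR0M /RleP hsum /RleP hReI.
split; first exact: hR0; split; first exact: hR1; split; first exact: hRe.
move=> eps /RltP eps0.
move/RltP in hR0; move/RltP in hR1; move/RltP in hRe.
have [HW0 HW1] := HW; have [HP0 HP1] := HPUV; have [HX0 HX1] := HPX.
have W0 x x1 y y1 z : (0 <= W x x1 y y1 z)%R by apply/RleP; exact: HW0.
have W1 x x1 : (\sum_(t : Y * Y1 * Z) W x x1 t.1.1 t.1.2 t.2 = 1)%R by exact: HW1.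
have uv0 : (U * V)%type by exact: sum_eq1_inhabited (HP1 : (\sum_t _ = 1)%R).
have xx0 : (X * X1)%type by exact: sum_eq1_inhabited (HX1 uv0.1 uv0.2 : (\sum_t _ = 1)%R).
have yy0 : (Y * Y1 * Z)%type by exact: sum_eq1_inhabited (W1 xx0.1 xx0.2).
pose o0 : out X Y Y1 Z := (xx0.1, yy0.1.1, yy0.1.2, yy0.2).
pose q u v x a : R := (PUV u v * PX u v x a)%R.
have q0 u v x a : (0 <= q u v x a)%R by apply: mulr_ge0; apply/RleP.
have q1 : (\sum_u \sum_v \sum_x \sum_a q u v x a = 1)%R.
  rewrite pair_bigA /= -[RHS](HP1 : (\sum_(t : U * V) PUV t.1 t.2 = 1)%R).
  apply: eq_bigr => -[u v] _ /=; rewrite pair_bigA /= -mulr_sumr.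
  by rewrite (HX1 u v : (\sum_(t : X * X1) PX u v t.1 t.2 = 1)%R) mulr1.
have [PA [KB [KC [KX [[PA0 PA1] [KB0 KB1] [KC0 KC1] [KX0 KX1] qE]]]]] :=
  factor_inputs uv0.1 uv0.2 xx0.1 q0 q1.
have k1 l : (\sum_o kernel W KX l o = 1)%R by exact: kernel_total.
have mi := @cond_mutinfoE X X1 Y Y1 Z U V W PUV PX PA KB KC KX W0 PA0 KB0 KC0 KX0 qE.
pose pl := letter_law PA KB KC; pose kern := kernel W KX.
have mR : cond_mutinfo p prU prY1 prX1
   = (info pl kern (@letter_U X1 U V) (@letter_A X1 U V) (@out_y1 X Y Y1 Z) / exp.ln 2)%R.
  exact: mi.
have m1 : mutinfo p prUX1 prY
   = (info pl kern (@letter_UA X1 U V) (@letter_tt X1 U V) (@out_y X Y Y1 Z) / exp.ln 2)%R.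
  exact: mi.
have m2 : mutinfo p prUX1 prZ
   = (info pl kern (@letter_UA X1 U V) (@letter_tt X1 U V) (@out_z X Y Y1 Z) / exp.ln 2)%R.
  exact: mi.
have mS : cond_mutinfo p prV prY prUX1
   = (info pl kern (@letter_V X1 U V) (@letter_UA X1 U V) (@out_y X Y Y1 Z) / exp.ln 2)%R.
  exact: mi.
have mG : cond_mutinfo p prV prZ prUX1
   = (info pl kern (@letter_V X1 U V) (@letter_UA X1 U V) (@out_z X Y Y1 Z) / exp.ln 2)%R.
  exact: mi.
have l0 : (0 < exp.ln 2 :> R)%R by rewrite ln_gt0 // ltr1n.
have IG0 : (0 <= cond_mutinfo p prV prZ prUX1)%R.
  rewrite mG; apply: divr_ge0; last exact: ltW.
  exact: info_leak_ge0.
have [Re' [Ra [Rb [Rq [ReRe' Ra0 Rb0 Rq0 [sumR1 leM leS eqG]]]]]] :=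
  rate_split hR0 hR1 hRe hReR1 hR0M hsum hReI IG0.
have Re'0 : (0 <= Re')%R by apply: le_trans ReRe'; exact: ltW.
move: leM; rewrite /M !RminE !le_min => /andP[leMR /andP[leM1 leM2]].
suff near : forall del : R, (0 < del)%R -> exists N0, forall N, (N0 <= N)%N ->
    exists s : any_code X X1 Y Y1 Z N, close_code W R0 R1 Re' del s.
  have [M0 [M1 [c [h1 [h2 [h3 [h4 h5]]]]]]] := diagonal near xx0.1 xx0.2 eps0.
  exists M0, M1, c; split=> //; split=> //; split=> //; split.
    by exists Re'; split => //; apply/RleP.
  by have [N0 H] := h5; exists N0 => N /H[a b]; split; apply/RleP.
move=> del del0.
(* Capped so that [d * ln 2], the tolerance in nats, is at most 1 as [asymptotic_code] asks. *)
pose d := Num.min 1%R del.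
have d0 : (0 < d)%R by rewrite lt_min ltr01.
have d1 : (d <= 1)%R by rewrite ge_min lexx.
have dd : (d <= del)%R by rewrite ge_min lexx orbT.
have dl : (0 < d * exp.ln 2 <= 1)%R.
  by rewrite mulr_gt0 //= mulr_ile1 ?(ltW d0) ?(ltW l0) // ln2_le1.
have dld : (d * exp.ln 2 <= d)%R by rewrite ler_piMr ?(ltW d0) // ln2_le1.
have ml (r : R) : (0 <= r)%R -> (0 <= r * exp.ln 2)%R.
  by move=> r_ge0; exact: mulr_ge0 r_ge0 (ltW l0).
have [||||||||||N0 N0P] := asymptotic_code W0 W1 PA0 PA1 KB0 KB1 KC0 KC1 KX0 KX1 o0
  (r0 := (R0 * exp.ln 2)%R) (ra := (Ra * exp.ln 2)%R) (rs := (Re' * exp.ln 2)%R)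
  (rd := (Rb * exp.ln 2)%R) (rq := (Rq * exp.ln 2)%R) _ _ _ _ _ _ _ _ _ _ dl.
- exact/ml/ltW.
- exact: ml.
- exact: ml.
- exact: ml.
- exact: ml.
- by rewrite -mulrDl -ler_pdivlMr // -mR.
- by rewrite -mulrDl -ler_pdivlMr // -m1.
- by rewrite -mulrDl -ler_pdivlMr // -m2.
- by rewrite -!mulrDl -ler_pdivlMr // -mS.
- by rewrite -mulrDl eqG mG mulfVK // gt_eqF.
(* Length 0 is excluded, because rates and equivocation are divided by [N]. *)
exists (maxn N0 1) => N; rewrite geq_max => /andP[NN0 N1].
have [M0 [M1 [M00 M10 b0 b1 cw]]] := N0P N NN0.
have [c [vc p1 p2 eqv]] := code_of_code_with W0 N1 M00 M10 cw.
have Npos : (0 < N%:R :> R)%R by rewrite ltr0n.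
exists (existT (fun m => code X X1 Y Y1 Z N m.1 m.2) (M0, M1) c); split => //=.
- rewrite log2E !INRE; apply: le_trans dd; exact: scale_dist b0.
- rewrite log2E !INRE; apply: le_trans dd; apply: (scale_dist Npos l0).
  by rewrite -!mulrDl sumR1 in b1.
- by apply: le_trans dd; exact: scale_itv eqv.
- by split; [apply: (le_trans p1)|apply: (le_trans p2)]; exact: le_trans dld dd.
Qed.
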